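(* Let $A$ be a real isotropic $d\times d$ dilation matrix, let $m\ge1$, and let $\phi^m$ be the corresponding elliptic scaling function of order $m$. Then the integer shifts of $\phi^m$ form a partition of unity: $$\sum_{k\in\mathbb{Z}^d}\phi^m(x-k)=1$$ (in the sense of tempered distributions on $\mathbb{R}^d$).
   Context: A real isotropic dilation matrix is a $d\times d$ matrix $A$ with integer entries, all of whose eigenvalues are greater than $1$ in absolute value, which is diagonalizable over $\mathbb{C}$ and all of whose eigenvalues have equal absolute value. Put $q:=|\det A|$ and $A^{-T}:=(A^T)^{-1}$. One can factor $A^{-T}=q^{-1/d}Q^{-1}UQ$ with $U$ real orthogonal and $Q$ real symmetric positive definite; fix such a $Q$ and write $Q^2=(q_{ij})_{1\le i,j\le d}$. Define $$P(\xi):=\xi^TQ^2\xi=\sum_{i} q_{ii}\xi_i^2+2\sum_{i<j}q_{ij}\xi_i\xi_j,\qquad G(\xi):=4\sum_{i} q_{ii}\sin^2\frac{\xi_i}{2}+2\sum_{i<j}q_{ij}\sin\xi_i\sin\xi_j .$$ Let $S(A^T):=\{s\in[0,1)^d: A^Ts\in\mathbb{Z}^d\}$ (this set has $q$ elements and contains $0$), and define the mask $$m_0(\xi):=\prod_{s\in S(A^T)\setminus\{0\}}\frac{G(\xi+2\pi s)}{G(2\pi s)}.$$ Define $$\mu(\xi):=\frac{q^{2/d}\,m_0(A^{-T}\xi)\,G(A^{-T}\xi)}{G(\xi)},$$ where at the points of $2\pi\mathbb{Z}^d$ (zeros of $G$) the value is understood as the limit, and $M(\xi):=\prod_{j=0}^\infty\mu\bigl((A^{-T})^j\xi\bigr)$.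 The elliptic scaling function $\phi$ is the tempered distribution with $\hat\phi(\xi)=\prod_{j=1}^\infty m_0((A^{-T})^j\xi)=\frac{G(\xi)}{P(\xi)}M(\xi)$ (with $G/P:=1$ at $\xi=0$); it is compactly supported. The elliptic scaling function of order $m$ is $\phi^1:=\phi$, $\phi^m:=\phi*\phi^{m-1}$, i.e. $\hat\phi^m(\xi)=(\hat\phi(\xi))^m$. The Fourier transform is $\hat f(\xi)=\int_{\mathbb{R}^d} f(x)e^{-i\xi\cdot x}\,dx$. *)

(* Defs.v *)
From HB Require Import structures.
From mathcomp Require Import all_boot all_order all_algebra finmap.
From mathcomp Require Import all_classical all_reals all_analysis.
From mathcomp.analysis.showcase Require Import summability.
From mathcomp.real_closed Require Import complex.

Set Implicit Arguments.
Unset Strict Implicit.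
Unset Printing Implicit Defensive.

Import Order.TTheory GRing.Theory Num.Theory.
Import numFieldNormedType.Exports.

Local Open Scope classical_set_scope.
Local Open Scope ring_scope.

Section Dilation.
Variables (R : realType) (d : nat).

Definition real_isotropic_dilation (A : 'M[int]_d) : Prop :=
  let B : 'M[R[i]]_d := map_mx intr A in
  [/\ forall l, eigenvalue B l -> 1 < `|l|,
      diagonalizable B &
      forall l l', eigenvalue B l -> eigenvalue B l' -> `|l| = `|l'|].

Definition real_tr (A : 'M[int]_d) : 'M[R]_d := (map_mx intr A)^T.

Definition inv_tr (A : 'M[int]_d) : 'M[R]_d := invmx (real_tr A).

(* [Q] is an admissible choice in A^-T = q^(-1/d) Q^-1 U Q, q = |det A|. *)
Definition isotropic_factor (A : 'M[int]_d) (Q : 'M[R]_d) : Prop :=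
  [/\ Q^T = Q,
      forall v : 'cV[R]_d, v != 0 -> 0 < (v^T *m Q *m v) 0 0 &
      exists2 U : 'M[R]_d, U^T *m U = 1%:M &
        inv_tr A =
          (`|\det A|%N%:R `^ (- d%:R^-1)) *: (invmx Q *m U *m Q)].

(* 2 pi-periodic analogue of the quadratic form xi^T Q^2 xi; it vanishes exactly on
   2 pi Z^d, so no denominator in [elliptic_mask] is zero. *)
Definition trig_form (Q : 'M[R]_d) (xi : 'cV[R]_d) : R :=
  4 * (\sum_i (Q *m Q) i i * sin (xi i 0 / 2) ^+ 2) +
  2 * (\sum_(i < d) \sum_(j < d | (i < j)%N) (Q *m Q) i j * sin (xi i 0) * sin (xi j 0)).

Definition dual_digits (A : 'M[int]_d) : set 'cV[R]_d :=
  [set s : 'cV[R]_d | (forall i, 0 <= s i 0 < 1) /\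
           exists k : 'cV[int]_d, real_tr A *m s = map_mx intr k].

(* [dual_digits A] is finite, so the finitely supported product ranges over all of it. *)
Definition elliptic_mask (A : 'M[int]_d) (Q : 'M[R]_d) (xi : 'cV[R]_d) : R :=
  \big[*%R/1]_(s \in dual_digits A `\ 0)
    (trig_form Q (xi + (2 * pi) *: s) / trig_form Q ((2 * pi) *: s)).

Definition scaling_symbol (A : 'M[int]_d) (Q : 'M[R]_d) (xi : 'cV[R]_d) : R :=
  lim ((fun n : nat =>
    \prod_(1 <= j < n.+1) elliptic_mask A Q (inv_tr A ^+ j *m xi)) @ \oo).

End Dilation.

Section Schwartz.
Variable R : realType.

(* Integration one coordinate at a time with respect to the Lebesgue measure.
   By Fubini this is the Lebesgue integral over R^d on absolutely integrable
   functions. *)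
Fixpoint integralR (d : nat) : ('cV[R]_d -> R) -> R :=
  match d with
  | 0 => fun f => f 0
  | n.+1 => fun f =>
      \int[@lebesgue_measure R]_t
        integralR (fun v : 'cV[R]_n => f (col_mx (t%:M : 'cV[R]_1) v))
  end.

Definition integralC (d : nat) (f : 'cV[R]_d -> R[i]) : R[i] :=
  (integralR (fun x => complex.Re (f x)) +i* integralR (fun x => complex.Im (f x)))%C.

Variable d : nat.

Definition iter_partial (s : seq 'I_d) (f : 'cV[R]_d -> R) : 'cV[R]_d -> R :=
  foldr (fun i g x => 'D_(delta_mx i 0) g x) f s.

Definition smooth (f : 'cV[R]_d -> R) : Prop :=
  forall s x, differentiable (iter_partial s f) x.

(* All Schwartz seminorms sup_x |x|^p |D^s f(x)| with p, |s| <= N are at most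
   B.  [`|x|] is the sup norm on R^d. *)
Definition seminorm_le (N : nat) (B : R) (f : 'cV[R]_d -> R[i]) : Prop :=
  forall (p : nat) (s : seq 'I_d) (x : 'cV[R]_d),
    (p <= N)%N -> (size s <= N)%N ->
    `|x| ^+ p * `|iter_partial s (fun y => complex.Re (f y)) x| <= B /\
    `|x| ^+ p * `|iter_partial s (fun y => complex.Im (f y)) x| <= B.

Definition schwartz (f : 'cV[R]_d -> R[i]) : Prop :=
  [/\ smooth (fun x => complex.Re (f x)), smooth (fun x => complex.Im (f x)) &
      forall N, exists B, seminorm_le N B f].

Definition fourier (f : 'cV[R]_d -> R[i]) (xi : 'cV[R]_d) : R[i] :=
  integralC (fun x =>
    let t := \sum_i xi i 0 * x i 0 in f x * (cos t -i* sin t)%C).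

(* Functionals are total; only their values on Schwartz functions matter. *)
Definition functional := ('cV[R]_d -> R[i]) -> R[i].

Definition tempered (T : functional) : Prop :=
  (forall (a : R[i]) f g, schwartz f -> schwartz g ->
     T (fun x => a * f x + g x) = a * T f + T g) /\
  (exists (N : nat) (C : R), forall (f : 'cV[R]_d -> R[i]) (B : R),
     schwartz f -> seminorm_le N B f -> `|T f| <= (C * B)%:C%C).

Definition regular (g : 'cV[R]_d -> R[i]) : functional :=
  fun f => integralC (fun x => g x * f x).

Definition fourier_dist (T : functional) : functional :=
  fun f => T (fourier f).

Definition eq_dist (T1 T2 : functional) : Prop :=
  forall f, schwartz f -> T1 f = T2 f.

(* The distribution T(x - h). *)
Definition translate (h : 'cV[R]_d) (T : functional) : functional :=
  fun f => T (fun x => f (x + h)).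

(* <T1 * T2, f> = <T1(x), <T2(y), f(x + y)>>; for compactly supported T2 the
   inner pairing is again a Schwartz function of x. *)
Definition convolution (T1 T2 : functional) : functional :=
  fun f => T1 (fun x => T2 (fun y => f (x + y))).

(* T * (T * ... * T) with m factors; only meaningful for m >= 1. *)
Definition conv_power (T : functional) (m : nat) : functional :=
  iter m.-1 (convolution T) T.

(* Weak convergence in S' of the net of partial sums over finite subsets of I. *)
Definition dist_sum (I : choiceType) (u : I -> functional) (T : functional) :
    Prop :=
  forall f, schwartz f ->
    partial_sum (fun i => u i f) @ totally --> (T f : (R[i] : numFieldType)).

(* The tempered distribution whose Fourier transform is the function
   [scaling_symbol A Q]. *)
Definition elliptic_scaling_function (A : 'M[int]_d) (Q : 'M[R]_d)
    (phi : functional) : Prop :=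
  tempered phi /\
  eq_dist (fourier_dist phi) (regular (fun xi => (scaling_symbol A Q xi)%:C%C)).

End Schwartz.

(* Main.v *)
From mathcomp Require Import all_boot all_order all_algebra finmap.
From mathcomp Require Import all_classical all_reals all_analysis.
From mathcomp Require Import measurable_realfun ring lra.
From mathcomp.analysis.showcase Require Import summability.
Require Import Defs.
From mathcomp.real_closed Require Import complex.

(** Write S for the symbol [scaling_symbol A Q], S_n for the finite products
    [partial_symbol A Q n] converging to it, and Phi f for the function
    x |-> phi (f (x + .)).  Unfolding the convolutions, the translate by k of the m-fold
    convolution power takes the value (Phi^m f)(k) at f ([conv_power_Phi]).  So the theorem
    says that the sum of Phi^m f over Z^d is the integral of f.

    Formally Phi multiplies the Fourier transform by S(- .).  At the origin S is 1, because
    the mask is 1 there.  At 2 pi l with l a nonzero integral vector S is 0: the matrix A^-T is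
    contracting, so the orbit of l under A^-T leaves Z^d, and the mask vanishes at 2 pi A^-T k
    as soon as k is integral and A^-T k is not ([partial_symbol_lattice]).  Hence Phi preserves
    the integral and annihilates the Fourier coefficients at the nonzero frequencies 2 pi l,
    and Poisson summation ([poisson_summation]) gives the claim.

    The point that needs work is that Phi f is again a Schwartz function, with the
    expected Fourier coefficients ([Phi_schC], [Phi_coefficient]).  Each S_n is a trigonometric
    polynomial, so the corresponding operator [approx n] is a finite combination of
    translations.  Every Schwartz function is the Fourier transform of a Schwartz function g
    ([schC_fourier_surj]), and phi is known on those: it is the integral of S g.  The
    estimates of [partial_symbol_estimates] say that S_n tends to S geometrically, and that weighting the
    coefficients of S_n by the k-th powers of the frequencies gives sums which, uniformly in n,
    are at most K a^k times a fixed polynomial in xi.  The first fact shows that [approx n f]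
    tends to Phi f, the second that the functions [approx n f] decay rapidly, uniformly in n.
    Decay, derivatives and Fourier coefficients therefore pass to the limit.

    Poisson summation is proved for functions whose Fourier coefficients vanish at all nonzero
    integers.  On the line, integration against a Fejer kernel does not change the
    integral and concentrates near the integers ([lattice_sum1_approx]).  In higher
    dimension, summing over the first coordinate yields a function of the other coordinates
    of the same kind ([lattice_sum_step]).

    Integrals over R^d are iterated one-dimensional integrals.  They are handled on the class
    [wlip] of functions that are bounded and Lipschitz in each coordinate relative to the
    product of the weights 1 / (1 + x_i^2), which is stable under slicing and under
    integration of a coordinate.  Fourier inversion is proved on the line, by comparison with
    a Gaussian ([inversion1]), and applied to one coordinate after the other. *)

Set Implicit Arguments.
Unset Strict Implicit.
Unset Printing Implicit Defensive.
Import Order.TTheory GRing.Theory Num.Theory.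
Import numFieldNormedType.Exports.
Local Open Scope classical_set_scope.
Local Open Scope ring_scope.

(** * Integrals on the line against the weight 1 / (1 + t^2) *)

Lemma eq_ler (R : numDomainType) (x y : R) : x = y -> x <= y.
Proof. by move=> ->. Qed.

Lemma norm_cvg_le (R : realType) (u : nat -> R) (l b : R) n0 : u @ \oo --> l ->
  (forall n, (n0 <= n)%N -> `|u n| <= b) -> `|l| <= b.
Proof.
move=> ul ub; have h : (fun n => `|u n|) @ \oo --> `|l| by exact: cvg_norm.
rewrite -(cvg_lim (@Rhausdorff R) h); apply: limr_le; first by apply/cvg_ex; exists `|l|.
by exists n0.
Qed.

Section OneDim.
Variable R : realType.
Implicit Types (f g F : R -> R) (t C : R).
Notation mu := (@lebesgue_measure R).

Definition w1 t : R := (1 + t ^+ 2)^-1.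

Lemma w1_gt0 t : 0 < w1 t.
Proof. by rewrite invr_gt0 ltr_wpDr// ?sqr_ge0. Qed.

Lemma w1_ge0 t : 0 <= w1 t. Proof. exact/ltW/w1_gt0. Qed.

Lemma w1_le1 t : w1 t <= 1.
Proof. by rewrite invf_le1 ?lerDl ?sqr_ge0// ltr_wpDr// sqr_ge0. Qed.

Lemma w1_continuous : continuous w1.
Proof. exact: (@continuous_oneDsqrV R). Qed.

(** Continuity provides measurability and primitives, the bound integrability and domination. *)
Definition tame f := continuous f /\ exists C, forall t, `|f t| <= C * w1 t.

Lemma w1_tame : tame w1.
Proof.
split; first exact: w1_continuous.
by exists 1 => t; rewrite mul1r ger0_norm// w1_ge0.
Qed.

Lemma w1_integrable : mu.-integrable [set: R] (EFin \o w1).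
Proof.
have mw : measurable_fun [set: R] (EFin \o w1).
  apply/measurable_EFinP; apply: continuous_measurable_fun.
  exact: w1_continuous.
apply/integrableP; split => //.
under eq_integral do rewrite /= ger0_norm ?w1_ge0//.
rewrite ge0_symfun_integralT //; last 3 first.
- exact: w1_ge0.
- exact: w1_continuous.
- by move=> x /=; rewrite /w1 sqrrN.
rewrite -set_itvcy (@integral0y_oneDsqr R) -EFinM ltry//.
Qed.

Lemma dominated_integrable_w1 f C :
  measurable_fun [set: R] f -> (forall t, `|f t| <= C * w1 t) ->
  mu.-integrable [set: R] (EFin \o f).
Proof.
move=> mf fC.
apply: (@le_integrable _ _ _ mu [set: R] _ _ (fun t => (C * w1 t)%:E)) => //.
- exact/measurable_EFinP.
- by move=> t _ /=; rewrite lee_fin (le_trans (fC t))// ler_norm.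
- by under eq_fun do rewrite EFinM; exact/integrableZl/w1_integrable.
Qed.

Lemma tame_integrable f : tame f -> mu.-integrable [set: R] (EFin \o f).
Proof.
move=> [cf [C fC]]; apply: (dominated_integrable_w1 (C := C)) => //.
exact: continuous_measurable_fun.
Qed.

Lemma tameD f g : tame f -> tame g -> tame (fun t => f t + g t).
Proof.
move=> [cf [C fC]] [cg [D gD]]; split.
  by move=> x; apply: cvgD; [exact: cf|exact: cg].
exists (C + D) => t; rewrite mulrDl (le_trans (ler_normD _ _))// lerD//.
Qed.

Lemma tameZ a f : tame f -> tame (fun t => a * f t).
Proof.
move=> [cf [C fC]]; split; first by move=> x; apply: cvgMl_tmp; exact: cf.
by exists (`|a| * C) => t; rewrite normrM -mulrA ler_wpM2l.
Qed.

Lemma tameN f : tame f -> tame (fun t => - f t).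
Proof. by move=> /(tameZ (-1)); under eq_fun do rewrite mulN1r. Qed.

Lemma tameB f g : tame f -> tame g -> tame (fun t => f t - g t).
Proof. by move=> tf /tameN; exact: tameD. Qed.

Lemma tame_mul_bounded f b B : tame f -> continuous b ->
  (forall t, `|b t| <= B) -> tame (fun t => f t * b t).
Proof.
move=> [cf [C fC]] cb bB; split.
  by move=> x; apply: cvgM; [exact: cf|exact: cb].
exists (C * B) => t; rewrite normrM mulrAC ler_pM//.
Qed.

Definition Int f : R := \int[mu]_t f t.

Lemma IntD f g : tame f -> tame g -> Int (fun t => f t + g t) = Int f + Int g.
Proof. by move=> tf tg; rewrite /Int RintegralD//; exact: tame_integrable. Qed.

Lemma IntB f g : tame f -> tame g -> Int (fun t => f t - g t) = Int f - Int g.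
Proof. by move=> tf tg; rewrite /Int RintegralB//; exact: tame_integrable. Qed.

Lemma IntZ a f : tame f -> Int (fun t => a * f t) = a * Int f.
Proof. by move=> tf; rewrite /Int RintegralZl//; exact: tame_integrable. Qed.

Lemma IntN f : tame f -> Int (fun t => - f t) = - Int f.
Proof.
by move=> tf; rewrite -mulN1r -IntZ//; under [in RHS]eq_fun do rewrite mulN1r.
Qed.

Lemma le_Int f g : tame f -> tame g -> (forall t, f t <= g t) -> Int f <= Int g.
Proof. by move=> tf tg fg; apply: le_Rintegral => //; exact: tame_integrable. Qed.

Lemma Int_le f C : tame f -> (forall t, `|f t| <= C * w1 t) ->
  `|Int f| <= C * Int w1.
Proof.
move=> tf fC; have tC := tameZ C w1_tame.
rewrite -IntZ ?ler_norml; last exact: w1_tame.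
rewrite -IntN// !le_Int//; try exact: tameN.
  by move=> t; have := fC t; rewrite ler_norml => /andP[].
by move=> t; have := fC t; rewrite ler_norml => /andP[].
Qed.

Lemma Int_dominated (f_ : nat -> R -> R) f C :
  (forall n, measurable_fun [set: R] (f_ n)) -> measurable_fun setT f ->
  (forall n t, `|f_ n t| <= C * w1 t) ->
  (forall t, f_ ^~ t @ \oo --> f t) ->
  (fun n => Int (f_ n)) @ \oo --> Int f.
Proof.
move=> mf_ mf fC ff.
have fC' t : `|f t| <= C * w1 t.
  by apply: (norm_cvg_le (n0 := 0) (ff t)) => n _; exact: fC.
have [] := @dominated_convergence _ _ _ mu [set: R] measurableT
  (fun n t => (f_ n t)%:E) (fun t => (f t)%:E) (fun t => (C * w1 t)%:E).
- by move=> n; apply/measurable_EFinP; exact: mf_.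
- by apply/measurable_EFinP; exact: mf.
- apply: aeW => t _; apply/cvg_EFin; first by apply: nearW.
  exact: ff.
- by under eq_fun do rewrite EFinM; exact/integrableZl/w1_integrable.
- by apply: aeW => t n _; rewrite lee_fin.
move=> _ _ h.
apply: fine_cvg.
rewrite fineK; last first.
  apply: integrable_fin_num => //; exact: dominated_integrable_w1 fC'.
exact: h.
Qed.

End OneDim.

(** * Derivatives, mean value estimates and primitives *)

Section Calculus.
Variable R : realType.

Lemma cvg0_le (u b : nat -> R) :
  (forall n, `|u n| <= b n) -> b @ \oo --> (0 : R) -> u @ \oo --> (0 : R).
Proof.
move=> ub /cvgrPdist_le b0; apply/cvgrPdist_le => e /b0.
apply: filterS => n; rewrite !sub0r !normrN; apply: le_trans.
by rewrite (le_trans (ub n))// ler_norm.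
Qed.

Lemma cvg_dist_le (u b : nat -> R) (l : R) :
  (forall n, `|l - u n| <= b n) -> b @ \oo --> (0 : R) -> u @ \oo --> l.
Proof.
move=> ub b0; have h1 : (fun n => l - (l - u n)) @ \oo --> l - 0.
  by apply: cvgB (cvg0_le ub b0); exact: cvg_cst.
have E : (fun n => l - (l - u n)) = u by apply/funext => n; rewrite opprB addrC subrK.
by rewrite E subr0 in h1.
Qed.

(** Quadratic remainders survive integration and limits, which is how derivatives are taken through both. *)
Lemma is_derive_quad (V : normedModType R) (f : V -> R) x v (D M : R) :
  (forall h : R, `|h| <= 1 -> `|f (x + h *: v) - f x - h * D| <= M * h ^+ 2) ->
  is_derive x v f D.
Proof.
move=> fM.
have M0 : 0 <= M.
  by have := fM 1; rewrite normr1 lexx expr1n mulr1 => /(_ isT); exact: le_trans.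
suff cvD : (fun h => h^-1 *: ((f \o shift x) (h *: v) - f x)) @ 0^' --> D.
  apply: DeriveDef; first by apply/cvg_ex; exists D.
  by apply: cvg_lim => //; exact: Rhausdorff.
apply/cvgrPdist_le => e e0.
have d0 : 0 < Num.min 1 (e / (M + 1)).
  by rewrite lt_min ltr01 divr_gt0// ltr_wpDl.
exists (Num.min 1 (e / (M + 1))) => //= h; rewrite /= sub0r normrN lt_min => /andP[h1 he] h0.
rewrite /shift/= /GRing.scale/= distrC.
have -> : h^-1 * (f (h *: v + x) - f x) - D =
   h^-1 * (f (x + h *: v) - f x - h * D).
  by rewrite [h *: v + x]addrC; field.
rewrite normrM normfV ler_pdivrMl ?normr_gt0// (le_trans (fM _ (ltW h1)))//.
rewrite -real_normK ?num_real// expr2 mulrCA ler_wpM2l//.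
move: he; rewrite ltr_pdivlMr ?ltr_wpDl// => /ltW; apply: le_trans.
by rewrite mulrC ler_wpM2l// lerDl.
Qed.

Lemma is_derive_line (V : normedModType R) (f f' : V -> R) (x v : V) (t : R) :
  is_derive (x + t *: v) v f (f' (x + t *: v)) ->
  is_derive t 1 (fun s : R => f (x + s *: v)) (f' (x + t *: v)).
Proof.
move=> [df vf].
have E : (fun h : R => h^-1 *: (((fun s : R => f (x + s *: v)) \o shift t) (h *: 1)
            - f (x + t *: v))) =
         (fun h => h^-1 *: ((f \o shift (x + t *: v)) (h *: v) - f (x + t *: v))).
  apply/funext => h /=; congr (_ *: (f _ - _)).
  by rewrite [h *: 1]mulr1 scalerDl addrCA.
by apply: DeriveDef; [rewrite /derivable E|rewrite -vf /derive E].
Qed.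

Lemma is_derive_shift (V : normedModType R) (h : V -> R) x y v D :
  is_derive (x + y) v h D -> is_derive x v (fun z => h (z + y)) D.
Proof.
have E : (fun t : R => t^-1 *: (((fun z => h (z + y)) \o shift x) (t *: v) - h (x + y))) =
    (fun t => t^-1 *: ((h \o shift (x + y)) (t *: v) - h (x + y))).
  by apply/funext => t /=; rewrite -addrA.
by move=> [dh vh]; split; [rewrite /derivable E|rewrite /derive E].
Qed.

Lemma is_derive_continuous (F f : R -> R) :
  (forall x : R, is_derive x 1 F (f x)) -> continuous F.
Proof.
move=> dF x; apply: differentiable_continuous; apply/derivable1_diffP.
by case: (dF x).
Qed.

Lemma mvt_le (F f : R -> R) (a b M : R) :
  (forall x : R, is_derive x 1 F (f x)) ->
  (forall x, `|x - a| <= `|b - a| -> `|f x| <= M) ->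
  `|F b - F a| <= M * `|b - a|.
Proof.
move=> dF fM; have cF := is_derive_continuous dF.
have [ab|ba] := leP a b.
- have [|c cab ->] := @MVT_segment _ F f a b ab.
    exact: continuous_subspaceT.
  rewrite normrM ler_wpM2r// fM//.
  move: cab; rewrite in_itv/= => /andP[ac cb].
  by rewrite !ger0_norm ?subr_ge0// lerD2r.
- have [|c cab E] := @MVT_segment _ F f b a (ltW ba).
    exact: continuous_subspaceT.
  rewrite distrC E normrM (distrC b a) ler_wpM2r// fM//.
  move: cab; rewrite in_itv/= => /andP[bc ca].
  by rewrite (distrC c a) (distrC b a) !ger0_norm ?subr_ge0// ?lerB// ltW.
Qed.

Lemma taylor1_le (u u' u'' : R -> R) (a h M : R) :
  (forall x : R, is_derive x 1 u (u' x)) ->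
  (forall x : R, is_derive x 1 u' (u'' x)) ->
  (forall x, `|x - a| <= `|h| -> `|u'' x| <= M) ->
  `|u (a + h) - u a - h * u' a| <= M * h ^+ 2.
Proof.
move=> du du' uM.
have M0 : 0 <= M by rewrite (le_trans _ (uM a _))// subrr normr0.
pose G x := u x - x * u' a.
have dG (x : R) : is_derive x 1 G (u' x - u' a).
  have h1 : is_derive x 1 (fun x : R => x * u' a) (u' a).
    have h2 := is_deriveM (is_derive_id x 1) (is_derive_cst (u' a) x 1).
    by apply: (is_derive_eq h2); rewrite /GRing.scale/= mulr0 add0r mulr1.
  exact: (is_deriveB (du x) h1).
have -> : u (a + h) - u a - h * u' a = G (a + h) - G a by rewrite /G; ring.
have ha : `|a + h - a| = `|h| by rewrite [a + h]addrC addrK.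
rewrite (le_trans (mvt_le (M := M * `|h|) dG _))//; last first.
  by rewrite ha -mulrA -expr2 real_normK ?num_real.
move=> x; rewrite ha => xh; rewrite (le_trans (mvt_le (M := M) du' _))//.
  by move=> y yx; apply: uM; exact: le_trans xh.
by rewrite ler_wpM2l.
Qed.

End Calculus.

Section Primitive.
Variable R : realType.
Implicit Types (f g F : R -> R) (t C : R).
Notation mu := (@lebesgue_measure R).

Lemma w1_nat_cvg0 : (fun n => w1 (n%:R : R)) @ \oo --> (0 : R).
Proof.
apply: cvg0_le (@cvg_harmonic R) => n.
rewrite ger0_norm ?w1_ge0// /w1 /harmonic/= lef_pV2 ?posrE ?ltr_wpDr ?sqr_ge0//.
rewrite -natr1 addrC lerD2l -natrX ler_nat.
by case: n => // n; rewrite expnS leq_pmulr// expn_gt0.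
Qed.

(** The fundamental theorem of calculus on [-n, n], and dominated convergence for the truncations. *)
Lemma Int_primitive f F : tame f -> (forall x : R, is_derive x 1 F (f x)) ->
  (fun n => F n%:R - F (- n%:R)) @ \oo --> Int f.
Proof.
move=> tf dF; have [cf [C fC]] := tf.
have cF := is_derive_continuous dF.
pose I n := `[- n%:R : R, n%:R]%classic.
suff : (fun n => Int (f \_ (I n))) @ \oo --> Int f.
  apply: cvg_trans; apply: near_eq_cvg; exists 1%N => // n /= n0.
  rewrite /Int -Rintegral_mkcond /Rintegral (@continuous_FTC2 _ f F)//.
  - by rewrite gtrN// ltr0n.
  - exact: continuous_subspaceT.
  - split.
    + by move=> x _; case: (dF x).
    + by apply: cvg_at_right_filter; exact: cF.
    + by apply: cvg_at_left_filter; exact: cF.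
  - by move=> x _; rewrite derive1E; case: (dF x).
apply: (@Int_dominated _ _ _ C).
- move=> n; apply/(measurable_restrictT f); first exact: measurable_itv.
  by apply: measurable_funTS; exact: continuous_measurable_fun.
- exact: continuous_measurable_fun.
- move=> n t; rewrite patchE; case: ifPn => // _.
  by rewrite normr0 (le_trans _ (fC t)).
- move=> t; apply/cvgrPdist_le => e e0.
  near=> n; rewrite patchE mem_set ?subrr ?normr0 ?ltW// /I/= in_itv/= -ler_norml.
  by near: n; exact: nbhs_infty_ger.
Unshelve. all: by end_near. Qed.

Lemma tame_primitive f : tame f -> exists F, forall x : R, is_derive x 1 F (f x).
Proof.
move=> tf; have [cf _] := tf.
exists (fun x => \int[mu]_(t in [set` `]-oo, x]]) f t) => x.
have xu : x < x + 1 by rewrite ltrDl.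
have [||d1 d2] := @continuous_FTC1 R f -oo%O x (x + 1) xu _ _ (cf x) => //.
  by apply: integrableS (tame_integrable tf).
  by rewrite ltNyr.
by apply: DeriveDef => //; rewrite -derive1E.
Qed.

Lemma Int_derive0 f F C : tame f -> (forall x : R, is_derive x 1 F (f x)) ->
  (forall t, `|F t| <= C * w1 t) -> Int f = 0.
Proof.
move=> tf dF FC; have h := Int_primitive tf dF.
rewrite -(cvg_lim (@Rhausdorff R) h); apply: cvg_lim; first exact: Rhausdorff.
apply: (@cvg0_le _ _ (fun n => 2 * C * w1 (n%:R : R))) => [n|].
  rewrite (le_trans (ler_normB _ _))//.
  rewrite [2 * C * _](_ : _ = C * w1 n%:R + C * w1 (- n%:R)) ?lerD//.
  by rewrite /w1 sqrrN; ring.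
by rewrite -[0](mulr0 (2 * C)); apply: cvgMl_tmp; exact: w1_nat_cvg0.
Qed.

Lemma w1_shift (x h : R) : w1 (x + h) <= 2 * (1 + h ^+ 2) * w1 x.
Proof.
rewrite /w1.
have p1 : 0 < 1 + x ^+ 2 by rewrite ltr_wpDr// sqr_ge0.
have p2 : 0 < 1 + (x + h) ^+ 2 by rewrite ltr_wpDr// sqr_ge0.
rewrite ler_pdivlMr// mulrC ler_pdivrMr//.
have := sqr_ge0 (x + 2 * h); have := sqr_ge0 (h * (x + h)); nra.
Qed.

Lemma tame_shift f a : tame f -> tame (fun t => f (t + a)).
Proof.
move=> [cf [C fC]]; split.
  move=> t; apply: (@continuous_comp _ _ _ (fun t => t + a) f); last exact: cf.
  by apply: cvgD; [exact: cvg_id|exact: cvg_cst].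
exists (C * (2 * (1 + a ^+ 2))) => t; rewrite (le_trans (fC _))// -mulrA ler_wpM2l//.
  by rewrite -(pmulr_lge0 _ (w1_gt0 0)) (le_trans _ (fC 0)).
exact: w1_shift.
Qed.

(** The difference of the two integrands has the primitive F (t + a) - F t, which decays like [w1] by the
    mean value theorem. *)
Lemma Int_shift f a : tame f -> Int (fun t => f (t + a)) = Int f.
Proof.
move=> tf; have tfa := tame_shift a tf; have [F dF] := tame_primitive tf.
have [cf [C fC]] := tf.
have C0 : 0 <= C by rewrite -(pmulr_lge0 _ (w1_gt0 0)) (le_trans _ (fC 0)).
have dFa (x : R) : is_derive x 1 (fun t => F (t + a)) (f (x + a)).
  have := @is_derive_line _ R^o F f a 1 x.
  rewrite /GRing.scale/= mulr1 [a + x]addrC => /(_ (dF _)).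
  by under eq_fun do rewrite mulr1 addrC.
have dD (x : R) : is_derive x 1 (fun t => F (t + a) - F t) (f (x + a) - f x).
  exact: is_deriveB.
apply/eqP; rewrite -subr_eq0 -IntB//; apply/eqP.
apply: (@Int_derive0 _ _ (C * (2 * (1 + a ^+ 2)) * `|a|)) dD _.
  exact: tameB.
move=> t; rewrite (le_trans (mvt_le (M := C * (2 * (1 + a ^+ 2)) * w1 t) dF _))//.
  move=> x; rewrite [t + a]addrC addrK => xa.
  rewrite (le_trans (fC _))// -mulrA ler_wpM2l//.
  rewrite -(subrKC t x) (le_trans (w1_shift _ _))// ler_wpM2r ?w1_ge0//.
  by rewrite ler_wpM2l// lerD2l -(real_normK (num_real (x - t))) -(real_normK (num_real a)) lerXn2r ?nnegrE.
by rewrite [t + a]addrC addrK mulrAC.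
Qed.

End Primitive.

(** * Iterated integrals of weighted Lipschitz functions *)

Lemma shift_coord (R : realType) d (x : 'cV[R]_d) h i j :
  (x + h *: delta_mx i 0) j 0 = x j 0 + h * (j == i)%:R.
Proof. by rewrite !mxE eqxx andbT. Qed.

Section Columns.
Variable R : realType.
Variable n : nat.
Implicit Types (t : R) (v : 'cV[R]_n).

Definition ccons t v : 'cV[R]_n.+1 := col_mx (t%:M : 'cV[R]_1) v.

Lemma ccons0 t v : ccons t v ord0 0 = t.
Proof.
rewrite /ccons (_ : ord0 = lshift n (ord0 : 'I_1)); last exact: val_inj.
by rewrite (col_mxEu (t%:M : 'cV[R]_1) v) !mxE.
Qed.

Lemma cconsS t v j : ccons t v (lift ord0 j) 0 = v j 0.
Proof.
rewrite /ccons (_ : lift ord0 j = rshift 1 j); last exact: val_inj.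
by rewrite (col_mxEd (t%:M : 'cV[R]_1) v).
Qed.

Lemma ccons_eqP (x : 'cV[R]_n.+1) t v :
  x ord0 0 = t -> (forall j, x (lift ord0 j) 0 = v j 0) -> x = ccons t v.
Proof.
move=> x0 xS; apply/matrixP => i j; rewrite [j]ord1 {j}.
by case: (unliftP ord0 i) => [k|] ->; rewrite ?ccons0 ?cconsS.
Qed.

Lemma ccons_eta (x : 'cV[R]_n.+1) :
  x = ccons (x ord0 0) (\col_j x (lift ord0 j) 0).
Proof. by apply: ccons_eqP => // j; rewrite mxE. Qed.

Lemma cconsD t s v u : ccons t v + ccons s u = ccons (t + s) (v + u).
Proof.
by apply: ccons_eqP => [|j]; [rewrite [LHS]mxE !ccons0|rewrite [LHS]mxE !cconsS [RHS]mxE].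
Qed.

Lemma ccons_addl t v h :
  ccons t v + h *: delta_mx ord0 0 = ccons (t + h) v.
Proof.
apply: ccons_eqP => [|j]; rewrite shift_coord ?ccons0 ?cconsS ?eqxx ?mulr1//.
by rewrite eq_sym (negPf (neq_lift _ _)) mulr0 addr0.
Qed.

Lemma ccons_addr t v h j :
  ccons t v + h *: delta_mx (lift ord0 j) 0 = ccons t (v + h *: delta_mx j 0).
Proof.
apply: ccons_eqP => [|k]; rewrite shift_coord ?ccons0 ?cconsS ?shift_coord.
  by rewrite (negPf (neq_lift _ _)) mulr0 addr0.
by rewrite (inj_eq lift_inj).
Qed.

End Columns.

Section Weight.
Variables (R : realType) (d : nat).
Implicit Types (x y : 'cV[R]_d) (h : R).

(** The integrable product weight to which all decay is compared. *)
Definition wt x : R := \prod_i w1 (x i 0).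

Lemma wt_gt0 x : 0 < wt x.
Proof. by apply: prodr_gt0 => i _; exact: w1_gt0. Qed.

Lemma wt_ge0 x : 0 <= wt x. Proof. exact/ltW/wt_gt0. Qed.

Lemma wt_shift x y : wt (x + y) <= (\prod_i (2 * (1 + y i 0 ^+ 2))) * wt x.
Proof.
rewrite /wt -big_split/=; apply: ler_prod => i _.
by rewrite w1_ge0/= mxE w1_shift.
Qed.

Lemma wt_shift1 x y : (forall i, `|y i 0| <= 1) -> wt (x + y) <= 4 ^+ d * wt x.
Proof.
move=> y1; rewrite (le_trans (wt_shift x y))// ler_wpM2r ?wt_ge0//.
rewrite -[d in _ ^+ d]card_ord -prodr_const; apply: ler_prod => i _.
have y2 : y i 0 ^+ 2 <= 1 by rewrite -real_normK ?num_real// expr_le1.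
by have := sqr_ge0 (y i 0); lra.
Qed.

Lemma delta_coord_le1 h i j : `|h| <= 1 -> `|(h *: delta_mx i 0 : 'cV[R]_d) j 0| <= 1.
Proof.
by move=> h1; rewrite !mxE eqxx andbT; case: eqP => _; rewrite ?mulr1// mulr0 normr0.
Qed.

Lemma wt_shift_delta x i h : `|h| <= 1 ->
  wt (x + h *: delta_mx i 0) <= 4 ^+ d * wt x.
Proof. by move=> h1; apply: wt_shift1 => j; exact: delta_coord_le1. Qed.

End Weight.

Lemma wt_ccons (R : realType) n t (v : 'cV[R]_n) : wt (ccons t v) = w1 t * wt v.
Proof.
rewrite /wt big_ord_recl ccons0; congr (_ * _).
by apply: eq_bigr => i _; rewrite cconsS.
Qed.

Section WLip.
Variables (R : realType) (d : nat).
Implicit Types (f g b : 'cV[R]_d -> R) (x y : 'cV[R]_d) (h C B : R).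

(** The Lipschitz bound carries the same weight as the size bound: slices and integrals over
    slices are then continuous with the same decay, so iterated integrals need no measure theory
    in dimension [d]. *)
Definition wlipC C f :=
  (forall x, `|f x| <= C * wt x) /\ (forall x i h, `|h| <= 1 -> `|f (x + h *: delta_mx i 0) - f x| <= C * `|h| * wt x).

Definition wlip f := exists C, wlipC C f.

Lemma wlipC_ge0 C f : wlipC C f -> 0 <= C.
Proof. by move=> [fC _]; rewrite -(pmulr_lge0 _ (wt_gt0 (0 : 'cV[R]_d))) (le_trans _ (fC 0)). Qed.

Lemma wlipCD C C' f g : wlipC C f -> wlipC C' g ->
  wlipC (C + C') (fun x => f x + g x).
Proof.
move=> [f1 f2] [g1 g2]; split=> [x|x i h h1].
  by rewrite (le_trans (ler_normD _ _))// mulrDl lerD.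
by rewrite opprD addrACA (le_trans (ler_normD _ _))// !mulrDl lerD// ?f2 ?g2.
Qed.

Lemma wlipCZ C a f : wlipC C f -> wlipC (`|a| * C) (fun x => a * f x).
Proof.
move=> [f1 f2]; split=> [x|x i h h1].
  by rewrite normrM -mulrA ler_wpM2l.
by rewrite -mulrBr normrM -!mulrA ler_wpM2l// mulrA f2.
Qed.

Lemma wlipD f g : wlip f -> wlip g -> wlip (fun x => f x + g x).
Proof. by move=> [C fC] [D gD]; exists (C + D); exact: wlipCD. Qed.

Lemma wlipZ a f : wlip f -> wlip (fun x => a * f x).
Proof. by move=> [C fC]; exists (`|a| * C); exact: wlipCZ. Qed.

Lemma wlipN f : wlip f -> wlip (fun x => - f x).
Proof. by move=> /(wlipZ (-1)); under eq_fun do rewrite mulN1r. Qed.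

Lemma wlipB f g : wlip f -> wlip g -> wlip (fun x => f x - g x).
Proof. by move=> wf /wlipN; exact: wlipD. Qed.

Lemma wlip0 : wlip (fun=> 0).
Proof.
exists 0; split=> [x|x i h _]; first by rewrite normr0 mul0r.
by rewrite subr0 normr0 !mul0r.
Qed.

Lemma wlipC_mul C f b B : wlipC C f -> (forall x, `|b x| <= B) ->
  (forall x i h, `|h| <= 1 -> `|b (x + h *: delta_mx i 0) - b x| <= B * `|h|) ->
  wlipC (C * B * (1 + 4 ^+ d)) (fun x => f x * b x).
Proof.
move=> fC b1 b2; have [f1 f2] := fC; have C0 := wlipC_ge0 fC.
have B0 : 0 <= B by rewrite (le_trans _ (b1 0)).
have four : 0 <= 4 ^+ d :> R by rewrite exprn_ge0.
split=> [x|x i h h1].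
  rewrite normrM (@le_trans _ _ (C * B * wt x))//.
    by rewrite mulrAC ler_pM.
  by rewrite ler_wpM2r ?wt_ge0// ler_peMr ?mulr_ge0// lerDl.
set x' := x + _; rewrite (_ : _ - _ = (f x' - f x) * b x + f x' * (b x' - b x)); last by ring.
rewrite (le_trans (ler_normD _ _))// !normrM mulrDr mulr1 !mulrDl lerD//.
  rewrite (le_trans (ler_pM _ _ (f2 x i h h1) (b1 x)))//.
  by apply: eq_ler; ring.
rewrite (le_trans (ler_pM _ _ (f1 x') (b2 x i h h1)))//.
have := wt_shift_delta x i h1; rewrite -/x' => hw.
rewrite (_ : C * wt x' * (B * `|h|) = C * B * `|h| * wt x'); last by ring.
rewrite (_ : C * B * 4 ^+ d * `|h| * wt x = C * B * `|h| * (4 ^+ d * wt x)); last by ring.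
by rewrite ler_wpM2l// !mulr_ge0.
Qed.

Lemma wlip_shift f y : wlip f -> wlip (fun x => f (x + y)).
Proof.
move=> [C fC]; have C0 := wlipC_ge0 fC; have [f1 f2] := fC.
exists (C * \prod_i (2 * (1 + y i 0 ^+ 2))); split=> [x|x i h h1].
  by rewrite (le_trans (f1 _))// -mulrA ler_wpM2l// wt_shift.
rewrite addrAC (le_trans (f2 _ i h h1))//.
rewrite mulrAC -!mulrA ler_wpM2l// mulrC [_ * (`|h| * _)]mulrCA ler_wpM2l//.
by rewrite wt_shift.
Qed.

End WLip.

Lemma wlipC_slice (R : realType) n C (f : 'cV[R]_n.+1 -> R) t :
  wlipC C f -> wlipC (C * w1 t) (fun v => f (ccons t v)).
Proof.
move=> [f1 f2]; split=> [v|v i h h1].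
  by rewrite -mulrA -wt_ccons.
rewrite -ccons_addr (le_trans (f2 _ _ _ h1))// wt_ccons.
by apply: eq_ler; ring.
Qed.

Lemma lip_tame (R : realType) (f : R -> R) C :
  (forall t, `|f t| <= C * w1 t) ->
  (forall t h, `|h| <= 1 -> `|f (t + h) - f t| <= C * `|h| * w1 t) -> tame f.
Proof.
move=> f1 f2; split; last by exists C.
have C0 : 0 <= C by rewrite -(pmulr_lge0 _ (w1_gt0 0)) (le_trans _ (f1 0)).
move=> x; apply/cvgrPdist_le => e e0.
have d0 : 0 < Num.min 1 (e / (C + 1)).
  by rewrite lt_min ltr01 divr_gt0// ltr_wpDl.
exists (Num.min 1 (e / (C + 1))) => //= y /=; rewrite distrC lt_min => /andP[h1 he].
rewrite -(subrKC x y) distrC (le_trans (f2 x (y - x) (ltW h1)))//.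
rewrite (@le_trans _ _ (C * `|y - x|))//.
  by rewrite ler_piMr ?w1_le1// mulr_ge0.
move: he; rewrite ltr_pdivlMr ?ltr_wpDl// => /ltW; apply: le_trans.
by rewrite mulrC ler_wpM2l// lerDl.
Qed.

Section IntegralR.
Variable R : realType.

Lemma integralRS n (f : 'cV[R]_n.+1 -> R) :
  integralR f = Int (fun t => integralR (fun v => f (ccons t v))).
Proof. by []. Qed.

Definition IntK : R := Int (@w1 R).

Let bounded d := forall (f : 'cV[R]_d -> R) C, wlip f ->
  (forall x, `|f x| <= C * wt x) -> `|integralR f| <= C * IntK ^+ d.

Let linear d := forall a (f g : 'cV[R]_d -> R), wlip f -> wlip g ->
  integralR (fun x => a * f x + g x) = a * integralR f + integralR g.

Let slice_tame n (f : 'cV[R]_n.+1 -> R) : bounded n -> linear n -> wlip f ->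
  tame (fun t => integralR (fun v => f (ccons t v))).
Proof.
move=> bn ln [C fC]; have ws t : wlip (fun v => f (ccons t v)).
  by exists (C * w1 t); exact: wlipC_slice.
have [f1 f2] := fC.
apply: (@lip_tame _ _ (C * IntK ^+ n)) => [t|t h h1].
  rewrite mulrAC; apply: bn => // v.
  by rewrite -mulrA -wt_ccons.
rewrite (_ : _ - _ = integralR (fun v => f (ccons (t + h) v) - f (ccons t v))).
  rewrite (_ : _ * w1 t = C * `|h| * w1 t * IntK ^+ n); last by ring.
  apply: bn; first exact: wlipB.
  by move=> v; rewrite -ccons_addl (le_trans (f2 _ _ _ h1))// wt_ccons mulrA.
have := ln (-1) _ _ (ws t) (ws (t + h)).
under eq_fun do rewrite mulN1r addrC.
by move=> ->; rewrite mulN1r [RHS]addrC.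
Qed.

(** The two statements go together: continuity of the inner integral, which makes the outer one
    meaningful, uses both in the lower dimension. *)
Let bounded_linear d : bounded d /\ linear d.
Proof.
elim: d => [|n [bn ln]].
  split=> [f C _ fC|a f g _ _ //]; rewrite /= expr0 mulr1.
  by have := fC 0; rewrite /wt big_ord0 mulr1.
split=> [f C wf fC|a f g wf wg].
  rewrite integralRS exprSr mulrA; apply: Int_le; first exact: slice_tame.
  move=> t; rewrite mulrAC; apply: bn.
    by case: wf => D fD; exists (D * w1 t); exact: wlipC_slice.
  by move=> v; rewrite -mulrA -wt_ccons.
rewrite !integralRS -IntZ -?IntD; try exact: slice_tame.
- congr Int; apply/funext => t; apply: ln.
    by case: wf => D fD; exists (D * w1 t); exact: wlipC_slice.
  by case: wg => D fD; exists (D * w1 t); exact: wlipC_slice.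
- by apply: tameZ; exact: slice_tame.
Qed.

Lemma integralR_le d (f : 'cV[R]_d -> R) C : wlip f ->
  (forall x, `|f x| <= C * wt x) -> `|integralR f| <= C * IntK ^+ d.
Proof. by case: (bounded_linear d) => + _; exact. Qed.

Lemma integralR_linear d a (f g : 'cV[R]_d -> R) : wlip f -> wlip g ->
  integralR (fun x => a * f x + g x) = a * integralR f + integralR g.
Proof. by case: (bounded_linear d) => _; exact. Qed.

Lemma slice_integral_tame n (f : 'cV[R]_n.+1 -> R) : wlip f ->
  tame (fun t => integralR (fun v => f (ccons t v))).
Proof. by case: (bounded_linear n) => *; exact: slice_tame. Qed.

Lemma integralRD d (f g : 'cV[R]_d -> R) : wlip f -> wlip g ->
  integralR (fun x => f x + g x) = integralR f + integralR g.
Proof.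
move=> wf wg; have := integralR_linear 1 wf wg.
by under eq_fun do rewrite mul1r; rewrite mul1r.
Qed.

Lemma integralR0 d : integralR (fun _ : 'cV[R]_d => 0) = 0.
Proof.
elim: d => //= n IH; under eq_Rintegral do rewrite IH.
by rewrite /Rintegral integral0.
Qed.

Lemma integralRZ d a (f : 'cV[R]_d -> R) : wlip f ->
  integralR (fun x => a * f x) = a * integralR f.
Proof.
move=> wf; have := integralR_linear a wf (wlip0 R d).
by under eq_fun do rewrite addr0; rewrite (integralR0 d) addr0.
Qed.

Lemma integralRB d (f g : 'cV[R]_d -> R) : wlip f -> wlip g ->
  integralR (fun x => f x - g x) = integralR f - integralR g.
Proof.
move=> wf wg; have := integralR_linear (-1) wg wf.
by under eq_fun do rewrite mulN1r addrC; move=> ->; rewrite mulN1r [LHS]addrC.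
Qed.

Lemma integralR_shift d (f : 'cV[R]_d -> R) y : wlip f ->
  integralR (fun x => f (x + y)) = integralR f.
Proof.
elim: d f y => [|n IH] f y wf; first by rewrite /= add0r (flatmx0 y).
rewrite !integralRS -[RHS](Int_shift (y ord0 0)); last exact: slice_integral_tame.
congr Int; apply/funext => t.
rewrite -(IH (fun v => f (ccons (t + y ord0 0) v)) (\col_j y (lift ord0 j) 0)); last first.
  by case: wf => D fD; exists (D * w1 (t + y ord0 0)); exact: wlipC_slice.
by congr integralR; apply/funext => v; rewrite {1}[y]ccons_eta cconsD.
Qed.

Lemma integralR_dominated d (f_ : nat -> 'cV[R]_d -> R) f C :
  (forall n, wlip (f_ n)) -> wlip f -> (forall n x, `|f_ n x| <= C * wt x) ->
  (forall x, f_ ^~ x @ \oo --> f x) ->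
  (fun n => integralR (f_ n)) @ \oo --> integralR f.
Proof.
elim: d f_ f C => [|m IH] f_ f C wf_ wf fC ff; first exact: ff.
have ws t (g : 'cV[R]_m.+1 -> R) : wlip g -> wlip (fun v => g (ccons t v)).
  by move=> [D gD]; exists (D * w1 t); exact: wlipC_slice.
apply: (@Int_dominated _ _ _ (C * IntK ^+ m)).
- move=> n; apply: continuous_measurable_fun.
  by case: (slice_integral_tame (wf_ n)).
- by apply: continuous_measurable_fun; case: (slice_integral_tame wf).
- move=> n t; rewrite mulrAC; apply: integralR_le; first exact: ws.
  by move=> v; rewrite -mulrA -wt_ccons.
- move=> t; apply: (IH _ _ (C * w1 t)) => [n||n x|x]; try exact: ws.
    by rewrite -mulrA -wt_ccons.
  exact: ff.
Qed.

End IntegralR.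

(** * Schwartz functions through stable families *)

Section SupNorm.
Variables (R : realType) (d : nat).
Implicit Types (x : 'cV[R]_d) (f : 'cV[R]_d -> R).

Lemma coord_norm x i : `|x i 0| <= `|x|.
Proof.
rewrite /Num.norm/= (@mx_normrE R d 1 x).
exact: (le_bigmax _ (fun ij : 'I_d * 'I_1 => `|x ij.1 ij.2|) (i, 0)).
Qed.

Lemma norm_coord x : x != 0 -> exists i, `|x| = `|x i 0|.
Proof.
move=> x0; have [|[i j] E] := @mx_norm_neq0 R d 1 x.
  by apply: contra_neq x0; exact: mx_norm_eq0.
by exists i; rewrite [LHS]E/= [j]ord1.
Qed.

Lemma wt_le_w1 x i : wt x <= w1 (x i 0).
Proof.
rewrite /wt (bigD1 i)//= ler_piMr ?w1_ge0//.
by apply: prodr_ile1 => j _; rewrite w1_ge0 w1_le1.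
Qed.

Lemma wt_le1 x : wt x <= 1.
Proof. by apply: prodr_ile1 => j _; rewrite w1_ge0 w1_le1. Qed.

Lemma coord_wt x i : `|x i 0| * wt x <= 1.
Proof.
rewrite (le_trans (ler_wpM2l _ (wt_le_w1 x i)))//.
rewrite /w1 ler_pdivrMr ?ltr_wpDr ?sqr_ge0// mul1r.
rewrite -[x i 0 ^+ 2]real_normK ?num_real//.
by have := sqr_ge0 (`|x i 0| - 1); nra.
Qed.

Lemma norm_wt x : `|x| * wt x <= 1.
Proof.
have [->|/norm_coord[i ->]] := eqVneq x 0; first by rewrite normr0 mul0r.
exact: coord_wt.
Qed.

Lemma wt_norm x : 1 <= wt x * (1 + `|x| ^+ 2) ^+ d.
Proof.
rewrite -[d in _ ^+ d]card_ord -prodr_const /wt -big_split/=.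
apply: (@le_trans _ _ (\prod_(i < d) 1)); first by rewrite big1.
apply: ler_prod => i _.
rewrite ler01/=.
rewrite /w1 ler_pdivlMl ?ltr_wpDr ?sqr_ge0// mulr1 lerD2l.
by rewrite -[x i 0 ^+ 2]real_normK ?num_real// lerXn2r ?nnegrE// coord_norm.
Qed.

(** Powers of the norm and powers of [wt] measure the same decay.  The index [j] keeps track of
    uniformity along sequences of functions. *)
Lemma wt_decay_of_norm (I : Type) (f : I -> 'cV[R]_d -> R) :
  (forall p, exists B, forall j x, `|x| ^+ p * `|f j x| <= B) ->
  forall N, exists C, forall j x, `|f j x| <= C * wt x ^+ N.
Proof.
move=> fB N; have [B0 B0P] := fB 0; have [B1 B1P] := fB (2 * (d * N))%N.
exists (2 ^+ (d * N) * (B0 + B1)) => j x.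
have w0 : 0 < wt x ^+ N by rewrite exprn_gt0// wt_gt0.
suff H : (1 + `|x| ^+ 2) ^+ (d * N) * `|f j x| <= 2 ^+ (d * N) * (B0 + B1).
  apply: le_trans (ler_wpM2r (ltW w0) H).
  rewrite mulrAC ler_peMl// exprM -exprMn mulrC exprn_ege1// ?wt_norm//.
have n0 := normr_ge0 (f j x); have p2 : 0 <= (2 : R) ^+ (d * N) by rewrite exprn_ge0.
have B00 : 0 <= B0 by rewrite (le_trans _ (B0P j x))// mulr_ge0.
have B10 : 0 <= B1 by rewrite (le_trans _ (B1P j x)) ?mulr_ge0 ?exprn_ge0.
(* for |x| <= 1 the bound of order 0 is used, otherwise the one of order 2 d N *)
have [x1|x1] := leP `|x| 1.
  apply: ler_pM => //.
    rewrite lerXn2r ?nnegrE ?addr_ge0 ?sqr_ge0//.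
    by rewrite -natr1 addrC lerD2r expr_le1.
  by have := B0P j x; rewrite expr0 mul1r => /le_trans; apply; rewrite lerDl.
rewrite (@le_trans _ _ (2 ^+ (d * N) * (`|x| ^+ (2 * (d * N)) * `|f j x|)))//.
  rewrite mulrA ler_wpM2r// (exprM `|x| 2) -exprMn lerXn2r ?nnegrE ?addr_ge0 ?sqr_ge0//.
  by rewrite mulrDl mul1r lerD2r exprn_ege1// ltW.
by rewrite ler_wpM2l// (le_trans (B1P j x))// lerDr.
Qed.

Lemma norm_pow_of_coord (I : Type) (f : I -> 'cV[R]_d -> R) :
  (exists B, forall j x, `|f j x| <= B) ->
  (forall i p, exists B, forall j x, `|x i 0 ^+ p * f j x| <= B) ->
  forall p, exists B, forall j x, `|x| ^+ p * `|f j x| <= B.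
Proof.
move=> [B0 B0P] fB p.
have [b bP] := choice (fun i => fB i p).
exists (B0 + \sum_i `|b i|) => j x.
have s0 : 0 <= \sum_i `|b i| by apply: sumr_ge0.
have b0 : 0 <= B0 by exact: le_trans (B0P j x).
have [->|/norm_coord[i ->]] := eqVneq x 0.
  rewrite normr0 expr0n; case: (p == 0%N); rewrite ?mul1r ?mul0r ?addr_ge0//.
  by rewrite (le_trans (B0P j _))// lerDl.
rewrite -normrX -normrM (le_trans (bP i j x))// (le_trans (ler_norm _))//.
by rewrite (bigD1 i)//= addrCA lerDl addr_ge0// sumr_ge0.
Qed.

End SupNorm.

Section Sch.
Variables (R : realType) (d : nat).
Implicit Types (f g a : 'cV[R]_d -> R) (P Q : ('cV[R]_d -> R) -> Prop).

(** Families closed under partial derivatives whose members decay rapidly.  To prove that a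
    function is Schwartz it then suffices to exhibit one such family containing it. *)
Definition stable P := forall f, P f ->
  (forall i, exists2 f', P f' & forall x, is_derive x (delta_mx i 0) f (f' x)) /\
  (forall N, exists C, forall x, `|f x| <= C * wt x ^+ N).

Definition sch f := exists2 P, stable P & P f.

Lemma sch_stable : stable sch.
Proof.
move=> f [P sP Pf]; have [h1 h2] := sP _ Pf; split=> // i.
by have [f' Pf' df] := h1 i; exists f' => //; exists P.
Qed.

Lemma sch_partial f i : sch f ->
  exists2 f', sch f' & forall x, is_derive x (delta_mx i 0) f (f' x).
Proof. by move=> /sch_stable[+ _]; exact. Qed.

Lemma sch_decay f N : sch f -> exists C, forall x, `|f x| <= C * wt x ^+ N.
Proof. by move=> /sch_stable[_]; exact. Qed.

Lemma sch_derive f f' i : sch f ->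
  (forall x, is_derive x (delta_mx i 0) f (f' x)) -> sch f'.
Proof.
move=> /(sch_partial i)[g sg dg] df; suff -> : f' = g by [].
by apply/funext => x; have [_ <-] := df x; have [_ <-] := dg x.
Qed.

Let line_derive f f' i x : (forall x, is_derive x (delta_mx i 0) f (f' x)) ->
  forall t : R, is_derive t 1 (fun s => f (x + s *: delta_mx i 0)) (f' (x + t *: delta_mx i 0)).
Proof. by move=> df t; exact: is_derive_line. Qed.

Lemma sch_shift_decay f N : sch f -> exists C, forall x i h, `|h| <= 1 ->
  `|f (x + h *: delta_mx i 0)| <= C * wt x ^+ N.
Proof.
move=> sf; have [C CP] := sch_decay N sf; exists (C * (4 ^+ d) ^+ N) => x i h h1.
have C0 : 0 <= C by rewrite -(pmulr_lge0 _ (exprn_gt0 N (wt_gt0 x))) (le_trans _ (CP x)).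
rewrite (le_trans (CP _))// -mulrA ler_wpM2l// -exprMn.
by rewrite lerXn2r ?nnegrE ?mulr_ge0 ?exprn_ge0 ?wt_ge0// wt_shift_delta.
Qed.

Lemma sch_lip f N : sch f -> exists C, forall x i h, `|h| <= 1 ->
  `|f (x + h *: delta_mx i 0) - f x| <= C * `|h| * wt x ^+ N.
Proof.
move=> sf.
have /choice[f' f'P] : forall i, exists f', sch f' /\ forall x, is_derive x (delta_mx i 0) f (f' x).
  by move=> i; have [f' ? ?] := sch_partial i sf; exists f'.
have /choice[C CP] : forall i, exists C, forall x j h, `|h| <= 1 ->
    `|f' i (x + h *: delta_mx j 0)| <= C * wt x ^+ N.
  by move=> i; apply: sch_shift_decay; case: (f'P i).
exists (\sum_i `|C i|) => x i h h1.
have df t := line_derive x (f'P i).2 t.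
have := mvt_le (a := 0) (b := h) (M := C i * wt x ^+ N) df.
rewrite scale0r addr0 subr0 => /(_ _)/le_trans; apply.
  by move=> t; rewrite subr0 => th; apply: CP; exact: le_trans h1.
rewrite mulrAC ler_wpM2r// ?exprn_ge0 ?wt_ge0// ler_wpM2r//.
by rewrite (le_trans (ler_norm _))// (bigD1 i)//= lerDl sumr_ge0.
Qed.

Lemma sch_taylor f f' i N : sch f ->
  (forall x, is_derive x (delta_mx i 0) f (f' x)) ->
  exists C, forall x h, `|h| <= 1 ->
  `|f (x + h *: delta_mx i 0) - f x - h * f' x| <= C * h ^+ 2 * wt x ^+ N.
Proof.
move=> sf df; have sf' := sch_derive sf df.
have [f'' sf'' df'] := sch_partial i sf'.
have [C CP] := sch_shift_decay N sf''.
exists C => x h h1.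
have := taylor1_le (a := 0) (h := h) (M := C * wt x ^+ N)
  (line_derive x df) (line_derive x df').
rewrite scale0r addr0 add0r => /(_ _)/le_trans; apply; last by rewrite mulrAC.
by move=> t; rewrite subr0 => th; apply: CP; exact: le_trans h1.
Qed.

Lemma sch_wlip f : sch f -> wlip f.
Proof.
move=> sf; have [C CP] := sch_decay 1 sf; have [D DP] := sch_lip 1 sf.
exists (`|C| + `|D|); split=> [x|x i h h1].
  rewrite (le_trans (CP x))// expr1 ler_wpM2r ?wt_ge0//.
  by rewrite (le_trans (ler_norm _))// lerDl.
rewrite (le_trans (DP x i h h1))// expr1 ler_wpM2r ?wt_ge0// ler_wpM2r//.
by rewrite (le_trans (ler_norm _))// lerDr.
Qed.

Lemma schD f g : sch f -> sch g -> sch (fun x => f x + g x).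
Proof.
move=> sf sg; exists (fun h : 'cV[R]_d -> R => exists f g, [/\ sch f, sch g & h = fun x => f x + g x]); last first.
  by exists f, g.
move=> _ {f g sf sg}[f [g [sf sg ->]]]; split=> [i|N].
  have [f' sf' df] := sch_partial i sf; have [g' sg' dg] := sch_partial i sg.
  exists (fun x => f' x + g' x); first by exists f', g'.
  by move=> x; exact: is_deriveD.
have [C CP] := sch_decay N sf; have [D DP] := sch_decay N sg.
exists (C + D) => x; rewrite mulrDl (le_trans (ler_normD _ _))// lerD//.
Qed.

Lemma schZ c f : sch f -> sch (fun x => c * f x).
Proof.
move=> sf; exists (fun h : 'cV[R]_d -> R => exists2 f, sch f & h = fun x => c * f x); last by exists f.
move=> _ {f sf}[f sf ->]; split=> [i|N].
  have [f' sf' df] := sch_partial i sf.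
  exists (fun x => c * f' x); first by exists f'.
  by move=> x; exact: (is_deriveZ c (df x)).
have [C CP] := sch_decay N sf.
by exists (`|c| * C) => x; rewrite normrM -mulrA ler_wpM2l.
Qed.

Lemma sch0 : sch (fun=> 0).
Proof.
exists (fun f => f = fun=> 0) => // _ ->; split=> [i|N].
  by exists (fun=> 0) => // x; exact: is_derive_cst.
by exists 0 => x; rewrite normr0 mul0r.
Qed.

Lemma schN f : sch f -> sch (fun x => - f x).
Proof. by move=> /(schZ (-1)); under eq_fun do rewrite mulN1r. Qed.

Lemma schB f g : sch f -> sch g -> sch (fun x => f x - g x).
Proof. by move=> sf /schN; exact: schD. Qed.

Lemma is_derive_coord (x : 'cV[R]_d) i j :
  is_derive x (delta_mx i 0) (fun x : 'cV[R]_d => x j 0) ((j == i)%:R : R).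
Proof.
apply: (@is_derive_quad _ _ _ _ _ _ 0) => h _.
by rewrite shift_coord (_ : _ - _ - _ = 0) ?normr0 ?mul0r//; ring.
Qed.

Lemma sch_mulx j f : sch f -> sch (fun x : 'cV[R]_d => x j 0 * f x).
Proof.
move=> sf; exists (fun h : 'cV[R]_d -> R => exists f g, [/\ sch f, sch g & h = fun x : 'cV[R]_d => x j 0 * f x + g x]);
  last by exists f, (fun=> 0); split=> //; [exact: sch0|apply/funext => x; rewrite addr0].
move=> _ {f sf}[f [g [sf sg ->]]]; split=> [i|N].
  have [f' sf' df] := sch_partial i sf; have [g' sg' dg] := sch_partial i sg.
  exists (fun x : 'cV[R]_d => x j 0 * f' x + ((j == i)%:R * f x + g' x)).
    by exists f', (fun x : 'cV[R]_d => (j == i)%:R * f x + g' x); split=> //; apply/schD/sg'/schZ.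
  move=> x; have h := is_deriveD (is_deriveM (is_derive_coord x i j) (df x)) (dg x).
  by apply: (is_derive_eq h); rewrite /GRing.scale/= addrA [f x * _]mulrC.
have [C CP] := sch_decay N.+1 sf; have [D DP] := sch_decay N sg.
have C0 : 0 <= C by rewrite -(pmulr_lge0 _ (exprn_gt0 N.+1 (wt_gt0 (0 : 'cV[R]_d)))) (le_trans _ (CP 0)).
exists (C + D) => x; rewrite mulrDl (le_trans (ler_normD _ _))// lerD// normrM.
rewrite (le_trans (ler_wpM2l _ (CP x)))// mulrCA ler_wpM2l// exprS mulrA.
by rewrite ler_piMl ?exprn_ge0 ?wt_ge0// coord_wt.
Qed.

Lemma sch_mulX j p f : sch f -> sch (fun x : 'cV[R]_d => x j 0 ^+ p * f x).
Proof.
move=> sf; elim: p => [|p IH]; first by under eq_fun do rewrite expr0 mul1r.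
by under eq_fun do rewrite exprS -mulrA; exact: sch_mulx.
Qed.

Lemma sch_shift y f : sch f -> sch (fun x => f (x + y)).
Proof.
move=> sf; exists (fun h : 'cV[R]_d -> R => exists2 f, sch f & h = fun x => f (x + y)); last by exists f.
move=> _ {f sf}[f sf ->]; split=> [i|N].
  have [f' sf' df] := sch_partial i sf.
  exists (fun x => f' (x + y)); first by exists f'.
  move=> x; have [C CP] := sch_taylor 0 sf df.
  apply: (@is_derive_quad _ _ _ _ _ _ C) => h h1.
  by rewrite (addrAC x _ y) (le_trans (CP _ _ h1))// expr0 mulr1.
have [C CP] := sch_decay N sf.
have C0 : 0 <= C by rewrite -(pmulr_lge0 _ (exprn_gt0 N (wt_gt0 (0 : 'cV[R]_d)))) (le_trans _ (CP 0)).
exists (C * (\prod_i (2 * (1 + y i 0 ^+ 2))) ^+ N) => x.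
rewrite (le_trans (CP _))// -mulrA ler_wpM2l// -exprMn.
rewrite lerXn2r ?nnegrE ?wt_ge0// ?wt_shift// mulr_ge0 ?wt_ge0//.
by apply: prodr_ge0 => i _; rewrite mulr_ge0// addr_ge0// sqr_ge0.
Qed.

End Sch.

(** * Comparison with the seminorms *)

(** The differential is 0 since the increment is negligible with respect to h. *)
Lemma differentiable_null (K : realType) (V W : normedModType K) (u : V -> W) (x : V) :
  (forall e : K, 0 < e -> \forall h \near (0 : V), `|u (h + x) - u x| <= e * `|h|) ->
  differentiable u x.
Proof.
move=> H.
have key : u \o shift x = cst (u x) + \0 +o_ 0 id.
  apply/eqaddoP => e e0; apply: filterS (H e e0) => h.
  rewrite (_ : (u \o shift x - (cst (u x) + \0)) h = u (h + x) - u x)//.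
  by rewrite -[LHS]/(u (h + x) - (u x + 0)) addr0.
have c0 : continuous (\0 : V -> W) by exact: cst_continuous.
by apply/diff_locallyP; rewrite (diff_unique c0 key).
Qed.

Section SchwartzClass.
Variables (R : realType) (d : nat).
Implicit Types (f g a : 'cV[R]_d -> R) (x h : 'cV[R]_d) (s : seq 'I_d).

Let hsum s h : 'cV[R]_d := \sum_(i <- s) h i 0 *: delta_mx i 0.

Let sch_lip_sum f s : sch f -> exists C, forall x h, `|h| <= 1 ->
  `|f (x + hsum s h) - f x| <= C * `|h|.
Proof.
move=> sf; have [C CP] := sch_lip 0 sf.
elim: s => [|i s [D DP]].
  by exists 0 => x h _; rewrite /hsum big_nil addr0 subrr normr0 mul0r.
exists (`|C| + D) => x h h1.
rewrite /hsum big_cons addrCA addrC -/(hsum s h).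
rewrite (_ : _ - _ = (f (x + hsum s h + h i 0 *: delta_mx i 0) - f (x + hsum s h))
    + (f (x + hsum s h) - f x)); last by rewrite addrA subrK.
rewrite (le_trans (ler_normD _ _))// mulrDl lerD//; last exact: DP.
have hi := coord_norm h i.
rewrite (le_trans (CP _ _ _ (le_trans hi h1)))// expr0 mulr1.
by rewrite (le_trans (ler_wpM2r _ (ler_norm C)))// ler_wpM2l.
Qed.

(** Telescoping over the coordinates: each step is a Taylor estimate along one coordinate, and
    the derivative at the displaced base point is replaced by the one at [x] by its Lipschitz bound. *)
Let sch_taylor_sum f (f' : 'I_d -> 'cV[R]_d -> R) s : sch f ->
  (forall i x, is_derive x (delta_mx i 0) f (f' i x)) ->
  exists C, forall x h, `|h| <= 1 ->
  `|f (x + hsum s h) - f x - \sum_(i <- s) h i 0 * f' i x| <= C * `|h| ^+ 2.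
Proof.
move=> sf df; elim: s => [|i s [D DP]].
  exists 0 => x h _; rewrite /hsum !big_nil addr0 !subr0 subrr normr0.
  by rewrite mul0r.
have [C CP] := sch_taylor 0 sf (df i).
have [E EP] := sch_lip_sum s (sch_derive sf (df i)).
exists (`|C| + E + D) => x h h1.
rewrite /hsum !big_cons addrCA addrC -/(hsum s h); set y := x + hsum s h.
have hi := coord_norm h i.
rewrite (_ : _ - _ = (f (y + h i 0 *: delta_mx i 0) - f y - h i 0 * f' i y) +
   h i 0 * (f' i y - f' i x) + (f y - f x - \sum_(i <- s) h i 0 * f' i x)); last by ring.
rewrite (le_trans (ler_normD _ _))// mulrDl lerD//; last exact: DP.
rewrite (le_trans (ler_normD _ _))// mulrDl lerD//.
  rewrite (le_trans (CP _ _ (le_trans hi h1)))// expr0 mulr1.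
  rewrite (le_trans (ler_wpM2r _ (ler_norm C)))// ?sqr_ge0// ler_wpM2l//.
  by rewrite -real_normK ?num_real// lerXn2r ?nnegrE.
by rewrite normrM expr2 mulrCA ler_pM// EP.
Qed.

(** The increment minus its linear part is quadratic, and the linear part is differentiable. *)
Lemma sch_differentiable f x : sch f -> differentiable f x.
Proof.
move=> sf.
have /choice[f' f'P] : forall i, exists f', forall x, is_derive x (delta_mx i 0) f (f' x).
  by move=> i; have [f' _ ?] := sch_partial i sf; exists f'.
have [C CP] := sch_taylor_sum (index_enum 'I_d) sf f'P.
pose l := \sum_(i < d) (f' i x *: (fun y : 'cV[R]_d => y i 0)).
have lE y : l y = \sum_(i < d) y i 0 * f' i x.
  by rewrite /l fct_sumE; apply: eq_bigr => i _; rewrite mulrC.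
have dl : differentiable l x.
  by apply: differentiable_sum => i; apply: differentiableZ; exact: differentiable_coord.
pose u : 'cV[R]_d -> R := f - l.
rewrite (_ : f = u + l); last by rewrite subrK.
apply: differentiableD => //.
apply: differentiable_null => e e1.
  have e0 : 0 < Num.min 1 (e / (`|C| + 1)).
    by rewrite lt_min ltr01 divr_gt0// ltr_wpDl.
  apply/nbhs_normP; exists (Num.min 1 (e / (`|C| + 1))) => //= h /=.
  rewrite sub0r normrN lt_min => /andP[h1 he].
  rewrite (_ : u (h + x) - u x = f (x + hsum (index_enum _) h) - f x - \sum_i h i 0 * f' i x); last first.
    have -> : hsum (index_enum _) h = h.
      rewrite [RHS]matrix_sum_delta /hsum; apply: eq_bigr => i _.
      by rewrite big_ord1.
    rewrite -[LHS]/(f (h + x) - l (h + x) - (f x - l x)) !lE.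
    under eq_bigr do rewrite mxE mulrDl.
    by rewrite big_split/= [x + h]addrC; ring.
  rewrite (le_trans (CP _ _ (ltW h1)))// expr2 mulrA ler_wpM2r//.
  move: he; rewrite ltr_pdivlMr ?ltr_wpDl// => /ltW; apply: le_trans.
  by rewrite mulrC ler_wpM2l// (le_trans (ler_norm _))// lerDl.
Qed.

Definition schwartzR f := smooth f /\
  forall N, exists B, forall p s x, (p <= N)%N -> (size s <= N)%N ->
    `|x| ^+ p * `|iter_partial s f x| <= B.

Lemma schwartzR_sch f : schwartzR f -> sch f.
Proof.
move=> sf; exists schwartzR => // {sf}f [sm bd]; split=> [i|].
  exists (iter_partial [:: i] f).
    split=> [s x|N]; rewrite /iter_partial.
      by rewrite -foldr_cat; exact: (sm (s ++ [:: i])).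
    have [B BP] := bd N.+1; exists B => p s x pN sN.
    rewrite -foldr_cat; apply: (BP p (s ++ [:: i])); first exact: leqW.
    by rewrite size_cat addn1.
  move=> x /=; apply: DeriveDef => //; apply: diff_derivable.
  exact: (sm [::] x).
move=> N; have [|C CP] := @wt_decay_of_norm _ _ unit (fun=> f) _ N; last first.
  by exists C => x; exact: (CP tt).
by move=> p; have [B BP] := bd p; exists B => _ x; exact: (BP p [::]).
Qed.

Lemma sch_iter_partial s f : sch f -> sch (iter_partial s f).
Proof.
move=> sf; elim: s => //= i s IH.
have [f' sf' df] := sch_partial i IH.
suff -> : (fun x => 'D_(delta_mx i 0) (iter_partial s f) x) = f' by [].
by apply/funext => x; have [_ ->] := df x.
Qed.

Lemma sch_schwartzR f : sch f -> schwartzR f.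
Proof.
move=> sf; split=> [s x|N].
  exact/sch_differentiable/sch_iter_partial.
suff [B BP] : exists B, forall s x, (size s <= N)%N -> `|iter_partial s f x| <= B * wt x ^+ N.
  exists B => p s x pN sN.
  have B0 : 0 <= B.
    by rewrite -(pmulr_lge0 _ (exprn_gt0 N (wt_gt0 x))) (le_trans _ (BP s x sN)).
  rewrite (le_trans (ler_wpM2l _ (BP s x sN)))// ?exprn_ge0//.
  rewrite mulrCA ler_piMr// -(subnK pN) exprD mulrCA -exprMn.
  rewrite mulr_ile1 ?exprn_ge0 ?mulr_ge0 ?exprn_ge0 ?wt_ge0// exprn_ile1 ?mulr_ge0 ?wt_ge0//.
    exact: wt_le1.
  exact: norm_wt.
elim: {1}N f sf => [|n IH] f sf.
  have [B BP] := sch_decay N sf; exists B => s x; rewrite leqn0 size_eq0 => /eqP -> /=.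
  exact: BP.
have /choice[D DP] : forall i, exists D, forall s x, (size s <= n)%N ->
    `|iter_partial s (iter_partial [:: i] f) x| <= D * wt x ^+ N.
  by move=> i; apply: IH; exact: sch_iter_partial.
have [B BP] := sch_decay N sf.
have s0 : 0 <= \sum_i `|D i| by apply: sumr_ge0.
exists (`|B| + \sum_i `|D i|) => s x.
case/lastP: s => [_|s i] /=.
  rewrite (le_trans (BP x))// ler_wpM2r ?exprn_ge0 ?wt_ge0//.
  by rewrite (le_trans (ler_norm _))// lerDl.
rewrite size_rcons ltnS => sn; rewrite -cats1 /iter_partial foldr_cat.
rewrite (le_trans (DP i s x sn))// ler_wpM2r ?exprn_ge0 ?wt_ge0//.
rewrite (le_trans (ler_norm _))// (bigD1 i)//= addrCA lerDl addr_ge0//.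
by rewrite sumr_ge0.
Qed.

Lemma schwartzP (f : 'cV[R]_d -> R[i]) : schwartz f <->
  sch (fun x => complex.Re (f x)) /\ sch (fun x => complex.Im (f x)).
Proof.
split=> [[sr si bd]|[/sch_schwartzR[sr br] /sch_schwartzR[si bi]]].
  by split; apply: schwartzR_sch; split=> // N; have [B BP] := bd N;
    exists B => p s x pN sN; case: (BP p s x pN sN).
split=> // N; have [B BP] := br N; have [D DP] := bi N.
exists (`|B| + `|D|) => p s x pN sN; split.
  by rewrite (le_trans (BP p s x pN sN))// (le_trans (ler_norm _))// lerDl.
by rewrite (le_trans (DP p s x pN sN))// (le_trans (ler_norm _))// lerDr.
Qed.

End SchwartzClass.

(** * Cosine and sine transforms on the line *)

Section Transform1.
Variable R : realType.
Implicit Types (u v f g : R -> R) (s t C : R) (b : bool).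

(** The two real kernels, cosine for [true] and sine for [false]; differentiation exchanges them
    up to the sign [sg]. *)
Definition tg b : R -> R := if b then @cos R else @sin R.

Definition sg b : R := if b then -1 else 1.

Lemma tg_le1 b t : `|tg b t| <= 1.
Proof.
by rewrite ler_norml; case: b; rewrite /tg ?cos_geN1 ?cos_le1 ?sin_geN1 ?sin_le1.
Qed.

Lemma is_derive_tg b (t : R) : is_derive t 1 (tg b) (sg b * tg (~~ b) t).
Proof.
case: b; rewrite /tg /sg /=; last by rewrite mul1r; exact: is_derive_sin.
by rewrite mulN1r; exact: is_derive_cos.
Qed.

Lemma sg_tg2 b t : sg b * (sg (~~ b) * tg b t) = - tg b t.
Proof. by case: b; rewrite /sg /= ?mulN1r ?mul1r ?mulN1r. Qed.

Lemma is_derive_comp_mul u (du : R -> R) (c t : R) : (forall x : R, is_derive x 1 u (du x)) ->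
  is_derive t 1 (fun r => u (c * r)) (c * du (c * t)).
Proof.
move=> h; have dc : is_derive t 1 (fun r : R => c * r) c.
  have h1 := is_deriveZ c (is_derive_id t 1).
  by apply: (is_derive_eq h1); rewrite /GRing.scale/= mulr1.
have h2 := is_derive1_comp (h (c * t)) dc.
by apply: (is_derive_eq h2); rewrite mulrC.
Qed.

Lemma is_derive_tg_mul b (c t : R) :
  is_derive t 1 (fun r => tg b (c * r)) (c * (sg b * tg (~~ b) (c * t))).
Proof.
apply: (@is_derive_comp_mul (tg b) (fun x => sg b * tg (~~ b) x)) => x.
exact: is_derive_tg.
Qed.

Lemma tg_taylor b x h : `|tg b (x + h) - tg b x - h * (sg b * tg (~~ b) x)| <= h ^+ 2.
Proof.
rewrite -[leRHS]mul1r.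
apply: (@taylor1_le _ (tg b) (fun x => sg b * tg (~~ b) x) (fun x => - tg b x)).
- by move=> y; exact: is_derive_tg.
- move=> y; have h1 := is_deriveZ (sg b) (is_derive_tg (~~ b) y).
  by apply: (is_derive_eq h1); rewrite -sg_tg2 negbK.
- by move=> y _; rewrite normrN tg_le1.
Qed.

Lemma tg_lip b x h : `|tg b (x + h) - tg b x| <= `|h|.
Proof.
have -> : `|h| = 1 * `|x + h - x| by rewrite [x + h]addrC addrK mul1r.
apply: (@mvt_le _ (tg b) (fun y => sg b * tg (~~ b) y)) => y => [|_].
  exact: is_derive_tg.
by rewrite normrM (_ : `|sg b| = 1) ?mul1r ?tg_le1// /sg; case: b; rewrite ?normrN normr1.
Qed.

Lemma tg_continuous_mul b s : continuous (fun t => tg b (s * t)).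
Proof. by exact: (is_derive_continuous (is_derive_tg_mul b s)). Qed.

Lemma tame_tg u b s : tame u -> tame (fun t => u t * tg b (s * t)).
Proof.
move=> tu; apply: tame_mul_bounded tu _ _; first exact: tg_continuous_mul.
by move=> t; exact: tg_le1.
Qed.

Definition trT b u s : R := Int (fun t => u t * tg b (s * t)).

Lemma trTD b u v s : tame u -> tame v ->
  trT b (fun t => u t + v t) s = trT b u s + trT b v s.
Proof.
move=> tu tv; rewrite /trT -IntD; try exact: tame_tg.
by congr Int; apply/funext => t; rewrite mulrDl.
Qed.

Lemma trTZ b c u s : tame u -> trT b (fun t => c * u t) s = c * trT b u s.
Proof.
move=> tu; rewrite /trT -IntZ; last exact: tame_tg.
by congr Int; apply/funext => t; rewrite mulrA.
Qed.

Lemma trT_le b u s C : tame u -> (forall t, `|u t| <= C * w1 t) ->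
  `|trT b u s| <= C * Int (@w1 R).
Proof.
move=> tu uC; apply: Int_le; first exact: tame_tg.
by move=> t; rewrite normrM (le_trans _ (uC t))// ler_piMr// tg_le1.
Qed.

(** The second order remainder of the kernel costs a factor t^2, which [u] absorbs. *)
Lemma trT_quad b u s h C : tame u -> tame (fun t => t * u t) ->
  (forall t, `|t * (t * u t)| <= C * w1 t) ->
  `|trT b u (s + h) - trT b u s - h * (sg b * trT (~~ b) (fun t => t * u t) s)| <=
    C * Int (@w1 R) * h ^+ 2.
Proof.
move=> tu ttu uC.
have t1 := tame_tg b (s + h) tu; have t2 := tame_tg b s tu.
have t3 := tameZ (h * sg b) (tame_tg (~~ b) s ttu).
rewrite [h * (_ * _)]mulrA /trT -IntZ; last exact: tame_tg.
rewrite -!IntB//; last exact: tameB.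
rewrite mulrAC; apply: Int_le; first by apply: tameB => //; exact: tameB.
move=> t; rewrite (_ : _ - _ = u t *
  (tg b (s * t + h * t) - tg b (s * t) - h * t * (sg b * tg (~~ b) (s * t)))); last first.
  by rewrite mulrDl; ring.
rewrite normrM (le_trans (ler_wpM2l _ (tg_taylor _ _ _)))//.
rewrite (_ : _ * _ = `|t * (t * u t)| * h ^+ 2).
  by rewrite mulrAC ler_wpM2r ?sqr_ge0.
rewrite !normrM mulrA -expr2 real_normK ?num_real//.
by rewrite exprMn; ring.
Qed.

Lemma trT_derive b u (s : R) C : tame u -> tame (fun t => t * u t) ->
  (forall t, `|t * (t * u t)| <= C * w1 t) ->
  is_derive s 1 (trT b u) (sg b * trT (~~ b) (fun t => t * u t) s).
Proof.
move=> tu ttu uC; apply: (@is_derive_quad _ _ _ _ _ _ (C * Int (@w1 R))) => h _.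
by rewrite [h%:A]mulr1; exact: trT_quad.
Qed.

Lemma trT_parts b u u' s : tame u -> tame u' ->
  (forall t : R, is_derive t 1 u (u' t)) ->
  s * trT b u s = sg b * trT (~~ b) u' s.
Proof.
move=> tu tu' du; have [_ [C uC]] := tu.
have t1 := tame_tg b s tu; have t2 := tame_tg (~~ b) s tu'.
have : Int (fun t => u' t * tg (~~ b) (s * t) + (s * sg (~~ b)) * (u t * tg b (s * t))) = 0.
  apply: (@Int_derive0 _ _ (fun t => u t * tg (~~ b) (s * t)) C).
  - by apply: tameD => //; exact: tameZ.
  - move=> t; have h := is_deriveM (du t) (is_derive_tg_mul (~~ b) s t).
    apply: (is_derive_eq h); rewrite /GRing.scale/= negbK; ring.
  - by move=> t; rewrite normrM (le_trans _ (uC t))// ler_piMr// tg_le1.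
rewrite IntD//; last exact: tameZ.
rewrite IntZ// -!/(trT _ _ _) => /eqP.
rewrite addr_eq0 => /eqP ->.
by case: b t1 t2 => _ _; rewrite /sg/=; ring.
Qed.

(** Riemann-Lebesgue: translating by half a period changes the sign of the kernel, so twice the
    transform is the integral of [u t - u (t + a n)] against it, with [a n] tending to 0. *)
Lemma trT_cvg0 b u : tame u -> (fun n => trT b u n%:R) @ \oo --> (0 : R).
Proof.
move=> tu; have [cu [C uC]] := tu.
have C0 : 0 <= C by rewrite -(pmulr_lge0 _ (w1_gt0 0)) (le_trans _ (uC 0)).
pose a (n : nat) : R := pi / n.+1%:R.
have a_le n : `|a n| <= pi.
  rewrite /a ger0_norm ?divr_ge0 ?pi_ge0// ler_pdivrMr// ler_peMr ?pi_ge0//.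
  by rewrite ler1n.
have a0 : a @ \oo --> (0 : R).
  rewrite -[0](mulr0 pi); apply: cvgMl_tmp; exact: cvg_harmonic.
have tua n : tame (fun t => u (t + a n)) := tame_shift _ tu.
have uaC n t : `|u (t + a n)| <= C * (2 * (1 + pi ^+ 2)) * w1 t.
  rewrite (le_trans (uC _))// -mulrA ler_wpM2l//.
  rewrite (le_trans (w1_shift _ _))// ler_wpM2r ?w1_ge0// ler_wpM2l// lerD2l.
  by rewrite -(real_normK (num_real (a n))) lerXn2r ?nnegrE ?pi_ge0.
have H n : 2 * trT b u n.+1%:R = Int (fun t => (u t - u (t + a n)) * tg b (n.+1%:R * t)).
  have E : trT b u n.+1%:R = - Int (fun t => u (t + a n) * tg b (n.+1%:R * t)).
    rewrite /trT -(Int_shift (a n)); last exact: tame_tg.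
    rewrite -IntN; last exact: tame_tg.
    congr Int; apply/funext => t; rewrite mulrDr [_ * a n]mulrC /a divfK ?pnatr_eq0//.
    rewrite -mulrN; congr (_ * _).
    by case: b; rewrite /tg ?cosDpi ?sinDpi.
  rewrite mulr2n mulrDl mul1r {2}E -IntB; try exact: tame_tg.
  by congr Int; apply/funext => t; rewrite mulrBl.
have : (fun n => Int (fun t => (u t - u (t + a n)) * tg b (n.+1%:R * t))) @ \oo --> Int (fun=> 0 : R).
  apply: (@Int_dominated _ _ _ (C + C * (2 * (1 + pi ^+ 2)))).
  - move=> n; apply: continuous_measurable_fun.
    by case: (tame_tg b n.+1%:R (tameB tu (tua n))).
  - exact: measurable_cst.
  - move=> n t; rewrite normrM (le_trans (ler_piMr _ (tg_le1 _ _)))//.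
    by rewrite (le_trans (ler_normB _ _))// mulrDl lerD.
  - move=> t.
    have ut : (fun n => u (t + a n)) @ \oo --> u t.
      have : (fun n => t + a n) @ \oo --> t.
        by rewrite -[X in _ --> X]addr0; apply: cvgD; [exact: cvg_cst|].
      by move=> ht; apply: (cvg_comp _ _ ht); exact: cu.
    apply: (@cvg0_le _ _ (fun n => `|u t - u (t + a n)|)).
      by move=> n; rewrite normrM ler_piMr// tg_le1.
    by apply/norm_cvg0P; rewrite -[0](subrr (u t)); apply: cvgB => //; exact: cvg_cst.
have -> : Int (fun=> 0 : R) = 0.
  rewrite -[RHS](mul0r (Int (@w1 R))) -IntZ; last exact: w1_tame.
  by congr Int; apply/funext => t; rewrite mul0r.
move=> /cvgrPdist_le h; apply/cvgrPdist_le => e e0.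
have /h[N _ HN] : 0 < 2 * e by rewrite mulr_gt0.
exists N.+1 => // -[//|n] /= Nn; have := HN n Nn.
by rewrite -H !sub0r !normrN normrM ger0_norm// ler_pM2l.
Qed.

(** The integrand is the derivative of a transform of [u], which tends to 0 at infinity by
    [trT_cvg0]. *)
Lemma Int_trT_mul b u C : tame u -> tame (fun t => t * u t) ->
  (forall t, `|t * (t * u t)| <= C * w1 t) ->
  tame (trT b (fun t => t * u t)) -> Int (trT b (fun t => t * u t)) = 0.
Proof.
move=> tu ttu uC tt.
have d (s : R) : is_derive s 1 (fun s => sg (~~ b) * trT (~~ b) u s) (trT b (fun t => t * u t) s).
  have h := is_deriveZ (sg (~~ b)) (trT_derive (~~ b) s tu ttu uC).
  apply: (is_derive_eq h); rewrite /GRing.scale/= negbK.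
  by case: b tt h => _ _; rewrite /sg/= ?mul1r ?mulN1r ?opprK.
have h := Int_primitive tt d.
rewrite -(cvg_lim (@Rhausdorff R) h); apply: cvg_lim; first exact: Rhausdorff.
have tN s : trT (~~ b) u (- s) = - sg (~~ b) * trT (~~ b) u s.
  rewrite /trT -IntZ; last exact: tame_tg.
  congr Int; apply/funext => t; rewrite mulNr.
  by case: b {tt d h}; rewrite /tg /sg/= ?sinN ?cosN ?opprK ?mul1r// mulN1r mulrN.
under eq_fun do rewrite tN -mulrBr.
rewrite -[0](mulr0 (sg (~~ b))); apply: cvgMl_tmp.
have h0 := @trT_cvg0 (~~ b) _ tu.
rewrite -[0](subrr 0); apply: cvgB => //.
by rewrite -[0](mulr0 (- sg (~~ b))); exact: cvgMl_tmp.
Qed.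

End Transform1.

(** * Fourier inversion on the line *)

Section Inversion1.
Variable R : realType.
Implicit Types (u v f g h : R -> R) (s t C : R) (b : bool).

Definition gauss t : R := expR (- (t ^+ 2 / 2)).

(** The inequality exp y >= 1 + y at y = t^2 / 6, cubed; 216 is 6^3. *)
Lemma gauss_decay t : gauss t <= 216 * w1 t ^+ 3.
Proof.
have -> : gauss t = expR (- (t ^+ 2 / 6)) ^+ 3.
  by rewrite -expRM_natl /gauss; congr expR; field.
rewrite (_ : 216 * _ = (6 * w1 t) ^+ 3); last by rewrite exprMn; ring.
rewrite lerXn2r ?nnegrE ?expR_ge0 ?mulr_ge0 ?w1_ge0//.
rewrite expRN /w1 -[6 in leRHS]invrK -invfM lef_pV2 ?posrE ?expR_gt0//; last first.
  by rewrite mulr_gt0 ?invr_gt0 ?ltr_wpDr ?sqr_ge0.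
rewrite (le_trans _ (expR_ge1Dx _))//.
by have := sqr_ge0 t; lra.
Qed.

Lemma is_derive_gauss t : is_derive t 1 gauss (- (t * gauss t)).
Proof.
have h1 : is_derive t 1 (fun t : R => - (t ^+ 2 / 2)) (- t).
  apply: (@is_derive_quad _ _ _ _ _ _ 1) => h _.
  rewrite [h%:A]mulr1 (_ : _ - _ - _ = - (h ^+ 2 / 2)); last by field.
  rewrite normrN normrM normrX real_normK ?num_real// mul1r.
  by rewrite ger0_norm ?invr_ge0// ler_piMr ?sqr_ge0// invf_le1// ler1n.
have h2 := @is_derive1_comp _ (@expR R) _ t _ _ (is_derive_expR _) h1.
by apply: (is_derive_eq h2); rewrite mulrN mulrC.
Qed.

Lemma gauss_continuous : continuous gauss.
Proof. exact: (is_derive_continuous is_derive_gauss). Qed.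

Lemma gauss_gt0 t : 0 < gauss t. Proof. exact: expR_gt0. Qed.

Let mul_gauss_le (c : R -> R) t n : (n <= 2)%N -> `|c t| <= 1 ->
  `|t ^+ n * (gauss t * c t)| <= 216 * w1 t.
Proof.
move=> n2 c1; have w0 := w1_gt0 t; have w0' := w1_ge0 t; have g0 := gauss_gt0 t.
have p1 : `|t| ^+ 2 * w1 t <= 1.
  by rewrite real_normK ?num_real// /w1 ler_pdivrMr ?ltr_wpDr ?sqr_ge0// mul1r lerDr.
have p2 : `|t| * w1 t <= 1.
  rewrite /w1 ler_pdivrMr ?ltr_wpDr ?sqr_ge0// mul1r -(real_normK (num_real t)).
  by have := sqr_ge0 (`|t| - 1); nra.
rewrite !normrM normrX (gtr0_norm g0) mulrA.
apply: (@le_trans _ _ (`|t| ^+ n * gauss t)).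
  by rewrite ler_piMr// mulr_ge0 ?exprn_ge0// ltW.
rewrite (le_trans (ler_wpM2l _ (gauss_decay t)))// ?exprn_ge0//.
rewrite mulrCA ler_wpM2l// exprS expr2 mulrCA ler_piMr// mulrA.
case: n n2 => [|[|[|//]]] _; rewrite ?expr0 ?expr1 ?mul1r.
- by rewrite -expr2 exprn_ile1// w1_le1.
- by rewrite mulr_ile1 ?mulr_ge0// w1_le1.
- by rewrite mulr_ile1 ?mulr_ge0 ?exprn_ge0// w1_le1.
Qed.

Lemma gauss_tame : tame gauss.
Proof.
split; first exact: gauss_continuous.
exists 216 => t; have := @mul_gauss_le (cst 1) t 0 isT.
by rewrite expr0 mul1r mulr1 normr1; exact.
Qed.

Lemma mul_gauss_tame : tame (fun t => t * gauss t).
Proof.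
split; first by move=> t; apply: cvgM; [exact: cvg_id|exact: gauss_continuous].
exists 216 => t; have := @mul_gauss_le (cst 1) t 1 isT.
by rewrite expr1 mulr1 normr1; exact.
Qed.

(** Both sides solve y' = - s y. *)
Lemma trT_gauss b s : trT b gauss s = trT b gauss 0 * gauss s.
Proof.
have d1 (r : R) : is_derive r 1 (trT b gauss) (- (r * trT b gauss r)).
  have tN : tame (fun t => - (t * gauss t)) := tameN mul_gauss_tame.
  rewrite (trT_parts b r gauss_tame tN is_derive_gauss).
  have h := @trT_derive _ b gauss r 216 gauss_tame mul_gauss_tame.
  have E : trT (~~ b) (fun t => - (t * gauss t)) r = - trT (~~ b) (fun t => t * gauss t) r.
    rewrite -mulN1r -trTZ; last exact: mul_gauss_tame.
    by congr trT; apply/funext => t; rewrite mulN1r.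
  rewrite E mulrN opprK; apply: h => t.
  have := @mul_gauss_le (cst 1) t 2 isT.
  by rewrite expr2 mulr1 normr1 mulrA; exact.
(* the quotient by the Gaussian has derivative 0 *)
pose E (r : R) := expR (r ^+ 2 / 2).
have gE r : gauss r * E r = 1 by rewrite /gauss /E expRN mulVf// gt_eqF// expR_gt0.
have dE (r : R) : is_derive r 1 E (r * E r).
  have -> : E = fun r => (gauss r)^-1.
    by apply/funext => x; rewrite /gauss /E expRN invrK.
  have := is_deriveV (lt0r_neq0 (gauss_gt0 r)) (is_derive_gauss r).
  move=> h; apply: (is_derive_eq h); rewrite /GRing.scale/=.
  by field; rewrite gt_eqF// gauss_gt0.
have dz (r : R) : is_derive r 1 (fun r => trT b gauss r * E r) 0.
  have h := is_deriveM (d1 r) (dE r).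
  by apply: (is_derive_eq h); rewrite /GRing.scale/=; ring.
have := mvt_le (a := 0) (b := s) (M := 0) dz.
rewrite mul0r => /(_ (fun _ _ => _))H.
have : `|trT b gauss s * E s - trT b gauss 0 * E 0| <= 0.
  by apply: H; rewrite normr0.
rewrite normr_le0 subr_eq0 => /eqP h.
have E0 : E 0 = 1 by rewrite /E expr0n/= mul0r expR0.
by rewrite -[LHS]mulr1 -(gE s) [gauss s * _]mulrC mulrA h E0 mulr1.
Qed.

(** The constant 2 pi of Fourier inversion, as the square of the Gaussian integral. *)
Definition kappa : R := Int gauss * Int gauss.

Lemma Int_trT_gauss b : Int (trT b gauss) = if b then kappa else 0.
Proof.
have -> : trT b gauss = fun s => trT b gauss 0 * gauss s.
  by apply/funext => s; exact: trT_gauss.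
rewrite IntZ; last exact: gauss_tame.
case: b; rewrite /trT /tg.
  by congr (_ * _); congr Int; apply/funext => t; rewrite mul0r cos0 mulr1.
rewrite (_ : (fun _ => _) = (fun t => 0 * gauss t)).
  by rewrite IntZ ?mul0r//; exact: gauss_tame.
by apply/funext => t; rewrite !mul0r sin0 mulr0.
Qed.

Lemma Int_gauss_gt0 : 0 < Int gauss.
Proof.
have [F dF] := tame_primitive gauss_tame.
have inc (a c : R) : a <= c -> F a <= F c.
  move=> ac; have [|x _ E] := @MVT_segment _ F gauss a c ac.
    by apply: continuous_subspaceT; exact: is_derive_continuous dF.
  by rewrite -subr_ge0 E mulr_ge0 ?subr_ge0// ltW// gauss_gt0.
have inc1 : F (-1) < F 1.
  have [||x _ E] := @MVT _ F gauss (-1) 1.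
  - by rewrite gtrN.
  - by apply: continuous_subspaceT; exact: is_derive_continuous dF.
  - by rewrite -subr_gt0 E mulr_gt0 ?gauss_gt0// opprK.
have h := Int_primitive gauss_tame dF.
apply: (@lt_le_trans _ _ (F 1 - F (-1))); first by rewrite subr_gt0.
rewrite -(cvg_lim (@Rhausdorff R) h); apply: limr_ge; first by apply/cvg_ex; exists (Int gauss).
exists 1%N => // n /= n1.
by rewrite lerB ?inc// ?lerN2 ler1n.
Qed.

Lemma kappa_neq0 : kappa != 0.
Proof. by rewrite mulf_neq0// gt_eqF// Int_gauss_gt0. Qed.

(** After subtraction of [h 0] times the Gaussian the function vanishes at 0, hence is of the form
    [t * u t], and [Int_trT_mul] applies; the Gaussian produces the constant. *)
Lemma inversion1 b (h h' : R -> R) C D : (forall t : R, is_derive t 1 h (h' t)) ->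
  tame h -> (forall t, `|t * h t| <= C * w1 t) ->
  (forall t, `|t| <= 1 -> `|h' t| <= D) ->
  tame (trT b h) ->
  Int (trT b h) = (if b then kappa else 0) * h 0.
Proof.
move=> dh th thC hD ttr.
pose k t := h t - h 0 * gauss t.
pose k' t := h' t + h 0 * (t * gauss t).
have tk : tame k by apply: tameB => //; apply: tameZ; exact: gauss_tame.
have dk (t : R) : is_derive t 1 k (k' t).
  have h2 := is_deriveB (dh t) (is_deriveZ (h 0) (is_derive_gauss t)).
  by apply: (is_derive_eq h2); rewrite /k' /GRing.scale/= mulrN opprK.
have k0 : k 0 = 0 by rewrite /k /gauss expr0n/= mul0r oppr0 expR0 mulr1 subrr.
(* continuous at 0 by the value of the derivative there *)
pose u t := if t == 0 then k' 0 else k t / t.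
have tu t : t * u t = k t.
  by rewrite /u; case: eqP => [->|/eqP t0]; rewrite ?mul0r ?k0// mulrC divfK.
have [ck [K kK]] := tk.
have K0 : 0 <= K by rewrite -(pmulr_lge0 _ (w1_gt0 0)) (le_trans _ (kK 0)).
pose D' := D + `|h 0| * 216.
have D0 : 0 <= D by rewrite (le_trans _ (hD 0 _))// normr0.
have D'0 : 0 <= D' by rewrite addr_ge0// mulr_ge0.
have k'D t : `|t| <= 1 -> `|k' t| <= D'.
  move=> t1; rewrite (le_trans (ler_normD _ _))// lerD ?hD// normrM ler_wpM2l//.
  have := @mul_gauss_le (cst 1) t 1 isT; rewrite expr1 mulr1 normr1 => /(_ (lexx _))/le_trans.
  by apply; rewrite ler_piMr// w1_le1.
have tameu : tame u.
  split.
    move=> x; have [->|x0] := eqVneq x 0.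
      have /is_derive1_caratheodory[g [gk cg g0]] := dk 0.
      suff -> : u = g by [].
      apply/funext => t; rewrite /u; case: eqP => [->//|/eqP t0].
      by have := gk t; rewrite k0 !subr0 => ->; rewrite mulfK.
    have : {for x, continuous (fun t => k t / t)}.
      by apply: cvgM; [exact: ck|exact: cvgV].
    rewrite /continuous_at /u (negPf x0); apply: cvg_trans; apply: near_eq_cvg.
    have : \forall t \near x, t != 0 by exact: open_neq.
    by apply: filterS => t /negPf ->.
  exists (K + 2 * D') => t.
  have w0 := w1_ge0 t.
  have [t1|t1] := leP `|t| 1.
    have ut : `|u t| <= D'.
      rewrite /u; case: eqP => [_|/eqP t0]; first by rewrite k'D// normr0.
      rewrite normrM normfV ler_pdivrMr ?normr_gt0//.
      have := mvt_le (a := 0) (b := t) (M := D') dk.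
      rewrite k0 !subr0; apply=> x; rewrite subr0 => xt.
      by apply: k'D; exact: le_trans t1.
    rewrite (le_trans ut)// mulrDl (@le_trans _ _ (2 * D' * w1 t))//; last first.
      by rewrite lerDr mulr_ge0.
    rewrite /w1 ler_pdivlMr ?ltr_wpDr ?sqr_ge0// mulrC ler_wpM2r//.
    by rewrite -natr1 addrC lerD2r -(real_normK (num_real t)) expr_le1.
  have t0 : t != 0 by rewrite -normr_gt0 (lt_trans _ t1).
  rewrite /u (negPf t0) normrM normfV ler_pdivrMr ?normr_gt0//.
  rewrite (le_trans (kK t))// (@le_trans _ _ ((K + 2 * D') * w1 t))//.
    by rewrite ler_wpM2r// lerDl mulr_ge0.
  by rewrite ler_peMr ?(ltW t1) ?mulr_ge0 ?addr_ge0 ?mulr_ge0.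
have ttu : (fun t => t * u t) = k by apply/funext.
have E : trT b k = fun s => trT b h s - h 0 * trT b gauss s.
  apply/funext => s; rewrite -mulNr -trTZ; last exact: gauss_tame.
  rewrite -trTD//; last by apply: tameZ; exact: gauss_tame.
  by congr trT; apply/funext => t; rewrite /k mulNr.
have tg' : tame (trT b gauss).
  rewrite (_ : trT b gauss = fun s => trT b gauss 0 * gauss s).
    by apply: tameZ; exact: gauss_tame.
  by apply/funext => s; exact: trT_gauss.
have ttk : tame (trT b k) by rewrite E; apply: tameB => //; exact: tameZ.
have := @Int_trT_mul _ b u (C + `|h 0| * 216) tameu.
rewrite ttu => /(_ tk _ ttk) H.
have /eqP : Int (trT b k) = 0.
  apply: H => t; rewrite tu /k mulrBr (le_trans (ler_normB _ _))// mulrDl lerD//.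
  rewrite mulrCA normrM -mulrA ler_wpM2l//.
  have := @mul_gauss_le (cst 1) t 1 isT; rewrite expr1 mulr1 normr1; exact.
rewrite E IntB//; last exact: tameZ.
by rewrite IntZ// Int_trT_gauss subr_eq0 mulrC => /eqP.
Qed.

End Inversion1.

(** * Transforms in one coordinate *)

Section CoordinateLine.
Variables (R : realType) (d : nat).
Implicit Types (x y : 'cV[R]_d) (a f g : 'cV[R]_d -> R) (t s h : R) (b : bool).

(** [x] with its [i]-th coordinate replaced by [t]. *)
Definition upd i t x : 'cV[R]_d := x + (t - x i 0) *: delta_mx i 0.

Lemma updE i t x j : upd i t x j 0 = if j == i then t else x j 0.
Proof.
rewrite /upd shift_coord; case: eqP => [->|_]; first by rewrite mulr1 subrKC.
by rewrite mulr0 addr0.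
Qed.

Lemma col_ext (x y : 'cV[R]_d) : (forall j, x j 0 = y j 0) -> x = y.
Proof. by move=> xy; apply/matrixP => j k; rewrite (ord1 k). Qed.

Lemma upd_shift_same i t h x : upd i t (x + h *: delta_mx i 0) = upd i t x.
Proof. by apply: col_ext => j; rewrite !updE shift_coord; case: eqP => //= _; rewrite mulr0 addr0. Qed.

Lemma upd_shift_other i j t h x : j != i ->
  upd i t (x + h *: delta_mx j 0) = upd i t x + h *: delta_mx j 0.
Proof.
move=> ji; apply: col_ext => k; rewrite updE [RHS]shift_coord updE shift_coord.
by case: (eqVneq k i) => // ->; rewrite eq_sym (negPf ji) mulr0 addr0.
Qed.

Lemma upd_add i t h x : upd i (t + h) x = upd i t x + h *: delta_mx i 0.
Proof.
apply: col_ext => k; rewrite [RHS]shift_coord !updE.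
by case: eqP => // _; rewrite ?mulr1// mulr0 addr0.
Qed.

Lemma upd_upd i t s x : upd i t (upd i s x) = upd i t x.
Proof. by apply: col_ext => k; rewrite !updE; case: (k == i). Qed.

Lemma upd_id i x : upd i (x i 0) x = x.
Proof. by apply: col_ext => k; rewrite updE; case: eqP => // ->. Qed.

Lemma upd_line i t x : upd i (t + x i 0) x = x + t *: delta_mx i 0.
Proof. by rewrite addrC upd_add upd_id. Qed.

Lemma wt_upd i t x : wt (upd i t x) <= w1 t.
Proof. by rewrite (le_trans (wt_le_w1 _ i))// updE eqxx. Qed.

Lemma line_le a i x C : (forall y, `|a y| <= C * wt y) ->
  forall t, `|a (upd i t x)| <= C * w1 t.
Proof.
move=> aC t; have C0 : 0 <= C by rewrite -(pmulr_lge0 _ (wt_gt0 x)) (le_trans _ (aC x)).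
by rewrite (le_trans (aC _))// ler_wpM2l// wt_upd.
Qed.

Lemma sch_decay1 a : sch a -> exists C, forall y, `|a y| <= C * wt y.
Proof. by move=> /(sch_decay 1)[C CP]; exists C => y; rewrite -[wt y]expr1. Qed.

Lemma line_tame a i x : sch a -> tame (fun t => a (upd i t x)).
Proof.
move=> sa; have [C [a1 a2]] := sch_wlip sa.
have C0 : 0 <= C by exact: (@wlipC_ge0 _ _ _ a).
apply: (@lip_tame _ _ C) => [|t h h1]; first exact: line_le.
by rewrite upd_add (le_trans (a2 _ _ _ h1))// ler_wpM2l ?mulr_ge0// wt_upd.
Qed.

Lemma line_derive a a' i x : (forall y, is_derive y (delta_mx i 0) a (a' y)) ->
  forall t : R, is_derive t 1 (fun s => a (upd i s x)) (a' (upd i t x)).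
Proof.
move=> da t.
have -> : (fun s => a (upd i s x)) = fun s => a (upd i 0 x + s *: delta_mx i 0).
  by apply/funext => s; rewrite -upd_add add0r.
by rewrite -[t in a' (upd _ t _)]add0r upd_add; exact: is_derive_line.
Qed.

Lemma line_mulx a i x t : t * a (upd i t x) = (fun y => y i 0 * a y) (upd i t x).
Proof. by rewrite /= updE eqxx. Qed.

(** The transform in the [i]-th coordinate alone; the frequency takes the place of that coordinate. *)
Definition Tr b i a x : R := trT b (fun t => a (upd i t x)) (x i 0).

Lemma TrE b i a x : Tr b i a x = Int (fun t => a (upd i t x) * tg b (x i 0 * t)).
Proof. by []. Qed.

Lemma TrZ b i c a x : sch a -> Tr b i (fun y => c * a y) x = c * Tr b i a x.
Proof. by move=> sa; rewrite /Tr trTZ//; exact: line_tame. Qed.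

Lemma TrD b i a f x : sch a -> sch f ->
  Tr b i (fun y => a y + f y) x = Tr b i a x + Tr b i f x.
Proof. by move=> sa sf; rewrite /Tr trTD//; exact: line_tame. Qed.

Lemma TrB b i a f x : sch a -> sch f ->
  Tr b i (fun y => a y - f y) x = Tr b i a x - Tr b i f x.
Proof.
move=> sa sf; under [in LHS]eq_fun do rewrite -mulN1r.
by rewrite TrD ?TrZ ?mulN1r//; exact: schZ.
Qed.

Lemma Tr_le b i a x C : sch a -> (forall y, `|a y| <= C * wt y) ->
  `|Tr b i a x| <= C * IntK R.
Proof. by move=> sa aC; apply: trT_le; [exact: line_tame|exact: line_le]. Qed.

Lemma Tr_derive_same b i a x : sch a ->
  is_derive x (delta_mx i 0) (Tr b i a) (Tr (~~ b) i (fun y => sg R b * (y i 0 * a y)) x).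
Proof.
move=> sa; have [C CP] := sch_decay1 (sch_mulx i (sch_mulx i sa)).
have E : (fun t => t * a (upd i t x)) = fun t => (fun y => y i 0 * a y) (upd i t x).
  by apply/funext => t; exact: line_mulx.
apply: (@is_derive_quad _ _ _ _ _ _ (C * IntK R)) => h _.
rewrite TrZ; last exact: sch_mulx.
rewrite /Tr shift_coord eqxx mulr1 (_ : (fun t => a (upd i t (x + h *: delta_mx i 0))) =
   (fun t => a (upd i t x))); last by apply/funext => t; rewrite upd_shift_same.
rewrite -E; apply: trT_quad; first exact: line_tame.
  by rewrite E; exact: (line_tame i x (sch_mulx i sa)).
move=> t; rewrite !line_mulx.
by have := line_le i x CP t; rewrite updE eqxx.
Qed.

Lemma Tr_derive_other b i j a a' x : j != i -> sch a ->
  (forall y, is_derive y (delta_mx j 0) a (a' y)) ->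
  is_derive x (delta_mx j 0) (Tr b i a) (Tr b i a' x).
Proof.
move=> ji sa da; have sa' := sch_derive sa da.
have [C CP] := sch_taylor 1 sa da.
have C0 : 0 <= C.
  have := CP 0 1; rewrite normr1 expr1n mulr1 => /(_ (lexx _)) h.
  by rewrite -(pmulr_lge0 _ (exprn_gt0 1 (wt_gt0 (0 : 'cV[R]_d)))) (le_trans _ h).
apply: (@is_derive_quad _ _ _ _ _ _ (C * IntK R)) => h h1.
have ss := sch_shift (h *: delta_mx j 0) sa.
have -> : Tr b i a (x + h *: delta_mx j 0) = Tr b i (fun y => a (y + h *: delta_mx j 0)) x.
  rewrite /Tr shift_coord eq_sym (negPf ji) mulr0 addr0; congr trT.
  by apply/funext => t; rewrite upd_shift_other.
rewrite -TrB// -TrZ// -TrB//; last 2 first.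
- exact: schB.
- exact: schZ.
rewrite mulrAC; apply: Tr_le; first by apply: schB; [exact: schB|exact: schZ].
by move=> y; have := CP y h h1; rewrite expr1.
Qed.

Lemma Tr_mulx_same b i a a' x : sch a ->
  (forall y, is_derive y (delta_mx i 0) a (a' y)) ->
  x i 0 * Tr b i a x = Tr (~~ b) i (fun y => sg R b * a' y) x.
Proof.
move=> sa da; have sa' := sch_derive sa da.
rewrite TrZ// /Tr; apply: trT_parts; try exact: line_tame.
by move=> t; exact: line_derive.
Qed.

Lemma Tr_mulX_same b i a p : sch a ->
  exists b' a', sch a' /\ forall x, x i 0 ^+ p * Tr b i a x = Tr b' i a' x.
Proof.
move=> sa; elim: p => [|p [b' [a' [sa' IH]]]].
  by exists b, a; split=> // x; rewrite expr0 mul1r.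
have [a'' sa'' da] := sch_partial i sa'.
exists (~~ b'), (fun y => sg R b' * a'' y); split; first exact: schZ.
by move=> x; rewrite exprS -mulrA IH; exact: Tr_mulx_same.
Qed.

Lemma Tr_mulX_other b i j a p x : j != i -> sch a ->
  x j 0 ^+ p * Tr b i a x = Tr b i (fun y => y j 0 ^+ p * a y) x.
Proof.
move=> ji sa; rewrite /Tr -trTZ; last exact: line_tame.
by congr trT; apply/funext => t; rewrite updE (negPf ji).
Qed.

(** Derivatives of these transforms are transforms of the same kind, and so are their products with
    powers of coordinates, by integration by parts.  They form a stable family. *)
Lemma sch_Tr b i a : sch a -> sch (Tr b i a).
Proof.
move=> sa; exists (fun g => exists b a, sch a /\ g = Tr b i a); last by exists b, a.
move=> _ {b a sa}[b [a [sa ->]]]; split=> [j|].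
  have [->|ji] := eqVneq j i.
    exists (Tr (~~ b) i (fun y => sg R b * (y i 0 * a y))); last by move=> x; exact: Tr_derive_same.
    by exists (~~ b), (fun y => sg R b * (y i 0 * a y)); split=> //; apply: schZ; exact: sch_mulx.
  have [a' sa' da] := sch_partial j sa.
  exists (Tr b i a'); last by move=> x; exact: Tr_derive_other.
  by exists b, a'.
have bd b' a' : sch a' -> exists B, forall x, `|Tr b' i a' x| <= B.
  move=> sa'; have [C CP] := sch_decay1 sa'.
  by exists (C * IntK R) => x; exact: Tr_le.
move=> N; have [|C CP] := @wt_decay_of_norm _ _ unit (fun=> Tr b i a) _ N; last first.
  by exists C => x; exact: (CP tt).
apply: norm_pow_of_coord => [|j p].
  by have [B BP] := bd b _ sa; exists B.
have [->|ji] := eqVneq j i.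
  have [b' [a' [sa' E]]] := Tr_mulX_same b i p sa.
  have [B BP] := bd b' _ sa'; exists B => _ x; rewrite E; exact: BP.
have [B BP] := bd b _ (sch_mulX j p sa).
by exists B => _ x; rewrite Tr_mulX_other.
Qed.

(** [inversion1] on the line through [x] in the [i]-th direction, with [x] as origin. *)
Let line_inversion b i a x : sch a ->
  Int (trT b (fun t => a (x + t *: delta_mx i 0))) = (if b then kappa R else 0) * a x.
Proof.
move=> sa; have sax := sch_shift x sa; set ax := (fun y => a (y + x)) in sax.
have E t : a (x + t *: delta_mx i 0) = ax (upd i t 0).
  by rewrite /ax /upd add0r mxE subr0 addrC.
have -> : (fun t => a (x + t *: delta_mx i 0)) = fun t => ax (upd i t 0) by apply/funext.
have [a' sa' da] := sch_partial i sax.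
have [C CP] := sch_decay1 (sch_mulx i sax).
have [D DP] := sch_decay 0 sa'.
rewrite (@inversion1 _ b _ _ C D (line_derive 0 da)).
- by rewrite -E scale0r addr0.
- exact: line_tame.
- by move=> t; rewrite line_mulx; exact: (line_le i 0 CP t).
- by move=> t _; rewrite (le_trans (DP _))// expr0 mulr1.
have -> : trT b (fun t => ax (upd i t 0)) = fun s => Tr b i ax (upd i s 0).
  apply/funext => s; rewrite /Tr updE eqxx; congr trT.
  by apply/funext => t; rewrite upd_upd.
by apply: line_tame; exact: sch_Tr.
Qed.

Let Tr_line b i a x s : Tr b i a (upd i s x) = trT b (fun t => a (upd i t x)) s.
Proof. by rewrite /Tr updE eqxx; congr trT; apply/funext => t; rewrite upd_upd. Qed.

(** The addition formula for the cosine recombines the four transforms into the inversion formula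
    at [x]. *)
Lemma Tr_inversion i a x : sch a ->
  Tr true i (Tr true i a) x + Tr false i (Tr false i a) x = kappa R * a x.
Proof.
move=> sa; rewrite -(line_inversion true i x sa).
have st b := sch_Tr b i sa.
rewrite (TrE true i (Tr true i a)) (TrE false i (Tr false i a)) -IntD; try by apply: tame_tg; exact: line_tame.
congr Int; apply/funext => s.
have tl : tame (fun t => a (upd i t x)) by exact: line_tame.
rewrite !Tr_line [RHS]/trT.
pose f r := a (upd i r x) * cos (s * (r - x i 0)).
have -> : (fun t => a (x + t *: delta_mx i 0) * tg true (s * t)) =
          (fun t => f (t + x i 0)).
  by apply/funext => t; rewrite /f upd_line addrK.
have E : f =
  (fun r => cos (x i 0 * s) * (a (upd i r x) * tg true (s * r)) +
            sin (x i 0 * s) * (a (upd i r x) * tg false (s * r))).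
  by apply/funext => r; rewrite /f mulrBr cosB /tg [s * x i 0]mulrC; ring.
rewrite Int_shift E; last by apply: tameD; apply: tameZ; exact: tame_tg.
rewrite IntD; try by apply: tameZ; exact: tame_tg.
by rewrite !IntZ; try exact: tame_tg; rewrite /trT /tg; ring.
Qed.

(** The odd part of the inversion formula, whose constant is 0. *)
Lemma Tr_commute i a x : sch a ->
  Tr true i (Tr false i a) x = Tr false i (Tr true i a) x.
Proof.
move=> sa; apply/eqP; rewrite -subr_eq0; apply/eqP.
have := line_inversion false i x sa; rewrite mul0r => <-.
have st b := sch_Tr b i sa.
rewrite (TrE true i (Tr false i a)) (TrE false i (Tr true i a)) -IntB; try by apply: tame_tg; exact: line_tame.
congr Int; apply/funext => s.
have tl : tame (fun t => a (upd i t x)) by exact: line_tame.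
rewrite !Tr_line [RHS]/trT.
pose f r := a (upd i r x) * sin (s * (r - x i 0)).
have -> : (fun t => a (x + t *: delta_mx i 0) * tg false (s * t)) =
          (fun t => f (t + x i 0)).
  by apply/funext => t; rewrite /f upd_line addrK.
have E : f =
  (fun r => cos (x i 0 * s) * (a (upd i r x) * tg false (s * r)) -
            sin (x i 0 * s) * (a (upd i r x) * tg true (s * r))).
  by apply/funext => r; rewrite /f mulrBr sinB /tg [s * x i 0]mulrC; ring.
rewrite Int_shift E; last by apply: tameB; apply: tameZ; exact: tame_tg.
rewrite IntB; try by apply: tameZ; exact: tame_tg.
by rewrite !IntZ; try exact: tame_tg; rewrite /trT /tg; ring.
Qed.

End CoordinateLine.

(** * Surjectivity of the Fourier transform *)

Section Slices.
Variables (R : realType) (n : nat).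
Implicit Types (a : 'cV[R]_n.+1 -> R) (t : R).

Lemma sch_slice a t : sch a -> sch (fun v => a (ccons t v)).
Proof.
move=> sa; exists (fun g => exists2 a, sch a & g = (fun v => a (ccons t v))); last by exists a.
move=> _ {a sa}[a sa ->]; split=> [j|N].
  have [a' sa' da] := sch_partial (lift ord0 j) sa.
  exists (fun v => a' (ccons t v)); first by exists a'.
  move=> v; have [C CP] := sch_taylor 0 sa da.
  apply: (@is_derive_quad _ _ _ _ _ _ C) => h h1.
  by rewrite -ccons_addr (le_trans (CP _ _ h1))// expr0 mulr1.
have [C CP] := sch_decay N sa.
have C0 : 0 <= C by rewrite -(pmulr_lge0 _ (exprn_gt0 N (wt_gt0 (0 : 'cV[R]_n.+1)))) (le_trans _ (CP 0)).
exists C => v; rewrite (le_trans (CP _))// ler_wpM2l// lerXn2r ?nnegrE ?wt_ge0//.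
by rewrite wt_ccons ler_piMl ?wt_ge0// w1_le1.
Qed.

Lemma upd_ccons0 s t (v : 'cV[R]_n) : upd ord0 s (ccons t v) = ccons s v.
Proof.
apply: ccons_eqP => [|j]; rewrite updE ?eqxx// cconsS.
by rewrite eq_sym (negPf (neq_lift _ _)).
Qed.

Lemma upd_cconsS j s t (v : 'cV[R]_n) :
  upd (lift ord0 j) s (ccons t v) = ccons t (upd j s v).
Proof.
apply: ccons_eqP => [|k]; rewrite updE ?ccons0 ?cconsS ?updE.
  by rewrite (negPf (neq_lift _ _)).
by rewrite (inj_eq lift_inj).
Qed.

End Slices.

Section PartialFourier.
Variable R : realType.
Local Notation Re := (@complex.Re R).
Local Notation Im := (@complex.Im R).

Definition schC d (f : 'cV[R]_d -> R[i]) :=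
  sch (fun x => Re (f x)) /\ sch (fun x => Im (f x)).

(** The complex Fourier transform in one coordinate, by real and imaginary parts. *)
Definition FT d (i : 'I_d) (f : 'cV[R]_d -> R[i]) (x : 'cV[R]_d) : R[i] :=
  ((Tr true i (fun y => Re (f y)) x + Tr false i (fun y => Im (f y)) x) +i*
   (Tr true i (fun y => Im (f y)) x - Tr false i (fun y => Re (f y)) x))%C.

Lemma schC_FT d i (f : 'cV[R]_d -> R[i]) : schC f -> schC (FT i f).
Proof.
by move=> [sr si]; split; [apply: schD|apply: schB]; exact: sch_Tr.
Qed.

Lemma schC_foldr_FT d s (f : 'cV[R]_d -> R[i]) : schC f -> schC (foldr (@FT d) f s).
Proof. by move=> sf; elim: s => //= i s; exact: schC_FT. Qed.

(** The conjugate transform divided by [kappa] is a right inverse. *)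
Lemma FT_surj d (i : 'I_d) (f : 'cV[R]_d -> R[i]) : schC f -> exists2 g, schC g & FT i g = f.
Proof.
move=> [sr si].
pose r x := (kappa R)^-1 * (Tr true i (fun y => Re (f y)) x - Tr false i (fun y => Im (f y)) x).
pose m x := (kappa R)^-1 * (Tr true i (fun y => Im (f y)) x + Tr false i (fun y => Re (f y)) x).
have k0 := kappa_neq0 R.
have trr b := sch_Tr b i sr; have tri b := sch_Tr b i si.
exists (fun x => r x +i* m x)%C.
  by split; apply: schZ; [exact: schB|exact: schD].
apply/funext => x; rewrite /FT/=.
have E b z : Tr b i r z = (kappa R)^-1 *
    (Tr b i (Tr true i (fun y => Re (f y))) z - Tr b i (Tr false i (fun y => Im (f y))) z).
  by rewrite TrZ ?TrB//; exact: schB.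
have E' b z : Tr b i m z = (kappa R)^-1 *
    (Tr b i (Tr true i (fun y => Im (f y))) z + Tr b i (Tr false i (fun y => Re (f y))) z).
  by rewrite TrZ ?TrD//; exact: schD.
have HA := Tr_inversion i x sr; have HD := Tr_inversion i x si.
have CA := Tr_commute i x sr; have CD := Tr_commute i x si.
rewrite !E !E' -mulrDr -mulrBr.
rewrite (_ : _ - _ + _ = kappa R * Re (f x)); last by rewrite -HA CD; ring.
rewrite (_ : _ + _ - _ = kappa R * Im (f x)); last by rewrite -HD CA; ring.
by rewrite !mulKf//; case: (f x).
Qed.

Lemma foldr_FT_surj d s (f : 'cV[R]_d -> R[i]) : schC f ->
  exists2 g, schC g & foldr (@FT d) g s = f.
Proof.
elim: s f => [|i s IH] f sf; first by exists f.
have [f1 sf1 E1] := FT_surj i sf; have [g sg Eg] := IH f1 sf1.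
by exists g => //=; rewrite Eg.
Qed.

Lemma foldr_FT_slice n s (f : 'cV[R]_n.+1 -> R[i]) t v :
  foldr (@FT n.+1) f (map (lift ord0) s) (ccons t v) =
  foldr (@FT n) (fun u => f (ccons t u)) s v.
Proof.
elim: s v => //= j s IH v.
have E b (h : R[i] -> R) : Tr b (lift ord0 j)
    (fun y => h (foldr (@FT n.+1) f [seq lift ord0 i | i <- s] y)) (ccons t v) =
    Tr b j (fun y => h (foldr (@FT n) (fun u => f (ccons t u)) s y)) v.
  rewrite /Tr cconsS; congr trT; apply/funext => r.
  by rewrite upd_cconsS IH.
by rewrite /FT !E.
Qed.

Definition dot d (x y : 'cV[R]_d) : R := \sum_i x i 0 * y i 0.

Lemma dot_ccons n t (v : 'cV[R]_n) s u : dot (ccons t v) (ccons s u) = t * s + dot v u.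
Proof.
rewrite /dot big_ord_recl !ccons0; congr (_ + _).
by apply: eq_bigr => i _; rewrite !cconsS.
Qed.

Lemma dotDr d (x y z : 'cV[R]_d) : dot x (y + z) = dot x y + dot x z.
Proof. by rewrite /dot -big_split; apply: eq_bigr => i _; rewrite mxE mulrDr. Qed.

Lemma dotC d (x y : 'cV[R]_d) : dot x y = dot y x.
Proof. by apply: eq_bigr => i _; rewrite mulrC. Qed.

Lemma dot_delta d (x : 'cV[R]_d) h i : dot x (h *: delta_mx i 0) = h * x i 0.
Proof.
rewrite /dot (bigD1 i)//= big1 ?addr0 => [|j ji]; rewrite !mxE ?eqxx ?mulr1 1?mulrC//.
by rewrite (negPf ji) mulr0 mul0r.
Qed.

Lemma wlip_tg_dot d (f : 'cV[R]_d -> R) b xi : wlip f ->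
  wlip (fun x => f x * tg b (dot xi x)).
Proof.
move=> [C fC]; pose B := 1 + \sum_i `|xi i 0|.
have s0 : 0 <= \sum_i `|xi i 0| by apply: sumr_ge0.
exists (C * B * (1 + 4 ^+ d)); apply: wlipC_mul => // [x|x i h h1].
  by rewrite (le_trans (tg_le1 _ _))// lerDl.
rewrite dotDr dot_delta (le_trans (tg_lip _ _ _))// normrM mulrC ler_wpM2r//.
by rewrite /B (bigD1 i)//= addrCA lerDl addr_ge0// sumr_ge0.
Qed.

Lemma fourierE d (f : 'cV[R]_d -> R[i]) xi : schC f -> fourier f xi =
  ((integralR (fun x => Re (f x) * tg true (dot xi x)) +
    integralR (fun x => Im (f x) * tg false (dot xi x))) +i*
   (integralR (fun x => Im (f x) * tg true (dot xi x)) -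
    integralR (fun x => Re (f x) * tg false (dot xi x))))%C.
Proof.
move=> [/sch_wlip wr /sch_wlip wi].
rewrite -integralRD -?integralRB; try exact: wlip_tg_dot.
rewrite /fourier /integralC; congr (_ +i* _)%C; congr integralR; apply/funext => x;
  by case: (f x) => p q /=; rewrite /tg /dot; ring.
Qed.

Lemma schC_slice n (f : 'cV[R]_n.+1 -> R[i]) t : schC f -> schC (fun v => f (ccons t v)).
Proof. by move=> [sr si]; split; [exact: (sch_slice t sr)|exact: (sch_slice t si)]. Qed.

(** The kernel factors over the coordinates; the first coordinate is integrated last on both sides,
    so no exchange of integrals occurs. *)
Lemma fourier_foldr d (f : 'cV[R]_d -> R[i]) xi : schC f ->
  fourier f xi = foldr (@FT d) f (enum 'I_d) xi.
Proof.
elim: d f xi => [|n IH] f xi sf.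
  have -> : enum 'I_0 = [::] by apply: size0nil; rewrite size_enum_ord.
  rewrite fourierE//= /dot big_ord0 /tg cos0 sin0 !mulr1 !mulr0 addr0 subr0.
  by rewrite (flatmx0 xi); case: (f 0).
rewrite enum_ordSl/= (ccons_eta xi); set t0 := xi _ _; set v := \col_j _.
pose g := foldr (@FT n.+1) f (map (lift ord0) (enum 'I_n)).
have sg : schC g by exact: schC_foldr_FT.
have gE t : g (ccons t v) = fourier (fun u => f (ccons t u)) v.
  by rewrite /g foldr_FT_slice -IH//; exact: schC_slice.
have gR t : Re (g (ccons t v)) =
    integralR (fun x => Re (f (ccons t x)) * tg true (dot v x)) +
    integralR (fun x => Im (f (ccons t x)) * tg false (dot v x)).
  by rewrite gE fourierE//; exact: schC_slice.
have gI t : Im (g (ccons t v)) =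
    integralR (fun x => Im (f (ccons t x)) * tg true (dot v x)) -
    integralR (fun x => Re (f (ccons t x)) * tg false (dot v x)).
  by rewrite gE fourierE//; exact: schC_slice.
have [sgr sgi] := sg; have [sr si] := sf.
have tR b : tame (fun t => Re (g (ccons t v)) * tg b (t0 * t)).
  have := line_tame ord0 (ccons 0 v) sgr.
  by under eq_fun do rewrite upd_ccons0; exact: tame_tg.
have tI b : tame (fun t => Im (g (ccons t v)) * tg b (t0 * t)).
  have := line_tame ord0 (ccons 0 v) sgi.
  by under eq_fun do rewrite upd_ccons0; exact: tame_tg.
have ws (a : 'cV[R]_n.+1 -> R) b t : sch a -> wlip (fun x => a (ccons t x) * tg b (dot v x)).
  by move=> sa; apply: wlip_tg_dot; apply: sch_wlip; exact: (sch_slice t sa).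
have TrE0 b (h : R[i] -> R) : Tr b ord0 (fun y => h (g y)) (ccons t0 v) =
    Int (fun t => h (g (ccons t v)) * tg b (t0 * t)).
  by rewrite TrE ccons0; congr Int; apply/funext => t; rewrite upd_ccons0.
have slT (a : 'cV[R]_n.+1 -> R) b : sch a ->
    tame (fun t => integralR (fun x => a (ccons t x) * tg b (dot (ccons t0 v) (ccons t x)))).
  move=> /sch_wlip wa.
  exact: (slice_integral_tame (wlip_tg_dot b (ccons t0 v) wa)).
have SP (a : 'cV[R]_n.+1 -> R) t : sch a ->
   integralR (fun x => a (ccons t x) * tg true (dot (ccons t0 v) (ccons t x))) =
   tg true (t0 * t) * integralR (fun x => a (ccons t x) * tg true (dot v x)) -
   tg false (t0 * t) * integralR (fun x => a (ccons t x) * tg false (dot v x)).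
  move=> sa; rewrite -!integralRZ; try exact: ws.
  rewrite -integralRB; try by apply: wlipZ; exact: ws.
  by congr integralR; apply/funext => x; rewrite dot_ccons /tg cosD; ring.
have SQ (a : 'cV[R]_n.+1 -> R) t : sch a ->
   integralR (fun x => a (ccons t x) * tg false (dot (ccons t0 v) (ccons t x))) =
   tg false (t0 * t) * integralR (fun x => a (ccons t x) * tg true (dot v x)) +
   tg true (t0 * t) * integralR (fun x => a (ccons t x) * tg false (dot v x)).
  move=> sa; rewrite -!integralRZ; try exact: ws.
  rewrite -integralRD; try by apply: wlipZ; exact: ws.
  by congr integralR; apply/funext => x; rewrite dot_ccons /tg sinD; ring.
rewrite -/g fourierE// /FT !TrE0 !integralRS.
rewrite -!IntD -?IntB; try exact: tR; try exact: tI;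
  try exact: (slT (fun x => Re (f x)) _ sr); try exact: (slT (fun x => Im (f x)) _ si).
congr (_ +i* _)%C; congr Int; apply/funext => t; rewrite gR gI.
  by rewrite (SP (fun x => Re (f x)))// (SQ (fun x => Im (f x)))//; ring.
by rewrite (SP (fun x => Im (f x)))// (SQ (fun x => Re (f x)))//; ring.
Qed.

Lemma schC_fourier_surj d (f : 'cV[R]_d -> R[i]) : schC f ->
  exists2 g, schC g & fourier g = f.
Proof.
move=> sf; have [g sg E] := foldr_FT_surj (enum 'I_d) sf.
by exists g => //; rewrite -E; apply/funext => xi; exact: fourier_foldr.
Qed.

End PartialFourier.

(** * Complex modulus and exponential sums *)

Section ComplexAbs.
Variable R : realType.
Implicit Types (z w : R[i]) (x : R).
Local Notation Re := (@complex.Re R).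
Local Notation Im := (@complex.Im R).

(** The norm of [R[i]] has its values in [R[i]]; this is the same number in [R]. *)
Definition cabs z : R := Re `|z|.

Lemma normC_cabs z : `|z| = (cabs z)%:C%C.
Proof. by rewrite /cabs normc_def. Qed.

Lemma cabs_ge0 z : 0 <= cabs z.
Proof. by rewrite /cabs normc_def sqrtr_ge0. Qed.

Lemma cabsM z w : cabs (z * w) = cabs z * cabs w.
Proof. by apply: complexI; rewrite rmorphM/= -!normC_cabs normrM. Qed.

Lemma cabsD z w : cabs (z + w) <= cabs z + cabs w.
Proof. by rewrite -lecR rmorphD/= -!normC_cabs ler_normD. Qed.

Lemma cabs_real x : cabs x%:C%C = `|x|.
Proof. by rewrite /cabs normc_def/= expr0n addr0 sqrtr_sqr. Qed.

Lemma cabs0 : cabs 0 = 0.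
Proof. by apply: complexI; rewrite -!normC_cabs normr0. Qed.

Lemma cabs1 : cabs 1 = 1.
Proof. by apply: complexI; rewrite -!normC_cabs normr1. Qed.

Lemma cabs_sum (I : Type) (r : seq I) (F : I -> R[i]) :
  cabs (\sum_(i <- r) F i) <= \sum_(i <- r) cabs (F i).
Proof.
elim: r => [|i r IH]; first by rewrite !big_nil cabs0.
by rewrite !big_cons (le_trans (cabsD _ _))// lerD.
Qed.

Lemma Re_le_cabs z : `|Re z| <= cabs z.
Proof. by rewrite /cabs normc_def/= -sqrtr_sqr ler_wsqrtr// lerDl sqr_ge0. Qed.

Lemma Im_le_cabs z : `|Im z| <= cabs z.
Proof. by rewrite /cabs normc_def/= -sqrtr_sqr ler_wsqrtr// lerDr sqr_ge0. Qed.

Lemma cabs_le_ReIm z : cabs z <= `|Re z| + `|Im z|.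
Proof.
have -> : z = (Re z)%:C%C + 'i%C * (Im z)%:C%C by exact: complexE.
rewrite (le_trans (cabsD _ _))// cabsM !cabs_real (_ : cabs 'i%C = 1) ?mul1r.
  by rewrite /= !(mul0r, mul1r, mulr0, mulr1, subr0, addr0, add0r, oppr0).
by rewrite /cabs normc_def/= expr0n add0r expr1n sqrtr1.
Qed.

Definition ei x : R[i] := (cos x -i* sin x)%C.

Lemma eiD x y : ei (x + y) = ei x * ei y.
Proof. by rewrite /ei cosD sinD; simpc; congr (_ +i* _)%C; ring. Qed.

Lemma ei0 : ei 0 = 1.
Proof. by rewrite /ei cos0 sin0 oppr0. Qed.

Lemma cabs_ei x : cabs (ei x) = 1.
Proof. by rewrite /cabs normc_def/= sqrrN cos2Dsin2 sqrtr1. Qed.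

Lemma cabs_ei_sub1 x : cabs (ei x - 1) <= 2 * `|x|.
Proof.
rewrite (le_trans (cabs_le_ReIm _))// mulr2n mulrDl mul1r lerD//.
  have := @tg_lip R true 0 x; rewrite add0r /tg cos0; exact.
rewrite (_ : Im _ = - sin x) ?normrN; last by rewrite /= ?oppr0 ?addr0 ?subr0.
have := @tg_lip R false 0 x; rewrite add0r /tg sin0 subr0; exact.
Qed.

End ComplexAbs.

Section TrigLists.
Variables (R : realType) (d : nat).
Local Notation term := (R[i] * 'cV[R]_d)%type.
Implicit Types (L : seq term) (xi t : 'cV[R]_d) (i : 'I_d) (k : nat).

(** A list of pairs (c, t) stands for the exponential sum of the c e^(-i t.xi).  Weighting the
    coefficients by t_i^k amounts, up to a power of i, to taking the k-th derivative in xi_i. *)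
Definition evk i k L xi : R[i] :=
  \sum_(p <- L) p.1 * ((p.2 i 0) ^+ k)%:C%C * ei (dot p.2 xi).

Definition ev L xi : R[i] := \sum_(p <- L) p.1 * ei (dot p.2 xi).

Lemma evk0 i L xi : evk i 0 L xi = ev L xi.
Proof. by apply: eq_bigr => p _; rewrite expr0 mulr1. Qed.

Definition prodL L L' : seq term := [seq (p.1 * q.1, p.2 + q.2) | p <- L, q <- L'].

Lemma dotDl (x y z : 'cV[R]_d) : dot (x + y) z = dot x z + dot y z.
Proof. by rewrite dotC dotDr !(dotC z). Qed.

Lemma dotNl (x z : 'cV[R]_d) : dot (- x) z = - dot x z.
Proof. by rewrite /dot -sumrN; apply: eq_bigr => i _; rewrite mxE mulNr. Qed.

Lemma dot0l (z : 'cV[R]_d) : dot 0 z = 0.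
Proof. by rewrite /dot big1// => i _; rewrite mxE mul0r. Qed.

Lemma dot0r (z : 'cV[R]_d) : dot z 0 = 0.
Proof. by rewrite dotC dot0l. Qed.

Lemma evk_prodL i k L L' xi : evk i k (prodL L L') xi =
  \sum_(j < k.+1) ('C(k, j)%:R * evk i (k - j) L xi) * evk i j L' xi.
Proof.
rewrite /evk big_allpairs_dep.
transitivity (\sum_(p <- L) \sum_(q <- L') \sum_(j < k.+1)
   'C(k, j)%:R * (p.1 * ((p.2 i 0) ^+ (k - j))%:C%C * ei (dot p.2 xi)) *
   (q.1 * ((q.2 i 0) ^+ j)%:C%C * ei (dot q.2 xi))).
  apply: eq_bigr => p _; apply: eq_bigr => q _ /=.
  rewrite mxE exprDn rmorph_sum/= mulr_sumr mulr_suml; apply: eq_bigr => j _.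
  rewrite dotDl eiD rmorphMn rmorphM/= -mulr_natl; ring.
under eq_bigr do rewrite exchange_big/=.
rewrite exchange_big/=; apply: eq_bigr => j _.
by rewrite [X in _ = X * _]mulr_sumr mulr_suml; apply: eq_bigr => p _; rewrite mulr_sumr.
Qed.

Lemma ev_prodL L L' xi : ev (prodL L L') xi = ev L xi * ev L' xi.
Proof.
rewrite /ev big_allpairs_dep mulr_suml; apply: eq_bigr => p _.
rewrite mulr_sumr; apply: eq_bigr => q _ /=.
by rewrite dotDl eiD; ring.
Qed.

(** By the Leibniz rule the constants multiply and the rates add. *)
Lemma evk_prodL_le i L L' xi (b a b' a' : R) :
  0 <= b -> 0 <= a -> 0 <= b' -> 0 <= a' ->
  (forall k, cabs (evk i k L xi) <= b * a ^+ k) ->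
  (forall k, cabs (evk i k L' xi) <= b' * a' ^+ k) ->
  forall k, cabs (evk i k (prodL L L') xi) <= (b * b') * (a + a') ^+ k.
Proof.
move=> b0 a0 b0' a0' h h' k.
rewrite evk_prodL (le_trans (cabs_sum _ _))// exprDn mulr_sumr; apply: ler_sum => j _.
rewrite !cabsM -[('C(k, j)%:R : R[i])](rmorph_nat (real_complex R)) cabs_real ger0_norm ?ler0n//.
rewrite -mulr_natr [leRHS](_ : _ = ('C(k, j)%:R * (b * a ^+ (k - j))) * (b' * a' ^+ j)); last by ring.
apply: ler_pM; [by rewrite mulr_ge0 ?cabs_ge0 ?ler0n|exact: cabs_ge0| |exact: h'].
by rewrite mul1r ler_wpM2l ?ler0n.
Qed.

Definition is_trig (m : 'cV[R]_d -> R) := exists L, forall xi, (m xi)%:C%C = ev L xi.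

Lemma is_trig_cst c : is_trig (fun=> c).
Proof.
by exists [:: (c%:C%C, 0)] => xi; rewrite /ev big_seq1/= dot0l ei0 mulr1.
Qed.

Lemma is_trigD m m' : is_trig m -> is_trig m' -> is_trig (fun xi => m xi + m' xi).
Proof.
by move=> [L LP] [L' LP']; exists (L ++ L') => xi; rewrite rmorphD/= LP LP' /ev big_cat.
Qed.

Lemma is_trigM m m' : is_trig m -> is_trig m' -> is_trig (fun xi => m xi * m' xi).
Proof.
move=> [L LP] [L' LP']; exists (prodL L L') => xi.
by rewrite rmorphM/= LP LP' ev_prodL.
Qed.

Lemma is_trig_sum (I : Type) (r : seq I) (P : pred I) (m : I -> 'cV[R]_d -> R) :
  (forall i : I, is_trig (m i)) -> is_trig (fun xi => \sum_(i <- r | P i) m i xi).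
Proof.
move=> h; elim: r => [|i r IH].
  by under eq_fun do rewrite big_nil; exact: is_trig_cst.
under eq_fun do rewrite big_cons; case: (P i) => //; exact: is_trigD.
Qed.

Lemma is_trig_prod (I : Type) (r : seq I) (m : I -> 'cV[R]_d -> R) :
  (forall i : I, is_trig (m i)) -> is_trig (fun xi => \prod_(i <- r) m i xi).
Proof.
move=> h; elim: r => [|i r IH].
  by under eq_fun do rewrite big_nil; exact: is_trig_cst.
by under eq_fun do rewrite big_cons; exact: is_trigM.
Qed.

Lemma is_trig_cos t c : is_trig (fun xi => cos (dot t xi + c)).
Proof.
exists [:: (2^-1%:C%C * ei c, t); (2^-1%:C%C * ei (- c), - t)] => xi.
rewrite /ev big_cons big_seq1/= -!mulrA -!eiD dotNl -opprD [c + _]addrC /ei cosN sinN opprK.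
by simpc; congr (_ +i* _)%C; [field|ring].
Qed.

Lemma is_trig_sin t c : is_trig (fun xi => sin (dot t xi + c)).
Proof.
have := is_trig_cos t (c - pi / 2).
congr is_trig; apply/funext => xi.
by rewrite addrA cosB cos_pihalf sin_pihalf mulr0 add0r mulr1.
Qed.

Lemma is_trig_coord_cos i c : is_trig (fun xi => cos (xi i 0 + c)).
Proof.
have := is_trig_cos (delta_mx i 0) c; congr is_trig; apply/funext => xi.
by rewrite -[delta_mx _ _]scale1r dotC dot_delta mul1r.
Qed.

Lemma is_trig_coord_sin i c : is_trig (fun xi => sin (xi i 0 + c)).
Proof.
have := is_trig_sin (delta_mx i 0) c; congr is_trig; apply/funext => xi.
by rewrite -[delta_mx _ _]scale1r dotC dot_delta mul1r.
Qed.

End TrigLists.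

(** * Contraction by the inverse transpose *)

Section Contraction.
Variables (R : realType) (d : nat).
Implicit Types (A : 'M[int]_d) (Q U : 'M[R]_d).

(** The determinant is the product of the eigenvalues. *)
Lemma dilation_det_gt1 A : (0 < d)%N -> real_isotropic_dilation R A -> (1 < `|\det A|)%N.
Proof.
move=> d0 [ev1 _ _]; set B := map_mx _ _ in ev1.
have [rs Hrs] := closed_field_poly_normal (char_poly B).
rewrite (monicP (char_poly_monic B)) scale1r in Hrs.
have szrs : size rs = d.
  have := size_char_poly B; by rewrite Hrs size_prod_XsubC => -[].
have rs1 z : z \in rs -> 1 < `|z|.
  move=> zrs; apply: ev1; rewrite eigenvalue_root_char Hrs root_prod_XsubC//.
have detE : `|\det B| = \prod_(z <- rs) `|z|.
  have := char_poly_det B; rewrite -horner_coef0 Hrs horner_prod => /(congr1 Num.norm).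
  rewrite normrM normrX normrN1 expr1n mul1r => <-.
  rewrite normr_prod; apply: eq_bigr => z _.
  by rewrite hornerXsubC sub0r normrN.
have : 1 < `|\det B|.
  rewrite detE; case: rs szrs rs1 {Hrs detE} => [E|z rs _ rs1].
    by move: d0; rewrite -E.
  rewrite big_cons.
  have h : 1 <= \prod_(j <- rs) `|j|.
    elim: rs rs1 => [|y rs IH] rs1; first by rewrite big_nil.
    rewrite big_cons; apply: mulr_ege1.
      by apply/ltW/rs1; rewrite !inE eqxx orbT.
    apply: IH => t; rewrite inE => /orP[/eqP ->|tr]; apply: rs1.
      by rewrite mem_head.
    by rewrite !inE tr !orbT.
  rewrite (lt_le_trans (rs1 z _)) ?mem_head// ler_peMr//.
rewrite det_map_mx/= -intr_norm => h.
by rewrite -(ltr_nat R[i]) natr_absz.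
Qed.

Lemma real_tr_unit A : (1 < `|\det A|)%N -> real_tr R A \in unitmx.
Proof.
move=> q1; rewrite /real_tr unitmx_tr unitmxE det_map_mx unitfE intr_eq0.
by apply: contraTneq q1 => ->.
Qed.

Lemma posdef_unit Q : (forall v : 'cV[R]_d, v != 0 -> 0 < (v^T *m Q *m v) 0 0) ->
  Q \in unitmx.
Proof.
move=> pos; rewrite unitmxE unitfE; apply/negP => /det0P[v v0 vQ].
have := pos v^T; rewrite trmxK vQ mul0mx mxE ltxx => h.
by have /h : v^T != 0 by rewrite trmx_eq0.
Qed.

Lemma orthogonal_entry_le U : U^T *m U = 1%:M -> forall k l, `|U k l| <= 1.
Proof.
move=> UU k l; have := congr1 (fun M : 'M[R]_d => M l l) UU.
rewrite !mxE eqxx (bigD1 k)//= !mxE -expr2 => E.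
have : U k l ^+ 2 <= 1.
  rewrite -[leRHS]E lerDl sumr_ge0// => j _; rewrite mxE -expr2 sqr_ge0//.
by rewrite -real_normK ?num_real// expr_le1.
Qed.

Lemma mx_exprS (B : 'M[R]_d) j : B ^+ j.+1 = B *m (B ^+ j).
Proof. by rewrite exprS. Qed.

Lemma orthogonal_expr U j : U^T *m U = 1%:M -> (U ^+ j)^T *m (U ^+ j) = 1%:M.
Proof.
move=> UU; elim: j => [|j IH]; first by rewrite expr0 trmx1 mulmx1.
by rewrite exprSr [U ^+ j * U]/(U ^+ j *m U) trmx_mul mulmxA -[_ *m _ *m U ^+ j]mulmxA IH mulmx1.
Qed.

Lemma contraction_rate A : (0 < d)%N -> (1 < `|\det A|)%N ->
  0 < (`|\det A|%N%:R `^ (- d%:R^-1) : R) < 1.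
Proof.
move=> d0 q1; have q0 : 0 < (`|\det A|%N%:R : R) by rewrite ltr0n (ltn_trans _ q1).
rewrite powR_gt0//= /powR gt_eqF// expR_lt1 mulNr oppr_lt0 mulr_gt0//.
  by rewrite invr_gt0 ltr0n.
by rewrite ln_gt0// ltr1n.
Qed.

(** All powers are simultaneously conjugate to powers of an orthogonal matrix, whose entries are
    at most 1. *)
Lemma inv_tr_expr_entry A Q : (0 < d)%N -> (1 < `|\det A|)%N -> isotropic_factor A Q ->
  exists C rho : R, [/\ 0 <= C, 0 < rho < 1 &
    forall j k l, `|(inv_tr R A ^+ j) k l| <= C * rho ^+ j].
Proof.
move=> d0 q1 [QT pos [U UU E]].
set rho := _ `^ _ in E; have rho01 : 0 < rho < 1 by exact: contraction_rate.
have Qu := posdef_unit pos.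
have Ej j : inv_tr R A ^+ j = rho ^+ j *: (invmx Q *m (U ^+ j) *m Q).
  elim: j => [|j IH]; first by rewrite !expr0 scale1r mulmx1 mulVmx.
  rewrite mx_exprS IH E -scalemxAl -scalemxAr scalerA -exprS; congr (_ *: _).
  by rewrite mx_exprS !mulmxA -[_ *m Q *m invmx Q]mulmxA mulmxV// mulmx1.
pose F k l := \sum_m \sum_p `|invmx Q k m| * `|Q p l|.
have F0 k l : 0 <= F k l by do 2!(apply: sumr_ge0 => ? _); rewrite mulr_ge0.
pose C := \sum_k \sum_l F k l.
have C0 : 0 <= C by do 2!(apply: sumr_ge0 => ? _).
exists C, rho; split=> // j k l.
have r0 : 0 <= rho by case/andP: rho01 => /ltW.
rewrite Ej mxE normrM mulrC (ger0_norm (exprn_ge0 j r0)) ler_wpM2r ?exprn_ge0//.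
have U1 := orthogonal_entry_le (orthogonal_expr j UU).
rewrite (@le_trans _ _ (F k l))//.
  rewrite mxE (le_trans (ler_norm_sum _ _ _))// /F exchange_big/=; apply: ler_sum => p _.
  rewrite mxE mulr_suml (le_trans (ler_norm_sum _ _ _))//; apply: ler_sum => m _.
  by rewrite !normrM ler_wpM2r// ler_piMr.
rewrite /C (bigD1 k)//= (bigD1 l)//= -addrA lerDl addr_ge0//.
  by apply: sumr_ge0.
by do 2!(apply: sumr_ge0 => ? _).
Qed.

End Contraction.

(** * The mask as a trigonometric polynomial *)

Section Mask.
Variables (R : realType) (d : nat) (A : 'M[int]_d) (Q : 'M[R]_d).
Hypothesis QT : Q^T = Q.
Hypothesis Qpos : forall v : 'cV[R]_d, v != 0 -> 0 < (v^T *m Q *m v) 0 0.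
Hypothesis Aunit : real_tr R A \in unitmx.
Implicit Types (x y xi s : 'cV[R]_d) (k : 'cV[int]_d).
Local Notation ZtoR := (map_mx (intr : int -> R)).

Let q i j := (Q *m Q) i j.

Let q_sym i j : q i j = q j i.
Proof.
have : (Q *m Q)^T = Q *m Q by rewrite trmx_mul QT.
by move=> /(congr1 (fun M : 'M[R]_d => M j i)); rewrite mxE.
Qed.

Let q_diag_gt0 i : 0 < q i i.
Proof.
have Qu := posdef_unit Qpos.
have -> : q i i = \sum_j Q j i ^+ 2.
  rewrite /q mxE; apply: eq_bigr => j _; rewrite expr2; congr (_ * _).
  by rewrite -{1}QT mxE.
have S0 : 0 <= \sum_j Q j i ^+ 2 by apply: sumr_ge0 => j _; exact: sqr_ge0.
rewrite lt_def S0 andbT; apply/negP => /eqP /psumr_eq0P H.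
have Q0 j : Q j i = 0.
  by apply/eqP; rewrite -sqrf_eq0; apply/eqP/H => // ? _; exact: sqr_ge0.
have : Q *m (delta_mx i 0 : 'cV[R]_d) = 0.
  by rewrite -colE; apply/matrixP => j l; rewrite !mxE Q0.
move=> /(congr1 (mulmx (invmx Q))); rewrite mulKmx// mulmx0.
by move=> /matrixP/(_ i 0)/eqP; rewrite !mxE !eqxx oner_eq0.
Qed.

Let sum_sym (f : 'I_d -> 'I_d -> R) : (forall i j, f i j = f j i) ->
  \sum_i \sum_j f i j = \sum_i f i i + 2 * \sum_(i < d) \sum_(j < d | (i < j)%N) f i j.
Proof.
move=> fs.
have E : \sum_(i < d) \sum_(j < d | (j < i)%N) f i j = \sum_(i < d) \sum_(j < d | (i < j)%N) f i j.
  rewrite (exchange_big_dep xpredT)//=; apply: eq_bigr => i _.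
  by apply: eq_bigr => j _; exact: fs.
rewrite mulr2n mulrDl mul1r -{1}E -!big_split/=; apply: eq_bigr => i _.
rewrite (bigD1 i)//=; congr (_ + _).
rewrite (bigID (fun j : 'I_d => (j < i)%N))/=; congr (_ + _); apply: eq_bigl => j.
  apply/andP/idP => [[]//|ji]; split=> //.
  by rewrite -(inj_eq val_inj) ltn_eqF.
by rewrite -leqNgt [RHS]ltn_neqAle eq_sym -(inj_eq val_inj).
Qed.

Let quad_ge0 (z : 'I_d -> R) : 0 <= \sum_i \sum_j q i j * z i * z j.
Proof.
rewrite (_ : \sum_i _ = \sum_l (\sum_i Q l i * z i) ^+ 2).
  by apply: sumr_ge0 => l _; exact: sqr_ge0.
under [RHS]eq_bigr do rewrite expr2 big_distrlr/=.
rewrite [RHS]exchange_big/=; apply: eq_bigr => i _.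
rewrite [RHS]exchange_big/=; apply: eq_bigr => j _.
rewrite /q mxE !mulr_suml; apply: eq_bigr => l _.
by rewrite -{1}QT mxE; ring.
Qed.

(** Completing the mixed sum by its diagonal gives a quadratic form in the sines, which is
    nonnegative, and leaves 4 sin^2 (x/2) - sin^2 x = 4 sin^4 (x/2) on the diagonal. *)
Lemma trig_form_ge x : \sum_i q i i * (4 * sin (x i 0 / 2) ^+ 4) <= trig_form Q x.
Proof.
pose f i j := q i j * sin (x i 0) * sin (x j 0).
have fs i j : f i j = f j i by rewrite /f q_sym; ring.
have H := sum_sym fs.
pose D := \sum_i f i i; pose T := \sum_(i < d) \sum_(j < d | (i < j)%N) f i j.
have E2 : 2 * T = \sum_i \sum_j f i j - D by rewrite H -/D -/T addrAC subrr add0r.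
rewrite -[trig_form Q x]/(4 * (\sum_i q i i * sin (x i 0 / 2) ^+ 2) + 2 * T) E2 /D.
rewrite addrCA -[leLHS]add0r lerD//; first exact: quad_ge0.
rewrite mulr_sumr -sumrB; apply: eq_ler; apply: eq_bigr => i _; rewrite /f.
have -> : sin (x i 0) = 2 * sin (x i 0 / 2) * cos (x i 0 / 2).
  by rewrite [in LHS](_ : x i 0 = x i 0 / 2 + x i 0 / 2) ?sinD; [ring|field].
have := cos2Dsin2 (x i 0 / 2); move=> E.
have -> : q i i * (2 * sin (x i 0 / 2) * cos (x i 0 / 2)) * (2 * sin (x i 0 / 2) * cos (x i 0 / 2))
  = q i i * (4 * sin (x i 0 / 2) ^+ 2) * cos (x i 0 / 2) ^+ 2 by ring.
rewrite (_ : cos (x i 0 / 2) ^+ 2 = 1 - sin (x i 0 / 2) ^+ 2); last by move: E; lra.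
by ring.
Qed.

Lemma trig_form_gt0 s : (forall i, 0 <= s i 0 < 1) -> s != 0 ->
  0 < trig_form Q ((2 * pi) *: s).
Proof.
move=> s01 s0; apply: lt_le_trans (trig_form_ge _).
have [i si] : exists i, s i 0 != 0.
  apply/existsP; apply: contraR s0; rewrite negb_exists => /forallP h.
  by apply/eqP/col_ext => i; rewrite mxE; apply/eqP; have := h i; rewrite negbK.
rewrite (bigD1 i)//= ltr_wpDr//.
  apply: sumr_ge0 => j _; apply: mulr_ge0; first exact/ltW/q_diag_gt0.
  by apply: mulr_ge0 => //; rewrite (_ : 4%N = (2 * 2)%N)// exprM sqr_ge0.
rewrite mulr_gt0// mulr_gt0// exprn_gt0// mxE.
have /andP[si0 si1] := s01 i; have pi0 := pi_gt0 R.
rewrite (_ : 2 * pi * s i 0 / 2 = pi * s i 0); last by field.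
apply: sin_gt0_pi; rewrite mulr_gt0//=; last by rewrite lt_def si.
by rewrite gtr_pMr.
Qed.

Lemma sin_intpi (k : int) : sin (k%:~R * pi) = 0 :> R.
Proof.
have nat_case (n : nat) : sin (n%:R * pi) = 0 :> R.
  elim: n => [|n IH]; first by rewrite mul0r sin0.
  by rewrite -natr1 mulrDl mul1r sinDpi IH oppr0.
case: k => n; first exact: nat_case.
by rewrite NegzE mulrNz mulNr sinN nat_case oppr0.
Qed.

Lemma trig_form_lattice k : trig_form Q ((2 * pi) *: ZtoR k) = 0.
Proof.
rewrite /trig_form big1 ?mulr0 ?add0r => [|i _].
  rewrite big1 ?mulr0// => i _; rewrite big1// => j _.
  rewrite [X in sin X](_ : _ = (2 * k i 0)%:~R * pi).
    by rewrite sin_intpi mulr0 mul0r.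
  by rewrite !mxE rmorphM/=; ring.
rewrite (_ : _ / 2 = (k i 0)%:~R * pi) ?sin_intpi ?expr0n ?mulr0//.
by rewrite !mxE; field.
Qed.

Lemma is_trig_trig_form y : is_trig (fun xi => trig_form Q (xi + y)).
Proof.
have h1 : is_trig (fun xi => 4 * \sum_i (Q *m Q) i i * sin ((xi + y) i 0 / 2) ^+ 2).
  apply: is_trigM; first exact: is_trig_cst.
  apply: is_trig_sum => i; apply: is_trigM; first exact: is_trig_cst.
  have -> : (fun xi : 'cV[R]_d => sin ((xi + y) i 0 / 2) ^+ 2) =
            (fun xi => 2^-1 + (- 2^-1) * cos (xi i 0 + y i 0)).
    apply/funext => xi; rewrite mxE; set z := _ + _.
    have := cos2Dsin2 (z / 2); have : cos z = cos (z / 2) ^+ 2 - sin (z / 2) ^+ 2.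
      by rewrite {1}(_ : z = z / 2 + z / 2) ?cosD//; field.
    by move=> -> h; lra.
  apply: is_trigD; first exact: is_trig_cst.
  by apply: is_trigM; [exact: is_trig_cst|exact: is_trig_coord_cos].
apply: is_trigD => //; apply: is_trigM; first exact: is_trig_cst.
apply: is_trig_sum => i; apply: is_trig_sum => j.
have e l : (fun xi : 'cV[R]_d => sin ((xi + y) l 0)) = (fun xi => sin (xi l 0 + y l 0)).
  by apply/funext => xi; rewrite mxE.
apply: is_trigM; last by rewrite e; exact: is_trig_coord_sin.
by apply: is_trigM; [exact: is_trig_cst|rewrite e; exact: is_trig_coord_sin].
Qed.

(** Such an s is determined by the integral vector A^T s, and s in the unit cube bounds the entries of
    the latter. *)
Lemma finite_dual_digits : finite_set (dual_digits A : set 'cV[R]_d).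
Proof.
pose M := (\sum_i \sum_j `|A i j|)%N.
(* the integral vector A^T s, shifted to be nonnegative, encodes s *)
pose dec (f : {ffun 'I_d -> 'I_(M.*2.+1)}) : 'cV[R]_d :=
  inv_tr R A *m \col_i ((f i)%:R - M%:R).
apply: (@sub_finite_set _ _ [set dec f | f in setT]); last exact/finite_image/finite_finset.
move=> s [s01 [k kE]].
have kb i : `|(k i 0)%:~R : R| <= M%:R.
  have -> : (k i 0)%:~R = (real_tr R A *m s) i 0 by rewrite kE mxE.
  rewrite mxE (le_trans (ler_norm_sum _ _ _))// /M natr_sum; apply: ler_sum => j _.
  rewrite natr_sum (bigD1 i)//= !mxE normrM natr_absz intr_norm.
  have /andP[s0 s1] := s01 j.
  rewrite (@le_trans _ _ `|(A j i)%:~R : R|)//; last by rewrite lerDl; apply: sumr_ge0.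
  by rewrite ler_piMr// ger0_norm// ltW.
have kb' i : `|k i 0| <= M%:Z by have := kb i; rewrite -intr_norm pmulrn ler_int.
have k0 i : 0 <= k i 0 + M%:Z.
  by have := kb' i; rewrite ler_norml -subr_ge0 opprK => /andP[].
exists [ffun i => inord (absz (k i 0 + M%:Z))] => //.
rewrite /dec -[RHS](mulKmx Aunit) kE; congr (_ *m _); apply: col_ext => i.
rewrite !mxE ffunE inordK; last first.
  rewrite ltnS -lez_nat gez0_abs// -addnn PoszD lerD2r.
  by rewrite (le_trans (ler_norm _)).
by rewrite natr_absz ger0_norm// rmorphD/= -pmulrn addrK.
Qed.

Lemma elliptic_maskE xi : elliptic_mask A Q xi =
  \prod_(s <- fset_set ((dual_digits A : set 'cV[R]_d) `\ 0))
    (trig_form Q (xi + (2 * pi) *: s) / trig_form Q ((2 * pi) *: s)).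
Proof.
by rewrite /elliptic_mask fsbig_finite//; exact/finite_setD/finite_dual_digits.
Qed.

Lemma is_trig_mask : is_trig (elliptic_mask A Q).
Proof.
pose m s xi := trig_form Q (xi + (2 * pi) *: s) / trig_form Q ((2 * pi) *: s).
have h s : is_trig (m s).
  by apply: is_trigM; [exact: is_trig_trig_form|exact: is_trig_cst].
have := is_trig_prod (fset_set ((dual_digits A : set 'cV[R]_d) `\ 0)) h.
by congr is_trig; apply/funext => xi; rewrite elliptic_maskE.
Qed.

Lemma elliptic_mask0 : elliptic_mask A Q 0 = 1.
Proof.
rewrite /elliptic_mask fsbig1// => s [[s01 _] s0].
rewrite add0r divff// gt_eqF// trig_form_gt0//.
by apply/eqP.
Qed.

(** The factor belonging to the digit congruent to - A^-T k vanishes. *)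
Lemma elliptic_mask_zero k : ~ (exists l : 'cV[int]_d, inv_tr R A *m ZtoR k = ZtoR l) ->
  elliptic_mask A Q ((2 * pi) *: (inv_tr R A *m ZtoR k)) = 0.
Proof.
move=> kA; set y := inv_tr R A *m _ in kA *.
(* [s] is the representative of [- y] in the unit cube *)
pose l : 'cV[int]_d := \col_i Num.floor (- y i 0).
pose s : 'cV[R]_d := - y - ZtoR l.
have sE i : s i 0 = - y i 0 - (Num.floor (- y i 0))%:~R by rewrite !mxE.
have s01 i : 0 <= s i 0 < 1.
  rewrite sE subr_ge0 ge_floor ltrBlDl.
  by rewrite -intrD1 floorD1_gt.
have sdig : (dual_digits A : set 'cV[R]_d) s.
  split=> //; exists (- k - A^T *m l).
  by rewrite /s mulmxBr mulmxN /y mulKVmx// raddfB raddfN/= map_mxM -map_trmx.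
have s0 : s != 0.
  apply/negP => /eqP h; apply: kA; exists (- l).
  by rewrite raddfN/=; apply/eqP; rewrite -subr_eq0 opprK -oppr_eq0 opprD; apply/eqP.
rewrite elliptic_maskE; apply/eqP; rewrite prodf_seq_eq0; apply/hasP; exists s => /=.
  rewrite in_fset_set ?inE/=; last exact/finite_setD/finite_dual_digits.
  by split=> //; apply/eqP.
rewrite -scalerDr (_ : y + s = ZtoR (- l)); last by rewrite /s addrA subrr add0r raddfN.
by rewrite trig_form_lattice mul0r.
Qed.

End Mask.

(** * Finite products of dilated masks *)

Section Growth.
Variable R : realType.
Implicit Types (x y b M : R).

Lemma bernoulli_le x n : 0 <= x -> 1 + n%:R * x <= (1 + x) ^+ n.
Proof.
move=> x0; elim: n => [|n IH]; first by rewrite mul0r addr0 expr0.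
rewrite exprSr -natr1 (le_trans _ (ler_wpM2r _ IH)) ?addr_ge0//.
have : 0 <= n%:R * x * x by rewrite !mulr_ge0// ler0n.
by lra.
Qed.

(** Used as an inductive weight along a contracting orbit: the decrease of (1 + kap y)^N from y to
    rho y absorbs any factor that is bounded and within O(y) of 1. *)
Lemma growth_weight (rho M C : R) : 0 < rho < 1 -> 0 <= C ->
  exists kap N, 0 <= kap /\ forall y b, 0 <= y -> b <= M -> b <= 1 + C * y ->
    b * (1 + kap * (rho * y)) ^+ N <= (1 + kap * y) ^+ N.
Proof.
move=> /andP[r0 r1] C0; have d0 : 0 < 1 - rho by rewrite subr_gt0.
(* [N] copes with the bound [M] when [kap * (rho * y)] exceeds 1, and [kap] with the slope [C] otherwise *)
have [N HN] : exists N : nat, 2 * rho * `|M| / (1 - rho) <= N.+1%:R.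
  exists (Num.truncn (2 * rho * `|M| / (1 - rho))).
  by apply/ltW/truncnS_gt.
pose kap := 2 * C / (N.+1%:R * (1 - rho)).
have n0 : 0 < N.+1%:R :> R by rewrite ltr0n.
have k0 : 0 <= kap by rewrite divr_ge0 ?mulr_ge0// ltW// mulr_gt0.
exists kap, N.+1; split=> // y b y0 bM bC.
have ky : 0 <= kap * y by rewrite mulr_ge0.
have p0 : 0 < 1 + kap * (rho * y) by rewrite ltr_wpDr// mulrCA mulr_ge0// ltW.
set z := kap * (1 - rho) * y / (1 + kap * (rho * y)).
have z0 : 0 <= z by rewrite divr_ge0 ?(ltW p0)// mulr_ge0// mulr_ge0// ltW.
have zE : (1 + kap * y) = (1 + z) * (1 + kap * (rho * y)).
  by rewrite /z mulrDl mul1r divfK ?gt_eqF//; ring.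
rewrite zE exprMn; apply: ler_wpM2r; first by rewrite exprn_ge0// ltW.
apply: (le_trans _ (bernoulli_le N.+1 z0)).
have [h|h] := leP (kap * (rho * y)) 1.
  rewrite (le_trans bC)// lerD2l /z mulrA ler_pdivlMr//.
  have : C * y * 2 = N.+1%:R * (kap * (1 - rho) * y).
    by rewrite /kap; field; rewrite !gt_eqF.
  move=> <-; rewrite ler_wpM2l ?mulr_ge0//.
  by rewrite -[2]/(1 + 1) lerD2l.
rewrite (le_trans bM)// (le_trans (ler_norm _))//.
apply: (@le_trans _ _ (N.+1%:R * ((1 - rho) / (2 * rho)))).
  rewrite mulrA ler_pdivlMr ?mulr_gt0//.
  by move: HN; rewrite ler_pdivrMr// (mulrC _ (`|M|)).
apply: (@le_trans _ _ (N.+1%:R * z)); last by rewrite lerDr.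
apply: ler_wpM2l; first exact: ltW n0.
rewrite /z ler_pdivlMr// mulrAC ler_pdivrMr ?mulr_gt0//.
rewrite (_ : kap * (1 - rho) * y * (2 * rho) = (1 - rho) * (2 * (kap * (rho * y)))); last by ring.
apply: ler_wpM2l; first exact: ltW d0.
have : 1 + kap * (rho * y) < 2 * (kap * (rho * y)) by lra.
exact: ltW.
Qed.

End Growth.

Lemma geometric_limit (R : realType) (u : nat -> R) (G rho : R) : 0 < rho < 1 ->
  (forall n, `|u n.+1 - u n| <= G * rho ^+ n.+1) ->
  forall n, `|lim (u @ \oo) - u n| <= G / (1 - rho) * rho ^+ n.
Proof.
move=> /andP[r0 r1] uG; have d0 : 0 < 1 - rho by rewrite subr_gt0.
have r0' := ltW r0.
have G0 : 0 <= G by have := le_trans (normr_ge0 _) (uG 0); rewrite pmulr_lge0 ?exprn_gt0.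
have G1 : 0 <= G / (1 - rho) by rewrite divr_ge0// ltW.
have step n k : `|u (n + k)%N - u n| <= G / (1 - rho) * (rho ^+ n - rho ^+ (n + k)).
  elim: k => [|k IH]; first by rewrite addn0 !subrr normr0 mulr0.
  rewrite addnS -(subrKA (u (n + k)%N)) (le_trans (ler_normD _ _))//.
  rewrite (le_trans (lerD (uG _) IH))// (_ : G * rho ^+ (n + k).+1 = G / (1 - rho) * ((1 - rho) * rho ^+ (n + k).+1)); last first.
    by field; rewrite gt_eqF.
  rewrite -mulrDr ler_wpM2l// mulrBl mul1r.
  have : rho * rho ^+ (n + k).+1 >= 0 by rewrite mulr_ge0 ?exprn_ge0.
  have : rho ^+ (n + k).+1 <= rho ^+ (n + k) by rewrite exprS ler_piMl ?exprn_ge0// ltW.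
  rewrite exprS; set p := rho ^+ (n + k); have p0 : 0 <= p by rewrite exprn_ge0.
  nra.
have step' n k : `|u (n + k)%N - u n| <= G / (1 - rho) * rho ^+ n.
  by rewrite (le_trans (step n k))// ler_wpM2l// gerBl exprn_ge0.
have cu : cvgn u.
  apply/cauchy_cvgP; apply: cauchy_exP => e e0.
  have : (fun n => G / (1 - rho) * rho ^+ n) @ \oo --> (0 : R).
    rewrite -[0](mulr0 (G / (1 - rho))); apply: cvgMl_tmp; apply: cvg_expr.
    by rewrite ger0_norm.
  move=> /cvgrPdist_lt/(_ (e / 2))[|N _ HN]; first by rewrite divr_gt0.
  have := HN N (leqnn N); rewrite /= sub0r normrN ger0_norm ?(mulr_ge0 G1 (exprn_ge0 N r0'))// => hN.
  exists (u N); exists N => // n /= Nn; rewrite /ball/= distrC -(subnKC Nn).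
  by rewrite (le_lt_trans (step' _ _))// (lt_le_trans hN)// ler_pdivrMr// ler_peMr ?(ltW e0)// ?ler1n.
move=> n.
apply: (norm_cvg_le (u := fun k => u k - u n) (n0 := n)).
  by apply: cvgB => //; exact: cvg_cst.
by move=> k nk; rewrite -(subnKC nk) step'.
Qed.

Section Norm1.
Variables (R : realType) (d : nat).
Implicit Types (x t : 'cV[R]_d) (M : 'M[R]_d).

Definition norm1 x : R := \sum_i `|x i 0|.

Lemma norm1_ge0 x : 0 <= norm1 x. Proof. exact: sumr_ge0. Qed.

Lemma coord_norm1 x i : `|x i 0| <= norm1 x.
Proof. by rewrite /norm1 (bigD1 i)//= lerDl sumr_ge0. Qed.

Lemma dot_norm1 t x : `|dot t x| <= norm1 t * norm1 x.
Proof.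
rewrite /dot (le_trans (ler_norm_sum _ _ _))// mulr_suml; apply: ler_sum => i _.
by rewrite normrM ler_wpM2l// coord_norm1.
Qed.

Lemma norm1_wt x : 1 + norm1 x <= (1 + d%:R) / wt x.
Proof.
rewrite ler_pdivlMr ?wt_gt0// mulrDl mul1r lerD ?wt_le1//.
rewrite /norm1 mulr_suml -[d in leRHS]card_ord -sumr_const.
by apply: ler_sum => i _; exact: coord_wt.
Qed.

Lemma mulmx_entry_le M C x i : 0 <= C -> (forall k l, `|M k l| <= C) ->
  `|(M *m x) i 0| <= C * norm1 x.
Proof.
move=> C0 MC; rewrite mxE (le_trans (ler_norm_sum _ _ _))// mulr_sumr.
by apply: ler_sum => j _; rewrite normrM ler_wpM2r.
Qed.

Lemma norm1_mulmx M C x : 0 <= C -> (forall k l, `|M k l| <= C) ->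
  norm1 (M *m x) <= d%:R * C * norm1 x.
Proof.
move=> C0 MC; rewrite -mulrA -[d in d%:R]card_ord mulr_natl -sumr_const.
by apply: ler_sum => i _; exact: mulmx_entry_le.
Qed.

Lemma dot_mulmx t M x : dot t (M *m x) = dot (M^T *m t) x.
Proof.
rewrite /dot; under eq_bigr do rewrite mxE mulr_sumr.
rewrite exchange_big/=; apply: eq_bigr => j _; rewrite mxE mulr_suml.
by apply: eq_bigr => i _; rewrite mxE; ring.
Qed.

End Norm1.

Section SymbolLimit.
Variables (R : realType) (d : nat) (A : 'M[int]_d) (Q : 'M[R]_d).
Local Notation term := (R[i] * 'cV[R]_d)%type.
Local Notation B := (inv_tr R A).
Local Notation ZtoR := (map_mx (intr : int -> R)).

Definition partial_symbol n (xi : 'cV[R]_d) : R :=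
  \prod_(1 <= j < n.+1) elliptic_mask A Q (B ^+ j *m xi).

Lemma partial_symbolS n xi : partial_symbol n.+1 xi =
  partial_symbol n xi * elliptic_mask A Q (B ^+ n.+1 *m xi).
Proof. by rewrite /partial_symbol big_nat_recr. Qed.

Lemma partial_symbol_0 n : elliptic_mask A Q 0 = 1 -> partial_symbol n 0 = 1.
Proof. by move=> m0; rewrite /partial_symbol big1// => j _; rewrite mulmx0. Qed.

Let dilate (M : 'M[R]_d) (L : seq term) : seq term := [seq (p.1, M^T *m p.2) | p <- L].

Let ev_dilate (M : 'M[R]_d) L xi : ev (dilate M L) xi = ev L (M *m xi).
Proof. by rewrite /ev big_map; apply: eq_bigr => p _; rewrite dot_mulmx. Qed.

Let mass (L : seq term) := \sum_(p <- L) cabs p.1.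
Let radius (L : seq term) := \sum_(p <- L) norm1 p.2.

Let mass_ge0 L : 0 <= mass L.
Proof. by apply: sumr_ge0 => p _; exact: cabs_ge0. Qed.

Let radius_ge0 L : 0 <= radius L.
Proof. by apply: sumr_ge0 => p _; exact: norm1_ge0. Qed.

Let le_radius L p : p \in L -> norm1 p.2 <= radius L.
Proof.
move=> pL; rewrite /radius (big_rem p)//= lerDl.
by apply: sumr_ge0 => x _; exact: norm1_ge0.
Qed.

Let ev_le_mass L xi : cabs (ev L xi) <= mass L.
Proof.
rewrite (le_trans (cabs_sum _ _))//; apply: ler_sum => p _.
by rewrite cabsM cabs_ei mulr1.
Qed.

Let ev_lip L xi : cabs (ev L xi - ev L 0) <= 2 * mass L * radius L * norm1 xi.
Proof.
rewrite /ev -sumrB (le_trans (cabs_sum _ _))// /mass -!mulrA mulr_suml mulr_sumr.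
rewrite big_seq [leRHS]big_seq; apply: ler_sum => p pL.
rewrite dot0r ei0 -mulrBr cabsM mulrCA ler_wpM2l ?cabs_ge0//.
rewrite (le_trans (cabs_ei_sub1 _))// ler_wpM2l//.
by rewrite (le_trans (dot_norm1 _ _))// ler_wpM2r ?norm1_ge0// le_radius.
Qed.

Let evk_dilate_le i k L (M : 'M[R]_d) (C : R) xi : 0 <= C -> (forall p l, `|M p l| <= C) ->
  cabs (evk i k (dilate M L) xi) <= mass L * (C * radius L) ^+ k.
Proof.
move=> C0 MC; rewrite /evk big_map (le_trans (cabs_sum _ _))// /mass mulr_suml.
rewrite big_seq [leRHS]big_seq; apply: ler_sum => p pL.
rewrite !cabsM cabs_ei mulr1 cabs_real ler_wpM2l ?cabs_ge0//.
rewrite normrX lerXn2r ?nnegrE ?mulr_ge0//.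
rewrite (le_trans (mulmx_entry_le _ _ C0 _))//.
  by move=> a b; rewrite mxE.
by rewrite ler_wpM2l// le_radius.
Qed.

(** The size of the products is controlled by telescoping [growth_weight] along the orbit of xi.
    The moments are controlled by the sum of the rates of the factors; the frequencies of the j-th
    factor are O(rho^j), so that this sum converges. *)
Lemma partial_symbol_estimates : (0 < d)%N -> (1 < `|\det A|)%N -> isotropic_factor A Q ->
  exists (L : nat -> seq term) (K a rho : R) (N : nat),
  [/\ 0 < rho < 1, 0 <= K, 0 <= a,
    forall n xi, ev (L n) xi = (partial_symbol n xi)%:C%C &
    (forall i k n xi, cabs (evk i k (L n) xi) <= K * a ^+ k / wt xi ^+ N) /\
    (forall n xi, `|scaling_symbol A Q xi - partial_symbol n xi| <= K * rho ^+ n / wt xi ^+ N)].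
Proof.
move=> d0 q1 fac; have [QT Qpos _] := fac; have Au := real_tr_unit R q1.
have m00 := elliptic_mask0 A QT Qpos.
have [L0 L0P] := is_trig_mask Q Au.
have [C [rho [C0 rho01 BC]]] := inv_tr_expr_entry d0 q1 fac.
have /andP[r0 r1] := rho01; have r0' := ltW r0.
pose m0 := elliptic_mask A Q.
have M1 : 1 <= mass L0.
  by have := ev_le_mass L0 0; rewrite -L0P m00 cabs1.
have m0M xi : `|m0 xi| <= mass L0 by rewrite -cabs_real L0P ev_le_mass.
pose lam := 2 * mass L0 * radius L0.
have lam0 : 0 <= lam by rewrite !mulr_ge0.
have m0L xi : `|m0 xi - 1| <= lam * norm1 xi.
  by have := ev_lip L0 xi; rewrite -!L0P m00 -rmorphB/= cabs_real.
have BCr j k l : `|(B ^+ j) k l| <= C * rho ^+ j := BC j k l.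
have Cr0 j : 0 <= C * rho ^+ j by rewrite mulr_ge0 ?exprn_ge0.
pose y (xi : 'cV[R]_d) := d%:R * C * norm1 xi.
have y0 xi : 0 <= y xi by rewrite !mulr_ge0 ?ler0n ?norm1_ge0.
have m0Lj j xi : `|m0 (B ^+ j *m xi) - 1| <= lam * (rho ^+ j * y xi).
  rewrite (le_trans (m0L _))// ler_wpM2l//.
  rewrite (le_trans (norm1_mulmx _ (Cr0 j) (BCr j)))//.
  by apply: eq_ler; rewrite /y; ring.
(* rounding the factors up to 1 makes the bounds for the products monotone *)
pose b j xi := Num.max 1 `|m0 (B ^+ j *m xi)|.
have b1 j xi : 1 <= b j xi by rewrite le_max lexx.
have [kap [N [kap0 kapP]]] := @growth_weight R rho (mass L0) lam rho01 lam0.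
have bP j xi : b j xi * (1 + kap * (rho ^+ j.+1 * y xi)) ^+ N <= (1 + kap * (rho ^+ j * y xi)) ^+ N.
  rewrite exprS -mulrA; apply: kapP.
  - by rewrite mulr_ge0 ?exprn_ge0.
  - by rewrite /b ge_max M1 m0M.
  - rewrite /b ge_max; apply/andP; split.
      by rewrite lerDl mulr_ge0// mulr_ge0 ?exprn_ge0.
    rewrite -lerBlDl.
    by rewrite (le_trans _ (m0Lj j xi))// -[X in _ - X](normr1 R) lerB_dist.
pose H xi := (1 + kap * y xi) ^+ N.
have prodH n xi : \prod_(1 <= j < n.+1) b j xi * (1 + kap * (rho ^+ n.+1 * y xi)) ^+ N <= H xi.
  elim: n => [|n IH].
    have e0 : 0 <= kap * (rho ^+ 1 * y xi) by rewrite mulr_ge0// mulr_ge0 ?exprn_ge0.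
    have e1 : kap * (rho ^+ 1 * y xi) <= kap * y xi.
      by rewrite ler_wpM2l// ler_piMl// expr1 ltW.
    have e2 := le_trans e0 e1.
    by rewrite big_nil mul1r /H lerXn2r ?nnegrE ?addr_ge0// lerD2l.
  rewrite big_nat_recr//= -mulrA (le_trans _ IH)// ler_wpM2l//.
  by apply: prodr_ge0 => j _; rewrite (le_trans _ (b1 j xi)).
have prodb n xi : \prod_(1 <= j < n.+1) b j xi <= H xi.
  apply: le_trans (prodH n xi); apply: ler_peMr.
    by apply: prodr_ge0 => j _; rewrite (le_trans _ (b1 j xi)).
  by rewrite exprn_ege1// lerDl mulr_ge0// mulr_ge0 ?exprn_ge0.
pose D := Num.max 1 (kap * (d%:R * C)).
pose K0 := (D * (1 + d%:R)) ^+ N.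
have D1 : 1 <= D by rewrite le_max lexx.
have D0 : 0 <= D by rewrite (le_trans _ D1).
have HK xi : H xi <= K0 / wt xi ^+ N.
  have e0 : 0 <= 1 + kap * y xi by rewrite addr_ge0// mulr_ge0.
  have e1 : 1 + kap * y xi <= D * (1 + d%:R) / wt xi.
    rewrite -mulrA (le_trans _ (ler_wpM2l D0 (norm1_wt xi)))//.
    rewrite mulrDr mulr1 lerD// /y mulrA ler_wpM2r ?norm1_ge0//.
    by rewrite le_max lexx orbT.
  by rewrite /H /K0 -exprVn -exprMn lerXn2r ?nnegrE ?(le_trans e0 e1).
have K00 : 0 <= K0 by rewrite exprn_ge0// mulr_ge0// addr_ge0 ?ler0n.
(* the products expanded as exponential sums *)
pose LL := fix LL n := if n is n'.+1 then prodL (LL n') (dilate (B ^+ n) L0) else [:: (1 : R[i], 0 : 'cV[R]_d)].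
have LLS n : LL n.+1 = prodL (LL n) (dilate (B ^+ n.+1) L0) by [].
pose a0 := mass L0 * (C * radius L0).
have a00 : 0 <= a0 by rewrite !mulr_ge0.
have LLk i n k xi : cabs (evk i k (LL n) xi) <=
    \prod_(1 <= j < n.+1) b j xi * (\sum_(1 <= j < n.+1) a0 * rho ^+ j) ^+ k.
  elim: n k => [|n IH] k.
    rewrite !big_nil /evk big_seq1/= mxE dot0l ei0 mul1r mulr1 mul1r cabs_real.
    by case: k => [|k]; rewrite ?expr0 ?normr1// !expr0n/= normr0.
  have -> : \prod_(1 <= j < n.+2) b j xi = \prod_(1 <= j < n.+1) b j xi * b n.+1 xi.
    by rewrite big_nat_recr.
  have -> : \sum_(1 <= j < n.+2) a0 * rho ^+ j = \sum_(1 <= j < n.+1) a0 * rho ^+ j + a0 * rho ^+ n.+1.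
    by rewrite big_nat_recr.
  rewrite LLS; apply: evk_prodL_le => //.
  - by apply: prodr_ge0 => j _; rewrite (le_trans _ (b1 j xi)).
  - by apply: sumr_ge0 => j _; rewrite mulr_ge0 ?exprn_ge0.
  - by rewrite (le_trans _ (b1 n.+1 xi)).
  - by rewrite mulr_ge0 ?exprn_ge0.
  case=> [|k'].
    by rewrite evk0 ev_dilate -L0P cabs_real expr0 mulr1 le_max lexx orbT.
  rewrite (le_trans (evk_dilate_le _ _ _ _ (Cr0 n.+1) (BCr n.+1)))//.
  rewrite (@le_trans _ _ ((a0 * rho ^+ n.+1) ^+ k'.+1))//; last first.
    by rewrite ler_peMl ?exprn_ge0// mulr_ge0 ?exprn_ge0.
  rewrite (_ : a0 * rho ^+ n.+1 = mass L0 * (C * rho ^+ n.+1 * radius L0)); last by rewrite /a0; ring.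
  rewrite [leRHS]exprMn ler_wpM2r ?exprn_ge0 ?mulr_ge0 ?exprn_ge0//.
  by rewrite exprS ler_peMr// exprn_ege1.
have LLev n xi : ev (LL n) xi = (partial_symbol n xi)%:C%C.
  elim: n => [|n IH].
    by rewrite /ev big_seq1/= dot0l ei0 mulr1 /partial_symbol big_nil.
  by rewrite LLS ev_prodL IH ev_dilate -L0P partial_symbolS rmorphM.
pose a := a0 / (1 - rho).
have d1 : 0 < 1 - rho by rewrite subr_gt0.
have a_ge0 : 0 <= a by rewrite divr_ge0// ltW.
have suma n : \sum_(1 <= j < n.+1) a0 * rho ^+ j <= a.
  rewrite -mulr_sumr /a ler_wpM2l// -[leRHS]mul1r ler_pdivlMr//.
  apply: (@le_trans _ _ (1 - rho ^+ n)); last by rewrite gerBl exprn_ge0.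
  elim: n => [|n IH]; first by rewrite big_nil mul0r expr0 subrr.
  rewrite big_nat_recr//= mulrDl (le_trans (lerD IH (lexx _)))// exprS.
  rewrite -subr_ge0 [leRHS](_ : _ = rho ^+ n * (1 - rho) ^+ 2); last by ring.
  by rewrite mulr_ge0 ?sqr_ge0 ?exprn_ge0.
have H0 xi : 0 <= H xi by rewrite (le_trans _ (prodb 0%N xi))// big_nil.
have Sn_le n xi : `|partial_symbol n xi| <= H xi.
  rewrite (le_trans _ (prodb n xi))// /partial_symbol normr_prod.
  by apply: ler_prod => j _; rewrite normr_ge0 le_max lexx orbT.
have Sstep n xi : `|partial_symbol n.+1 xi - partial_symbol n xi| <= H xi * lam * y xi * rho ^+ n.+1.
  rewrite partial_symbolS -[X in _ - X]mulr1 -mulrBr normrM.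
  rewrite [leRHS](_ : _ = H xi * (lam * (rho ^+ n.+1 * y xi))); last by ring.
  by apply: ler_pM.
pose E := d%:R * C * (1 + d%:R).
have E0 : 0 <= E by rewrite !mulr_ge0 ?addr_ge0 ?ler0n.
have yE xi : y xi <= E / wt xi.
  rewrite /y /E -[leRHS]mulrA ler_wpM2l ?mulr_ge0 ?ler0n//.
  by rewrite (le_trans _ (norm1_wt xi))// lerDr.
pose K1 := K0 * lam * E / (1 - rho).
have K10 : 0 <= K1 by rewrite divr_ge0 ?mulr_ge0// ltW.
exists LL, (K0 + K1), a, rho, N.+1; split=> //; first by rewrite addr_ge0.
have wN (xi : 'cV[R]_d) : 0 < wt xi ^+ N by rewrite exprn_gt0// wt_gt0.
split=> [i k n xi|n xi].
  have p0 : 0 <= \prod_(1 <= j < n.+1) b j xi.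
    by apply: prodr_ge0 => j _; rewrite (le_trans _ (b1 j xi)).
  have s0 : 0 <= \sum_(1 <= j < n.+1) a0 * rho ^+ j.
    by apply: sumr_ge0 => j _; rewrite mulr_ge0 ?exprn_ge0.
  apply: (le_trans (LLk i n k xi)).
  apply: (@le_trans _ _ (H xi * a ^+ k)).
    apply: ler_pM => //; first exact: exprn_ge0.
    by apply: lerXn2r; rewrite ?nnegrE ?suma.
  rewrite mulrAC; apply: ler_wpM2r; first exact: exprn_ge0.
  apply: (le_trans (HK xi)); apply: ler_pM => //.
  - by rewrite invr_ge0; exact/ltW/wN.
  - by rewrite lerDl.
  rewrite lef_pV2 ?posrE ?exprn_gt0 ?wt_gt0// exprS ler_piMl ?wt_le1//.
  exact/ltW/wN.
apply: (le_trans (geometric_limit rho01 (Sstep ^~ xi) n)).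
rewrite [leRHS]mulrAC; apply: ler_wpM2r; first exact: exprn_ge0.
apply: (@le_trans _ _ (K1 / wt xi ^+ N.+1)); last first.
  by rewrite ler_wpM2r ?invr_ge0 ?exprn_ge0 ?wt_ge0// lerDr.
have -> : K1 / wt xi ^+ N.+1 = (K0 / wt xi ^+ N) * lam * (E / wt xi) / (1 - rho).
  have w0 : wt xi != 0 by rewrite gt_eqF// wt_gt0.
  have p0 := lt0r_neq0 (wN xi); have dd := lt0r_neq0 d1.
  rewrite /K1 exprS; move: (wt xi ^+ N) p0 => p p0.
  by field; rewrite ?p0 ?w0 ?dd.
apply: ler_wpM2r; first by rewrite invr_ge0 ltW.
apply: ler_pM => //; first exact: mulr_ge0.
by apply: ler_wpM2r.
Qed.

End SymbolLimit.

(** * Zeros on the dual lattice *)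

Section SymbolZeros.
Variables (R : realType) (d : nat) (A : 'M[int]_d) (Q : 'M[R]_d).
Local Notation B := (inv_tr R A).
Local Notation ZtoR := (map_mx (intr : int -> R)).

(** Integral vectors tending to 0 are eventually 0, so the orbit of a nonzero [l] contains an integral
    vector whose successor is not integral; there the mask vanishes. *)
Lemma partial_symbol_lattice (l : 'cV[int]_d) : (0 < d)%N -> (1 < `|\det A|)%N ->
  isotropic_factor A Q -> l != 0 ->
  exists n0, forall n, (n0 <= n)%N -> partial_symbol A Q n ((2 * pi) *: ZtoR l) = 0.
Proof.
move=> d0 q1 fac l0; have Au := real_tr_unit R q1.
have [C [rho [C0 rho01 BC]]] := inv_tr_expr_entry d0 q1 fac.
have /andP[r0 r1] := rho01.
pose integral (x : 'cV[R]_d) := exists k : 'cV[int]_d, x = ZtoR k.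
have [[n [nI nNI]]|allI] := pselect (exists n, integral (B ^+ n *m ZtoR l) /\
    ~ integral (B ^+ n.+1 *m ZtoR l)).
  exists n.+1 => m nm; apply/eqP; rewrite prodf_seq_eq0; apply/hasP; exists n.+1.
    by rewrite mem_index_iota /= ltnS.
  have [k kE] := nI.
  rewrite /= -scalemxAr mx_exprS -mulmxA kE elliptic_mask_zero//.
  by move=> h; apply: nNI; rewrite mx_exprS -mulmxA kE.
have I n : integral (B ^+ n *m ZtoR l).
  elim: n => [|n IH]; first by exists l; rewrite expr0 mul1mx.
  by apply: contrapT => h; apply: allI; exists n.
have [n Hn] : exists n, C * rho ^+ n * norm1 (ZtoR l) < 1.
  have : (fun n => C * norm1 (ZtoR l) * rho ^+ n) @ \oo --> (0 : R).
    rewrite -[0](mulr0 (C * norm1 (ZtoR l))); apply: cvgMl_tmp; apply: cvg_expr.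
    by rewrite ger0_norm// ltW.
  move=> /cvgrPdist_lt/(_ 1 ltr01)[N _ HN]; exists N; have := HN N (leqnn N).
  rewrite /= sub0r normrN mulrAC => /(le_lt_trans _); apply.
  exact: ler_norm.
have [k kE] := I n.
have k0 : k = 0.
  apply/matrixP => i j; rewrite [j]ord1 mxE.
  have : `|(k i 0)%:~R : R| < 1.
    have -> : (k i 0)%:~R = (B ^+ n *m ZtoR l) i 0 by rewrite kE mxE.
    apply: le_lt_trans Hn; apply: mulmx_entry_le => //.
    by rewrite mulr_ge0// exprn_ge0// ltW.
  by rewrite -intr_norm -[1](mulr1z 1) ltr_int; case: (k i 0) => [[|m]|m].
have : ZtoR l = 0.
  elim: n {Hn} kE => [|n IH] kE; first by move: kE; rewrite expr0 mul1mx k0 raddf0.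
  apply: IH; rewrite k0 raddf0 -[LHS](mulKVmx Au).
  rewrite (_ : invmx _ *m _ = B ^+ n.+1 *m ZtoR l); last by rewrite mx_exprS mulmxA.
  by rewrite kE k0 raddf0 mulmx0.
move=> /matrixP h; suff /eqP E : l = 0 by rewrite E in l0.
apply/matrixP => i j; have := h i j; rewrite !mxE => /eqP.
by rewrite intr_eq0 => /eqP.
Qed.

End SymbolZeros.

(** * Integrals of complex-valued functions *)

Section ComplexIntegral.
Variables (R : realType) (d : nat).
Local Notation Re := (@complex.Re R).
Local Notation Im := (@complex.Im R).
Implicit Types (f g : 'cV[R]_d -> R[i]) (z : R[i]) (x y xi : 'cV[R]_d).

Definition cwlip f := wlip (fun x => Re (f x)) /\ wlip (fun x => Im (f x)).

Lemma Re_addc z z' : Re (z + z') = Re z + Re z'. Proof. by case: z z' => ? ? []. Qed.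
Lemma Im_addc z z' : Im (z + z') = Im z + Im z'. Proof. by case: z z' => ? ? []. Qed.
Lemma Re_mulc z z' : Re (z * z') = Re z * Re z' - Im z * Im z'.
Proof. by case: z z' => ? ? []. Qed.
Lemma Im_mulc z z' : Im (z * z') = Re z * Im z' + Im z * Re z'.
Proof. by case: z z' => ? ? []. Qed.

Lemma complex_eta z : (Re z +i* Im z)%C = z. Proof. by case: z. Qed.

Lemma cwlipD f g : cwlip f -> cwlip g -> cwlip (fun x => f x + g x).
Proof.
move=> [fr fi] [gr gi]; split.
  by under eq_fun do rewrite Re_addc; exact: wlipD.
by under eq_fun do rewrite Im_addc; exact: wlipD.
Qed.

Lemma cwlipZ z f : cwlip f -> cwlip (fun x => z * f x).
Proof.
move=> [fr fi]; split.
  by under eq_fun do rewrite Re_mulc; apply: wlipB; exact: wlipZ.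
by under eq_fun do rewrite Im_mulc; apply: wlipD; exact: wlipZ.
Qed.

Lemma cwlip0 : cwlip (fun=> 0).
Proof. by split; exact: wlip0. Qed.

Lemma cwlip_sum (I : Type) (r : seq I) (F : I -> 'cV[R]_d -> R[i]) :
  (forall i, cwlip (F i)) -> cwlip (fun x => \sum_(i <- r) F i x).
Proof.
move=> FW; elim: r => [|i r IH].
  by under eq_fun do rewrite big_nil; exact: cwlip0.
by under eq_fun do rewrite big_cons; exact: cwlipD.
Qed.

Lemma schC_cwlip f : schC f -> cwlip f.
Proof. by move=> [fr fi]; split; exact: sch_wlip. Qed.

Lemma cwlip_ei f xi : cwlip f -> cwlip (fun x => f x * ei (dot xi x)).
Proof.
move=> [fr fi]; split.
  have h1 := wlip_tg_dot true xi fr; have h2 := wlip_tg_dot false xi fi.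
  by have := wlipD h1 h2; congr wlip; apply/funext => x; rewrite Re_mulc /= /tg; ring.
have h1 := wlip_tg_dot true xi fi; have h2 := wlip_tg_dot false xi fr.
by have := wlipB h1 h2; congr wlip; apply/funext => x; rewrite Im_mulc /= /tg; ring.
Qed.

Lemma integralCD f g : cwlip f -> cwlip g ->
  integralC (fun x => f x + g x) = integralC f + integralC g.
Proof.
move=> [fr fi] [gr gi]; rewrite /integralC.
under [in X in (X +i* _)%C]eq_fun do rewrite Re_addc.
under [in X in (_ +i* X)%C]eq_fun do rewrite Im_addc.
by rewrite !integralRD.
Qed.

Lemma integralCZ z f : cwlip f -> integralC (fun x => z * f x) = z * integralC f.
Proof.
move=> [fr fi]; rewrite /integralC.
under [in X in (X +i* _)%C]eq_fun do rewrite Re_mulc.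
under [in X in (_ +i* X)%C]eq_fun do rewrite Im_mulc.
rewrite integralRB ?integralRD ?integralRZ//; try exact: wlipZ.
by rewrite -[z in RHS]complex_eta.
Qed.

Lemma integralC0 : integralC (fun _ : 'cV[R]_d => 0 : R[i]) = 0.
Proof. by rewrite /integralC/= integralR0. Qed.

Lemma integralC_sum (I : Type) (r : seq I) (F : I -> 'cV[R]_d -> R[i]) :
  (forall i, cwlip (F i)) ->
  integralC (fun x => \sum_(i <- r) F i x) = \sum_(i <- r) integralC (F i).
Proof.
move=> FW; elim: r => [|i r IH].
  by rewrite big_nil; under eq_fun do rewrite big_nil; exact: integralC0.
rewrite big_cons -IH -integralCD//; last exact: cwlip_sum.
by congr integralC; apply/funext => x; rewrite big_cons.
Qed.

Lemma integralCB f g : cwlip f -> cwlip g ->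
  integralC (fun x => f x - g x) = integralC f - integralC g.
Proof.
move=> wf wg; rewrite -mulN1r -integralCZ// -integralCD//; last exact: cwlipZ.
by congr integralC; apply/funext => x; rewrite mulN1r.
Qed.

Lemma integralC_le f (C : R) : cwlip f -> (forall x, cabs (f x) <= C * wt x) ->
  cabs (integralC f) <= 2 * (C * IntK R ^+ d).
Proof.
move=> [fr fi] fC; rewrite (le_trans (cabs_le_ReIm _))// mulr2n mulrDl mul1r.
apply: lerD; apply: integralR_le => // x; apply: le_trans (fC x).
  exact: Re_le_cabs.
exact: Im_le_cabs.
Qed.

Lemma integralC_shift f y : cwlip f -> integralC (fun x => f (x + y)) = integralC f.
Proof.
by move=> [fr fi]; rewrite /integralC; congr (_ +i* _)%C;
  [exact: (integralR_shift y fr)|exact: (integralR_shift y fi)].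
Qed.

Lemma fourier_ei f xi : fourier f xi = integralC (fun x => f x * ei (dot xi x)).
Proof. by []. Qed.

Lemma schC_decay f N : schC f -> exists C, 0 <= C /\ forall x, cabs (f x) <= C * wt x ^+ N.
Proof.
move=> [/(sch_decay N)[C CP] /(sch_decay N)[D DP]].
exists (`|C| + `|D|); split=> [|x]; first by rewrite addr_ge0.
have w0 : 0 <= wt x ^+ N by rewrite exprn_ge0// wt_ge0.
rewrite (le_trans (cabs_le_ReIm _))// mulrDl lerD//.
  by rewrite (le_trans (CP x))// ler_wpM2r// ler_norm.
by rewrite (le_trans (DP x))// ler_wpM2r// ler_norm.
Qed.

Lemma schC_shift f y : schC f -> schC (fun x => f (y + x)).
Proof.
move=> [fr fi]; split.
  by have := sch_shift y fr; congr sch; apply/funext => x; rewrite addrC.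
by have := sch_shift y fi; congr sch; apply/funext => x; rewrite addrC.
Qed.

Lemma schC_mulX i p f : schC f -> schC (fun x => ((x i 0) ^+ p)%:C%C * f x).
Proof.
move=> [fr fi]; split.
  by have := sch_mulX i p fr; congr sch; apply/funext => x; rewrite Re_mulc/= mul0r subr0.
by have := sch_mulX i p fi; congr sch; apply/funext => x; rewrite Im_mulc/= mul0r addr0.
Qed.

Lemma schCZ z f : schC f -> schC (fun x => z * f x).
Proof.
move=> [fr fi]; split.
  by under eq_fun do rewrite Re_mulc; apply: schB; exact: schZ.
by under eq_fun do rewrite Im_mulc; apply: schD; exact: schZ.
Qed.

Lemma schC_sum (I : Type) (r : seq I) (F : I -> 'cV[R]_d -> R[i]) :
  (forall i, schC (F i)) -> schC (fun x => \sum_(i <- r) F i x).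
Proof.
move=> FW; elim: r => [|i r IH].
  by under eq_fun do rewrite big_nil; split; exact: sch0.
under eq_fun do rewrite big_cons.
have [fr fi] := FW i; have [gr gi] := IH; split.
  by under eq_fun do rewrite Re_addc; exact: schD.
by under eq_fun do rewrite Im_addc; exact: schD.
Qed.

(** The decay of a Schwartz function absorbs polynomial growth. *)
Lemma wlip_multiplier (m a : 'cV[R]_d -> R) (K : R) N : sch a -> 0 <= K ->
  (forall x, `|m x| <= K / wt x ^+ N) ->
  (forall x i h, `|h| <= 1 -> `|m (x + h *: delta_mx i 0) - m x| <= K * `|h| / wt x ^+ N) ->
  wlip (fun x => m x * a x).
Proof.
move=> sa K0 m1 m2.
have [C CP] := sch_decay N.+1 sa; have [D DP] := sch_lip N.+1 sa.
have C0 : 0 <= C.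
  by rewrite -(pmulr_lge0 _ (exprn_gt0 N.+1 (wt_gt0 (0 : 'cV[R]_d)))) (le_trans _ (CP 0)).
pose F : R := (4 ^+ d) ^+ N.
have F0 : 0 <= F by rewrite !exprn_ge0.
have wE x : (wt x ^+ N)^-1 * wt x ^+ N.+1 = wt x.
  by rewrite exprS mulrCA mulVf ?mulr1// expf_neq0// gt_eqF// wt_gt0.
exists (K * C + K * (F * `|D|)); split=> [x|x i h h1].
  rewrite normrM (le_trans (ler_pM _ _ (m1 x) (CP x)))//.
  rewrite [leLHS](_ : _ = K * C * wt x); last by rewrite mulrACA wE.
  by rewrite ler_wpM2r ?wt_ge0// lerDl !mulr_ge0.
set x' := x + _.
have wx : (wt x' ^+ N)^-1 <= F / wt x ^+ N.
  have wp : 0 < wt x ^+ N by rewrite exprn_gt0// wt_gt0.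
  have wp' : 0 < wt x' ^+ N by rewrite exprn_gt0// wt_gt0.
  rewrite ler_pdivlMr// mulrC ler_pdivrMr// /F -exprMn.
  rewrite lerXn2r ?nnegrE ?mulr_ge0 ?exprn_ge0 ?wt_ge0//.
  have := wt_shift_delta x' i (h := - h); rewrite normrN => /(_ h1).
  by rewrite /x' scaleNr addrK.
rewrite (_ : _ - _ = (m x' - m x) * a x + m x' * (a x' - a x)); last by ring.
rewrite (le_trans (ler_normD _ _))// !normrM !mulrDl; apply: lerD.
  rewrite (le_trans (ler_pM _ _ (m2 x i h h1) (CP x)))//.
  by apply: eq_ler; rewrite mulrACA wE; ring.
rewrite (le_trans (ler_pM _ _ (m1 x') (DP x i h h1)))//.
apply: (@le_trans _ _ (K * (F / wt x ^+ N) * (`|D| * `|h| * wt x ^+ N.+1))); last first.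
  by apply: eq_ler; rewrite [K * _]mulrA mulrACA wE; ring.
have w0 : 0 <= wt x ^+ N.+1 by rewrite exprn_ge0// wt_ge0.
apply: ler_pM.
- by rewrite mulr_ge0// invr_ge0 exprn_ge0// wt_ge0.
- by rewrite (le_trans _ (DP x i h h1)).
- by rewrite ler_wpM2l.
- by rewrite ler_wpM2r// ler_wpM2r// ler_norm.
Qed.

End ComplexIntegral.

(** * Pairing the distribution with translates *)

Section ShiftOperator.
Variables (R : realType) (d : nat).
Local Notation term := (R[i] * 'cV[R]_d)%type.
Local Notation Re := (@complex.Re R).
Local Notation Im := (@complex.Im R).
Variables (S : 'cV[R]_d -> R) (L : nat -> seq term) (K a rho : R) (N : nat).
Hypothesis d_gt0 : (0 < d)%N.
Hypothesis rho01 : 0 < rho < 1.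
Hypothesis K0 : 0 <= K.
Hypothesis a0 : 0 <= a.
Hypothesis L_real : forall n xi, exists r, ev (L n) xi = r%:C%C.
Hypothesis L_moment : forall i k n xi, cabs (evk i k (L n) xi) <= K * a ^+ k / wt xi ^+ N.
Hypothesis L_cvg : forall n xi, `|S xi - Re (ev (L n) xi)| <= K * rho ^+ n / wt xi ^+ N.
Variable phi : functional R d.
Hypothesis phiE : forall g, schC g ->
  phi (fourier g) = integralC (fun xi => (S xi)%:C%C * g xi).
Implicit Types (f g : 'cV[R]_d -> R[i]) (x y xi : 'cV[R]_d).

Let Sn n xi := Re (ev (L n) xi).

Let SnE n xi : ev (L n) xi = (Sn n xi)%:C%C.
Proof. by have [r E] := L_real n xi; rewrite /Sn E. Qed.

Let geo_cvg0 C : (fun n => C * rho ^+ n) @ \oo --> (0 : R).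
Proof.
rewrite -[0](mulr0 C); apply: cvgMl_tmp; apply: cvg_expr.
by case/andP: rho01 => r0 r1; rewrite ger0_norm// ltW.
Qed.

Let Sn_cvg xi : (fun n => Sn n xi) @ \oo --> S xi.
Proof.
apply: cvg_dist_le (L_cvg ^~ xi) _.
have -> : (fun n => K * rho ^+ n / wt xi ^+ N) = (fun n => K / wt xi ^+ N * rho ^+ n).
  by apply/funext => n; rewrite mulrAC.
exact: geo_cvg0.
Qed.

Let is_derive_ev (l : seq term) i x (s : R) :
  is_derive s 1 (fun s : R => Re (ev l (x + s *: delta_mx i 0)))
    (Im (evk i 1 l (x + s *: delta_mx i 0))).
Proof.
elim: l => [|p l IH].
  rewrite /evk big_nil; under eq_fun do rewrite /ev big_nil.
  exact: is_derive_cst.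
rewrite /evk big_cons Im_addc; under eq_fun do rewrite /ev big_cons Re_addc.
apply: is_deriveD IH.
have dotE r : dot p.2 (x + r *: delta_mx i 0) = dot p.2 x + p.2 i 0 * r.
  by rewrite dotDr dot_delta mulrC.
pose q b (r : R) := tg b (dot p.2 x + p.2 i 0 * r).
have dq b (r : R) : is_derive r 1 (q b) (p.2 i 0 * (sg R b * q (~~ b) r)).
  have h1 : is_derive r 1 (fun r : R => dot p.2 x + p.2 i 0 * r) (p.2 i 0).
    have h := is_deriveD (is_derive_cst (dot p.2 x) r 1) (is_deriveZ (p.2 i 0) (is_derive_id r 1)).
    by apply: (is_derive_eq h); rewrite /GRing.scale/= mulr1 add0r.
  have h2 := @is_derive1_comp _ (tg b) _ r _ _ (is_derive_tg b _) h1.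
  by apply: (is_derive_eq h2); rewrite mulrC.
have h := is_deriveD (is_deriveZ (Re p.1) (dq true s)) (is_deriveZ (Im p.1) (dq false s)).
have E : (fun r : R => Re (p.1 * ei (dot p.2 (x + r *: delta_mx i 0)))) =
    (fun r => Re p.1 *: q true r + Im p.1 *: q false r).
  by apply/funext => r; rewrite Re_mulc dotE /q /tg /GRing.scale/=; ring.
rewrite E; apply: (is_derive_eq h).
by rewrite expr1 !Im_mulc !Re_mulc /= dotE /q /sg /tg /GRing.scale/=; ring.
Qed.

Let Sn_le n xi : `|Sn n xi| <= K / wt xi ^+ N.
Proof.
rewrite /Sn (le_trans (Re_le_cabs _))//.
by have := L_moment (Ordinal d_gt0) 0 n xi; rewrite evk0 expr0 mulr1.
Qed.

Let F : R := (4 ^+ d) ^+ N.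

Let wt_inv_shift xi i h : `|h| <= 1 ->
  (wt (xi + h *: delta_mx i 0) ^+ N)^-1 <= F / wt xi ^+ N.
Proof.
move=> h1; set x' := xi + _.
have wp : 0 < wt xi ^+ N by rewrite exprn_gt0// wt_gt0.
have wp' : 0 < wt x' ^+ N by rewrite exprn_gt0// wt_gt0.
rewrite ler_pdivlMr// mulrC ler_pdivrMr// /F -exprMn.
rewrite lerXn2r ?nnegrE ?mulr_ge0 ?exprn_ge0 ?wt_ge0//.
have := wt_shift_delta x' i (h := - h); rewrite normrN => /(_ h1).
by rewrite /x' scaleNr addrK.
Qed.

Let Sn_lip n xi i h : `|h| <= 1 ->
  `|Sn n (xi + h *: delta_mx i 0) - Sn n xi| <= K * a * F * `|h| / wt xi ^+ N.
Proof.
move=> h1; have := mvt_le (a := 0) (b := h) (M := K * a * (F / wt xi ^+ N)) (is_derive_ev (L n) i xi).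
rewrite scale0r addr0 subr0 => H; rewrite mulrAC -[K * a * F / _]mulrA; apply: H => s.
rewrite subr0 => sh; rewrite (le_trans (Im_le_cabs _))// (le_trans (L_moment _ _ _ _))//.
rewrite expr1 ler_wpM2l ?mulr_ge0// wt_inv_shift//.
exact: le_trans h1.
Qed.

Let K1 := K + K * a * F.

Let F0 : 0 <= F. Proof. by rewrite !exprn_ge0. Qed.

Let K10 : 0 <= K1. Proof. by rewrite addr_ge0// !mulr_ge0. Qed.

Let S_wlip (b : 'cV[R]_d -> R) : sch b -> wlip (fun x => S x * b x).
Proof.
move=> sb; have wv x : 0 <= (wt x ^+ N)^-1 by rewrite invr_ge0 exprn_ge0// wt_ge0.
apply: (wlip_multiplier sb K10 (N := N)) => [x|x i h h1].
  apply: (norm_cvg_le (n0 := 0) (@Sn_cvg x)) => n _; rewrite (le_trans (Sn_le n x))// ler_wpM2r//.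
  by rewrite lerDl !mulr_ge0.
apply: (norm_cvg_le (n0 := 0) (cvgB (@Sn_cvg _) (@Sn_cvg _))) => n _.
rewrite (le_trans (Sn_lip n x i h1))// ler_wpM2r// ler_wpM2r// lerDr//.
Qed.

Let cwlip_S g : schC g -> cwlip (fun xi => (S xi)%:C%C * g xi).
Proof.
move=> [gr gi]; split.
  by have := S_wlip gr; congr wlip; apply/funext => x; rewrite Re_mulc/= mul0r subr0.
by have := S_wlip gi; congr wlip; apply/funext => x; rewrite Im_mulc/= mul0r addr0.
Qed.

(** The operator with symbol [evk i k (L n)]. *)
Definition weighted i k n f x : R[i] :=
  \sum_(p <- L n) p.1 * ((p.2 i 0) ^+ k)%:C%C * f (x + p.2).

(** The operator with symbol [ev (L n)], a finite combination of translations. *)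
Definition approx n f x : R[i] := \sum_(p <- L n) p.1 * f (x + p.2).

Lemma weighted_fourier i k n g x : schC g ->
  weighted i k n (fourier g) x =
  integralC (fun xi => evk i k (L n) xi * (g xi * ei (dot x xi))).
Proof.
move=> sg; have wg := schC_cwlip sg.
rewrite /weighted.
transitivity (\sum_(p <- L n) integralC (fun xi => p.1 * (p.2 i 0 ^+ k)%:C%C *
   (g xi * ei (dot (x + p.2) xi)))).
  apply: eq_bigr => p _; rewrite integralCZ//; exact: cwlip_ei.
rewrite -integralC_sum; last by move=> p; apply: cwlipZ; exact: cwlip_ei.
congr integralC; apply/funext => xi; rewrite /evk mulr_suml; apply: eq_bigr => p _.
by rewrite dotDl eiD; ring.
Qed.

Lemma approx_weighted i n f x : approx n f x = weighted i 0 n f x.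
Proof. by apply: eq_bigr => p _; rewrite expr0 mulr1. Qed.

Lemma cwlip_evk i k n g x : schC g ->
  cwlip (fun xi => evk i k (L n) xi * (g xi * ei (dot x xi))).
Proof.
move=> sg; have wg := schC_cwlip sg.
have := @cwlip_sum R d _ (L n) (fun p xi => p.1 * (p.2 i 0 ^+ k)%:C%C *
   (g xi * ei (dot (x + p.2) xi))).
have -> : (fun x0 => \sum_(i0 <- L n) i0.1 * (i0.2 i 0 ^+ k)%:C%C * (g x0 * ei (dot (x + i0.2) x0)))
  = (fun xi => evk i k (L n) xi * (g xi * ei (dot x xi))).
  apply/funext => xi; rewrite /evk mulr_suml; apply: eq_bigr => p _.
  by rewrite dotDl eiD; ring.
by apply=> p; apply: cwlipZ; exact: cwlip_ei.
Qed.

(** On the Fourier side the weights are moments, bounded uniformly in [n] by hypothesis. *)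
Lemma weighted_bounded i k f : schC f -> exists C, forall n x, cabs (weighted i k n f x) <= C.
Proof.
move=> /schC_fourier_surj[g sg <-].
have [C [C0 CP]] := schC_decay N.+1 sg.
exists (2 * (K * a ^+ k * C * IntK R ^+ d)) => n x.
rewrite weighted_fourier//; apply: integralC_le; first exact: cwlip_evk.
move=> xi; have w0 := wt_gt0 xi.
rewrite !cabsM cabs_ei mulr1.
rewrite (le_trans (ler_pM (cabs_ge0 _) (cabs_ge0 _) (L_moment i k n xi) (CP xi)))//.
apply: eq_ler; rewrite exprS mulrACA; congr (_ * _).
by rewrite mulrCA mulVf ?mulr1// expf_neq0// gt_eqF.
Qed.

(** On the Fourier side this is the convergence of the symbols. *)
Lemma approx_cvg f : schC f -> exists C, forall n,
  cabs (phi f - approx n f 0) <= C * rho ^+ n.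
Proof.
move=> /schC_fourier_surj[g sg <-].
have [C [C0 CP]] := schC_decay N.+1 sg.
exists (2 * (K * C * IntK R ^+ d)) => n.
rewrite (approx_weighted (Ordinal d_gt0)) weighted_fourier// phiE//.
rewrite -integralCB; [|exact: cwlip_S|exact: cwlip_evk].
rewrite (_ : 2 * _ * _ = 2 * (K * rho ^+ n * C * IntK R ^+ d)); last by ring.
apply: integralC_le.
  have := cwlipD (cwlip_S sg) (cwlipZ (-1) (cwlip_evk (Ordinal d_gt0) 0 n 0 sg)).
  by congr cwlip; apply/funext => x; rewrite mulN1r.
move=> xi; have w0 := wt_gt0 xi.
rewrite evk0 dot0l ei0 mulr1 -mulrBl SnE -rmorphB/= cabsM cabs_real.
rewrite (le_trans (ler_pM (normr_ge0 _) (cabs_ge0 _) (L_cvg n xi) (CP xi)))//.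
apply: eq_ler; rewrite exprS mulrACA; congr (_ * _).
by rewrite mulrCA mulVf ?mulr1// expf_neq0// gt_eqF.
Qed.

Definition Phi f x : R[i] := phi (fun y => f (x + y)).

Lemma approx_shift n f x : approx n (fun y => f (x + y)) 0 = approx n f x.
Proof. by apply: eq_bigr => p _; rewrite add0r. Qed.

Lemma approx_Phi f x : schC f -> exists C, forall n,
  cabs (Phi f x - approx n f x) <= C * rho ^+ n.
Proof.
move=> sf; have [C CP] := approx_cvg (schC_shift x sf).
by exists C => n; rewrite -approx_shift; exact: CP.
Qed.

Lemma approx_Re_cvg f x : schC f -> (fun n => Re (approx n f x)) @ \oo --> Re (Phi f x).
Proof.
move=> sf; have [C CP] := approx_Phi x sf; apply: cvg_dist_le (geo_cvg0 C) => n.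
apply: le_trans (CP n); apply: le_trans (Re_le_cabs _).
by apply: eq_ler; case: (Phi f x) => ? ?; case: (approx n f x).
Qed.

Lemma approx_Im_cvg f x : schC f -> (fun n => Im (approx n f x)) @ \oo --> Im (Phi f x).
Proof.
move=> sf; have [C CP] := approx_Phi x sf; apply: cvg_dist_le (geo_cvg0 C) => n.
apply: le_trans (CP n); apply: le_trans (Im_le_cabs _).
by apply: eq_ler; case: (Phi f x) => ? ?; case: (approx n f x).
Qed.

Lemma approx_schC n f : schC f -> schC (approx n f).
Proof.
move=> sf; apply: schC_sum => p; apply: schCZ.
by have := schC_shift p.2 sf; congr schC; apply/funext => x; rewrite addrC.
Qed.

(** The binomial expansion of x_i^p = ((x_i + t_i) - t_i)^p gives weighted combinations of
    translates of y_i^q f(y). *)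
Lemma approx_mulX i p f : schC f -> exists C, forall n x,
  cabs (((x i 0) ^+ p)%:C%C * approx n f x) <= C.
Proof.
move=> sf.
have /choice[C CP] (j : nat) : exists C, forall n x,
    cabs (weighted i j n (fun y => ((y i 0) ^+ (p - j))%:C%C * f y) x) <= C.
  by apply: weighted_bounded; exact: schC_mulX.
exists (\sum_(j < p.+1) 'C(p, j)%:R * C j) => n x.
have -> : ((x i 0) ^+ p)%:C%C * approx n f x = \sum_(j < p.+1) ('C(p, j)%:R * (-1) ^+ j)%:C%C *
    weighted i j n (fun y => ((y i 0) ^+ (p - j))%:C%C * f y) x.
  rewrite /approx /weighted mulr_sumr.
  under [RHS]eq_bigr do rewrite mulr_sumr.
  rewrite exchange_big/=; apply: eq_bigr => q _.
  rewrite {1}(_ : x i 0 = (x + q.2) i 0 - q.2 i 0); last by rewrite mxE addrK.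
  rewrite exprBn rmorph_sum/= mulr_suml; apply: eq_bigr => j _.
  rewrite -mulr_natl !rmorphM/=; ring.
rewrite (le_trans (cabs_sum _ _))//; apply: ler_sum => j _.
rewrite cabsM cabs_real normrM normrX normrN1 expr1n mulr1 ger0_norm ?ler0n//.
by rewrite ler_wpM2l ?ler0n.
Qed.

Lemma approx_decay M f : schC f -> exists C, forall n x, cabs (approx n f x) <= C * wt x ^+ M.
Proof.
move=> sf.
have [|C CP] := @wt_decay_of_norm _ _ nat (fun n x => cabs (approx n f x)) _ M; last first.
  by exists C => n x; have := CP n x; rewrite ger0_norm ?cabs_ge0.
apply: norm_pow_of_coord => [|i p].
  have [C CP] := approx_mulX (Ordinal d_gt0) 0 sf; exists C => n x.
  by have := CP n x; rewrite expr0 mul1r ger0_norm ?cabs_ge0.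
have [C CP] := approx_mulX i p sf; exists C => n x.
by have := CP n x; rewrite cabsM cabs_real normrM (ger0_norm (cabs_ge0 _)).
Qed.

Lemma Phi_decay M f : schC f -> exists C, forall x, `|Re (Phi f x)| <= C * wt x ^+ M /\
  `|Im (Phi f x)| <= C * wt x ^+ M.
Proof.
move=> sf; have [C CP] := approx_decay M sf; exists C => x; split.
  by apply: (norm_cvg_le (n0 := 0) (@approx_Re_cvg _ x sf)) => n _; apply: le_trans (CP n x); exact: Re_le_cabs.
by apply: (norm_cvg_le (n0 := 0) (@approx_Im_cvg _ x sf)) => n _; apply: le_trans (CP n x); exact: Im_le_cabs.
Qed.

Definition partialC i f f' := forall x,
  is_derive x (delta_mx i 0) (fun y => Re (f y)) (Re (f' x)) /\
  is_derive x (delta_mx i 0) (fun y => Im (f y)) (Im (f' x)).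

Lemma schC_partial i f : schC f -> exists2 f', schC f' & partialC i f f'.
Proof.
move=> [sr si]; have [r' sr' dr] := sch_partial i sr; have [m' sm' dm] := sch_partial i si.
by exists (fun x => r' x +i* m' x)%C.
Qed.

Lemma approx_partial i n f f' : partialC i f f' -> partialC i (approx n f) (approx n f').
Proof.
move=> df x; rewrite /approx.
elim: (L n) => [|p l [IHr IHi]].
  rewrite big_nil; under eq_fun do rewrite big_nil.
  under [X in _ /\ is_derive _ _ X _]eq_fun do rewrite big_nil.
  by split; exact: is_derive_cst.
have [dr di] := df (x + p.2).
have := is_derive_shift dr; have := is_derive_shift di => {}di {}dr.
rewrite big_cons Re_addc Im_addc; split.
  under eq_fun do rewrite big_cons Re_addc Re_mulc.
  rewrite Re_mulc; apply: is_deriveD IHr.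
under eq_fun do rewrite big_cons Im_addc Im_mulc.
rewrite Im_mulc; apply: is_deriveD IHi.
Qed.

(** The second order Taylor estimate for [approx n f] holds uniformly in [n]. *)
Lemma Phi_partial i f f' : schC f -> partialC i f f' -> partialC i (Phi f) (Phi f').
Proof.
move=> sf df.
have sf' : schC f'.
  by have [fr fi] := sf; split;
    [exact: (sch_derive fr (fun x => (df x).1))|exact: (sch_derive fi (fun x => (df x).2))].
have [f'' sf'' df'] := schC_partial i sf'.
have [C CP] := approx_decay 0 sf''.
have line g g' (h : R[i] -> R) n : (forall x, is_derive x (delta_mx i 0) (fun y => h (approx n g y)) (h (approx n g' x))) ->
  forall x (t : R), is_derive t 1 (fun s => h (approx n g (x + s *: delta_mx i 0))) (h (approx n g' (x + t *: delta_mx i 0))).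
  by move=> dg x t; apply: (@is_derive_line _ _ (fun y => h (approx n g y)) (fun y => h (approx n g' y))).
move=> x; split; apply: (@is_derive_quad _ _ _ _ _ _ C) => h _.
  apply: (@norm_cvg_le _ _ _ _ 0) => [|n _].
    apply: cvgB; [apply: cvgB|apply: cvgMl_tmp]; exact: approx_Re_cvg.
  have := taylor1_le (a := 0) (h := h) (M := C)
    (line f f' Re n (fun x => (approx_partial n df x).1) x)
    (line f' f'' Re n (fun x => (approx_partial n df' x).1) x).
  rewrite scale0r addr0 add0r; apply=> t _.
  by rewrite (le_trans (Re_le_cabs _))// (le_trans (CP _ _))// expr0 mulr1.
apply: (@norm_cvg_le _ _ _ _ 0) => [|n _].
  apply: cvgB; [apply: cvgB|apply: cvgMl_tmp]; exact: approx_Im_cvg.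
have := taylor1_le (a := 0) (h := h) (M := C)
  (line f f' Im n (fun x => (approx_partial n df x).2) x)
  (line f' f'' Im n (fun x => (approx_partial n df' x).2) x).
rewrite scale0r addr0 add0r; apply=> t _.
by rewrite (le_trans (Im_le_cabs _))// (le_trans (CP _ _))// expr0 mulr1.
Qed.

Lemma Phi_schC f : schC f -> schC (Phi f).
Proof.
move=> sf; split.
  exists (fun h : 'cV[R]_d -> R => exists2 f, schC f & h = fun x => Re (Phi f x)); last by exists f.
  move=> _ {f sf}[f sf ->]; split=> [i|M].
    have [f' sf' df] := schC_partial i sf.
    by exists (fun x => Re (Phi f' x)) => [|x]; [exists f'|exact: (Phi_partial sf df x).1].
  by have [C CP] := Phi_decay M sf; exists C => x; case: (CP x).
exists (fun h : 'cV[R]_d -> R => exists2 f, schC f & h = fun x => Im (Phi f x)); last by exists f.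
move=> _ {f sf}[f sf ->]; split=> [i|M].
  have [f' sf' df] := schC_partial i sf.
  by exists (fun x => Im (Phi f' x)) => [|x]; [exists f'|exact: (Phi_partial sf df x).2].
by have [C CP] := Phi_decay M sf; exists C => x; case: (CP x).
Qed.

Lemma approx_coefficient n f eta : schC f ->
  integralC (fun x => approx n f x * ei (dot eta x)) = ev (L n) (- eta) * fourier f eta.
Proof.
move=> sf; have wf := schC_cwlip sf.
have E q x : f (x + q) * ei (dot eta x) =
    ei (dot q (- eta)) * (f (x + q) * ei (dot eta (x + q))).
  have e : ei (- dot eta q) * ei (dot eta q) = 1 by rewrite -eiD addNr ei0.
  rewrite dotDr eiD (dotC q) dotNl -[LHS]mul1r -e; ring.
have w q : cwlip (fun x => f (x + q) * ei (dot eta (x + q))).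
  by have [wr wi] := cwlip_ei eta wf; split; 
    [have := wlip_shift q wr|have := wlip_shift q wi].
transitivity (\sum_(p <- L n) integralC (fun x => p.1 * ei (dot p.2 (- eta)) *
    (f (x + p.2) * ei (dot eta (x + p.2))))).
  rewrite -integralC_sum; last by move=> p; exact: cwlipZ.
  congr integralC; apply/funext => x; rewrite mulr_suml; apply: eq_bigr => p _.
  by rewrite -!mulrA; congr (_ * _); rewrite E.
rewrite /ev mulr_suml; apply: eq_bigr => p _; rewrite integralCZ//; congr (_ * _).
rewrite fourier_ei.
exact: (@integralC_shift _ _ (fun x => f x * ei (dot eta x)) p.2 (cwlip_ei eta wf)).
Qed.

(** Dominated convergence, by the uniform decay of [approx n f]. *)
Lemma Phi_coefficient_cvg f eta : schC f ->
  (fun n => Re (ev (L n) (- eta) * fourier f eta)) @ \oo -->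
    Re (integralC (fun x => Phi f x * ei (dot eta x))) /\
  (fun n => Im (ev (L n) (- eta) * fourier f eta)) @ \oo -->
    Im (integralC (fun x => Phi f x * ei (dot eta x))).
Proof.
move=> sf; have [C CP] := approx_decay 1 sf.
have wn n : cwlip (fun x => approx n f x * ei (dot eta x)).
  by apply: cwlip_ei; apply: schC_cwlip; exact: approx_schC.
have [wr wi] : cwlip (fun x => Phi f x * ei (dot eta x)).
  by apply: cwlip_ei; apply: schC_cwlip; exact: Phi_schC.
have bn n x : cabs (approx n f x * ei (dot eta x)) <= C * wt x.
  by rewrite cabsM cabs_ei mulr1; have := CP n x; rewrite expr1.
have E n : ev (L n) (- eta) * fourier f eta =
  integralC (fun x => approx n f x * ei (dot eta x)) by rewrite approx_coefficient.
under [X in X @ _ --> _]eq_fun do rewrite E.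
under [X in _ /\ (X @ _ --> _)]eq_fun do rewrite E.
split; apply: (integralR_dominated (C := C)) => //.
- by move=> n; case: (wn n).
- by move=> n x; apply: le_trans (bn n x); exact: Re_le_cabs.
- move=> x; rewrite Re_mulc; under eq_fun do rewrite Re_mulc.
  by apply: cvgB; apply: cvgMr_tmp; [exact: approx_Re_cvg|exact: approx_Im_cvg].
- by move=> n; case: (wn n).
- by move=> n x; apply: le_trans (bn n x); exact: Im_le_cabs.
- move=> x; rewrite Im_mulc; under eq_fun do rewrite Im_mulc.
  by apply: cvgD; apply: cvgMr_tmp; [exact: approx_Re_cvg|exact: approx_Im_cvg].
Qed.

Lemma Phi_coefficient f eta (r : R) : schC f ->
  (exists n0, forall n, (n0 <= n)%N -> ev (L n) (- eta) = r%:C%C) ->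
  integralC (fun x => Phi f x * ei (dot eta x)) = r%:C%C * fourier f eta.
Proof.
move=> sf [n0 H]; have [cr ci] := Phi_coefficient_cvg eta sf.
have stat (u : nat -> R) l m : (forall n, (n0 <= n)%N -> u n = m) -> u @ \oo --> l -> l = m.
  move=> um /(cvg_lim (@Rhausdorff R)) <-; apply: cvg_lim; first exact: Rhausdorff.
  by apply: cvg_near_cst; exists n0.
rewrite -[LHS]complex_eta -[RHS]complex_eta; congr (_ +i* _)%C.
  by apply: stat cr => n nn; rewrite H.
by apply: stat ci => n nn; rewrite H.
Qed.

End ShiftOperator.

(** * Fejer kernels *)

Section FejerKernel.
Variable R : realType.
Implicit Types (H k : R -> R) (t x c C : R) (l : int).

Lemma le_primitive (F G f g : R -> R) (a b : R) : a <= b ->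
  (forall x, is_derive x 1 F (f x)) -> (forall x, is_derive x 1 G (g x)) ->
  (forall x, a <= x <= b -> f x <= g x) -> F b - F a <= G b - G a.
Proof.
move=> ab dF dG fg.
pose D x := G x - F x.
have dD x : is_derive x 1 D (g x - f x) by apply: is_deriveB.
have cD : continuous D := is_derive_continuous dD.
have [|c cab E] := @MVT_segment R D (fun x => g x - f x) a b ab (fun x _ => dD x).
  exact: continuous_subspaceT.
have : 0 <= D b - D a.
  by rewrite E mulr_ge0 ?subr_ge0// fg//; move: cab; rewrite in_itv.
by rewrite /D; lra.
Qed.

(** From sin y >= y cos y at y = x / 2 and the duplication formulas. *)
Lemma sin_ge_half x : 0 <= x <= pi / 2 -> x / 2 <= sin x.
Proof.
move=> /andP[x0 x1].
have h1 : 0 <= x / 2 by rewrite divr_ge0.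
have step (y : R) : 0 <= y <= pi / 2 -> y * cos y <= sin y.
  move=> /andP[y0 y1].
  have dl (s : R) : is_derive s 1 (fun s => s * cos y) (cos y).
    have h := is_deriveZ (cos y) (is_derive_id s 1).
    rewrite (_ : (fun s => s * cos y) = cos y \*: id); last first.
      by apply/funext => u; rewrite mulrC.
    by apply: (is_derive_eq h); rewrite /GRing.scale/= mulr1.
  have := le_primitive y0 dl (fun s => is_derive_sin s).
  rewrite sin0 mul0r !subr0; apply=> s /andP[s0 sy].
  have pp := @pi_ge0 R.
  by rewrite leNgt ltr_cos ?in_itv/= -?leNgt//; apply/andP; split; lra.
have c2 : cos (x / 2) ^+ 2 >= 1 / 2.
  have : 0 <= cos x by apply: cos_ge0_pihalf; rewrite (le_trans _ x0)// ?oppr_le0 ?divr_ge0 ?pi_ge0.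
  have -> : cos x = cos (x / 2 + x / 2) by congr cos; field.
  by rewrite cosD -!expr2; have := cos2Dsin2 (x / 2); lra.
have s2 : x / 2 * cos (x / 2) <= sin (x / 2) by apply: step; rewrite h1; lra.
have c0 : 0 <= cos (x / 2).
  by apply: cos_ge0_pihalf; have := @pi_ge0 R; lra.
have -> : sin x = sin (x / 2 + x / 2) by congr sin; field.
rewrite sinD; nra.
Qed.

Lemma sqr_le_sin t : `|t| <= 1 / 2 -> t ^+ 2 <= sin (pi * t) ^+ 2.
Proof.
move=> t2; have p2 := @pi_ge2 R.
have -> : sin (pi * t) ^+ 2 = sin (pi * `|t|) ^+ 2.
  by have [t0|t0] := leP 0 t; rewrite ?(ger0_norm t0)// (ltr0_norm t0) mulrN sinN sqrrN.
rewrite -real_normK ?num_real//; have t0 := normr_ge0 t.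
have : pi * `|t| / 2 <= sin (pi * `|t|) by apply: sin_ge_half; apply/andP; split; nra.
by move=> h; rewrite lerXn2r ?nnegrE//; nra.
Qed.

Lemma tg_period b x l : tg b (x + 2 * pi * l%:~R) = tg b x :> R.
Proof.
pose y : R := l%:~R * pi.
have sy : sin y = 0 := sin_intpi R l.
have -> : 2 * pi * l%:~R = y + y by rewrite /y; ring.
have h := cos2Dsin2 y; have s2 : sin (y + y) = 0 by rewrite sinD sy; ring.
have c2 : cos (y + y) = 1 by rewrite cosD sy; move: h; rewrite sy; nra.
by case: b; rewrite /tg; [rewrite cosD|rewrite sinD]; rewrite s2 c2 mulr1 mulr0 ?subr0 ?addr0.
Qed.

(** Bounded 1-periodic weights of mean [c] over a period whose product with [H] integrates to [c]
    times the integral of [H].  These properties are linear in the weight, which reduces the Fejer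
    kernel to its cosines. *)
Definition averages H k c :=
  [/\ continuous k, exists B, forall t, `|k t| <= B, Int (fun t => H t * k t) = c * Int H,
      forall t, k (t + 1) = k t &
      exists P, (forall t, is_derive t 1 P (k t)) /\ forall t, P (t + 1) = P t + c].

Section Averages.
Variable H : R -> R.
Hypothesis tH : tame H.

Lemma averages_tame k c : averages H k c -> tame (fun t => H t * k t).
Proof. by move=> [ck [B kB] _ _ _]; exact: tame_mul_bounded tH ck kB. Qed.

Lemma averagesD k k' c c' : averages H k c -> averages H k' c' ->
  averages H (fun t => k t + k' t) (c + c').
Proof.
move=> a a'; have tk := averages_tame a; have tk' := averages_tame a'.
have [ck [B kB] ik pk [P [dP PP]]] := a; have [ck' [B' kB'] ik' pk' [P' [dP' PP']]] := a'.
split.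
- by move=> t; apply: cvgD; [exact: ck|exact: ck'].
- by exists (B + B') => t; rewrite (le_trans (ler_normD _ _))// lerD.
- by under eq_fun do rewrite mulrDr; rewrite IntD// ik ik' mulrDl.
- by move=> t; rewrite pk pk'.
- exists (fun t => P t + P' t); split=> [t|t]; first exact: is_deriveD.
  by rewrite PP PP' addrACA.
Qed.

Lemma averagesZ a k c : averages H k c -> averages H (fun t => a * k t) (a * c).
Proof.
move=> h; have tk := averages_tame h; have [ck [B kB] ik pk [P [dP PP]]] := h.
split.
- by move=> t; apply: cvgMl_tmp; exact: ck.
- by exists (`|a| * B) => t; rewrite normrM ler_wpM2l.
- by under eq_fun do rewrite mulrCA; rewrite IntZ// ik mulrA.
- by move=> t; rewrite pk.
- exists (fun t => a * P t); split=> [t|t]; last by rewrite PP mulrDr.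
  exact: (is_deriveZ a (dP t)).
Qed.

Lemma averages0 : averages H (fun=> 0) 0.
Proof.
split.
- by move=> t; exact: cvg_cst.
- by exists 0 => t; rewrite normr0.
- under eq_fun do rewrite mulr0.
  by rewrite mul0r; have := IntZ 0 tH; under eq_fun do rewrite mul0r; rewrite mul0r.
- by [].
- by exists (fun=> 0); split=> [t|t]; [exact: is_derive_cst|rewrite addr0].
Qed.

Lemma averages_sum n (k : nat -> R -> R) (c : nat -> R) : (forall i, averages H (k i) (c i)) ->
  averages H (fun t => \sum_(0 <= i < n) k i t) (\sum_(0 <= i < n) c i).
Proof.
move=> h; elim: n => [|n IH].
  by rewrite big_nil; under eq_fun do rewrite big_nil; exact: averages0.
rewrite big_nat_recr//=; under eq_fun do rewrite big_nat_recr//=.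
exact: averagesD.
Qed.

Hypothesis H_coef : forall l, l != 0 -> Int (fun t => H t * cos (2 * pi * l%:~R * t)) = 0.

Lemma averages_cos l : averages H (fun t => cos (2 * pi * l%:~R * t)) (l == 0)%:R.
Proof.
have [->|l0] := eqVneq l 0.
  under eq_fun do rewrite mulr0 mul0r cos0.
  split=> [t|||//|]; first exact: cvg_cst.
  - by exists 1 => t; rewrite normr1.
  - by under eq_fun do rewrite mulr1; rewrite mul1r.
  - by exists id; split=> // t; exact: is_derive_id.
have w0 : 2 * pi * l%:~R != 0 :> R by rewrite !mulf_neq0 ?intr_eq0// gt_eqF// pi_gt0.
split.
- exact: (@tg_continuous_mul R true (2 * pi * l%:~R)).
- by exists 1 => t; exact: (tg_le1 true).
- by rewrite H_coef// mul0r.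
- by move=> t; rewrite mulrDr mulr1; exact: (tg_period true).
- exists (fun t => (2 * pi * l%:~R)^-1 * sin (2 * pi * l%:~R * t)); split=> t.
    have h := is_deriveZ (2 * pi * l%:~R)^-1 (is_derive_tg_mul false (2 * pi * l%:~R) t).
    apply: (is_derive_eq h).
    by rewrite /sg /tg /GRing.scale/= mul1r mulrA mulVf// mul1r.
  rewrite addr0; congr (_ * _).
  rewrite (_ : _ * (t + 1) = 2 * pi * l%:~R * t + 2 * pi * l%:~R); last by ring.
  exact: (tg_period false).
Qed.

(** The square of the modulus of the sum of the e^(2 pi i a t), 0 <= a < N, divided by N. *)
Definition fejer N t : R :=
  N%:R^-1 * \sum_(0 <= a < N) \sum_(0 <= b < N) cos (2 * pi * (a%:Z - b%:Z)%:~R * t).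

Lemma averages_fejer N : (0 < N)%N -> averages H (fejer N) 1.
Proof.
move=> N0; have -> : 1 = N%:R^-1 * \sum_(0 <= a < N) \sum_(0 <= b < N) (a%:Z - b%:Z == 0 :> int)%:R :> R.
  rewrite (eq_big_nat _ _ (F2 := fun=> 1)) => [|a aN].
    by rewrite big_const_nat subn0 iter_addr_0 mulVf// pnatr_eq0 -lt0n.
  rewrite (big_nat_widenl _ 0)//= (bigD1_seq a) ?mem_index_iota ?iota_uniq//=.
  rewrite subrr eqxx big1 ?addr0// => b ba.
  by rewrite subr_eq0 eqz_nat eq_sym (negPf ba).
apply: averagesZ; apply: averages_sum => a; apply: averages_sum => b.
exact: averages_cos.
Qed.

End Averages.

Lemma dirichlet_cos N x : 2 * sin x * \sum_(0 <= a < N) cos (2 * a%:R * x) =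
  sin (2 * N%:R * x - x) + sin x.
Proof.
elim: N => [|N IH]; first by rewrite big_nil mulr0 mulr0 mul0r sub0r sinN addNr.
rewrite big_nat_recr//= mulrDr IH -[N.+1%:R]natr1.
have -> : 2 * (N%:R + 1) * x - x = 2 * N%:R * x + x by ring.
by rewrite sinB sinD; ring.
Qed.

Lemma dirichlet_sin N x : 2 * sin x * \sum_(0 <= a < N) sin (2 * a%:R * x) =
  cos x - cos (2 * N%:R * x - x).
Proof.
elim: N => [|N IH]; first by rewrite big_nil mulr0 mulr0 mul0r sub0r cosN subrr.
rewrite big_nat_recr//= mulrDr IH -[N.+1%:R]natr1.
have -> : 2 * (N%:R + 1) * x - x = 2 * N%:R * x + x by ring.
by rewrite cosB cosD; ring.
Qed.

Lemma fejerE N t : fejer N t = N%:R^-1 *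
  ((\sum_(0 <= a < N) cos (2 * a%:R * (pi * t))) ^+ 2 +
   (\sum_(0 <= a < N) sin (2 * a%:R * (pi * t))) ^+ 2).
Proof.
rewrite /fejer; congr (_ * _); rewrite !expr2 !big_distrlr/= -big_split/=.
apply: eq_bigr => a _; rewrite -big_split/=; apply: eq_bigr => b _.
rewrite -cosB; congr cos; rewrite rmorphB/= -!pmulrn; ring.
Qed.

Lemma fejer_ge0 N t : 0 <= fejer N t.
Proof. by rewrite fejerE mulr_ge0 ?invr_ge0// addr_ge0 ?sqr_ge0. Qed.

(** Multiplication by 2 sin (pi t) telescopes the two sums in [fejerE]. *)
Lemma fejer_sin_le N t : sin (pi * t) ^+ 2 * fejer N t <= N%:R^-1.
Proof.
rewrite fejerE mulrCA ler_piMr ?invr_ge0//.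
set x := pi * t; set y := 2 * N%:R * x - x.
have h1 := dirichlet_cos N x; have h2 := dirichlet_sin N x.
set A := \sum_(0 <= a < N) _ in h1 *; set B := \sum_(0 <= a < N) _ in h2 *.
suff : (2 * sin x * A) ^+ 2 + (2 * sin x * B) ^+ 2 <= 4 by nra.
rewrite h1 h2 -/y; have := cos2Dsin2 x; have := cos2Dsin2 y.
have := sqr_ge0 (sin x - sin y); have := sqr_ge0 (cos x + cos y); nra.
Qed.

End FejerKernel.

(** * Sums over the integers *)

Section LatticeSum1.
Variable R : realType.
Implicit Types (H h : R -> R) (t C : R) (l : int).

(** The integers from - n to n - 1, paired as the two constructors of [int]. *)
Definition lattice_sum1 n h : R := \sum_(0 <= j < n) (h (- j.+1%:R) + h j%:R).

(** A telescoping majorant for the tails of the sum of [w1] over the integers. *)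
Definition tail1 n : R := 8 / n.+1%:R.

Lemma w1_int_le n n' : (n <= n')%N ->
  \sum_(n <= j < n') (w1 (- (j.+1)%:R) + w1 j%:R) <= tail1 n - tail1 n' :> R.
Proof.
elim: n' => [|m IH]; first by rewrite leqn0 => /eqP ->; rewrite big_geq// subrr.
rewrite leq_eqVlt => /predU1P[->|]; first by rewrite big_geq// subrr.
rewrite ltnS => nm; rewrite big_nat_recr//=; have := IH nm.
suff : w1 (- (m.+1)%:R) + w1 m%:R <= tail1 m - tail1 m.+1 by lra.
have m0 : 0 <= m%:R :> R by [].
have w : w1 (- (m.+1)%:R) <= w1 m%:R :> R.
  rewrite /w1 sqrrN lef_pV2 ?posrE ?ltr_wpDr ?sqr_ge0// lerD2l -natr1.
  by nra.
suff : w1 m%:R <= (tail1 m - tail1 m.+1) / 2 by lra.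
have -> : (tail1 m - tail1 m.+1) / 2 = 4 / ((m%:R + 1) * (m%:R + 2)).
  rewrite /tail1 -[m.+2%:R]natr1 -[m.+1%:R]natr1; field.
  by apply/andP; split; rewrite gt_eqF//; lra.
rewrite /w1 ler_pdivlMr ?mulr_gt0 ?ltr_wpDl// mulrC ler_pdivrMr ?ltr_wpDr ?sqr_ge0//.
by nra.
Qed.

Lemma tail1_ge0 n : 0 <= tail1 n. Proof. by rewrite divr_ge0. Qed.

Lemma lattice_sum1_tail h C n n' : (forall t, `|h t| <= C * w1 t) -> (n <= n')%N ->
  `|lattice_sum1 n' h - lattice_sum1 n h| <= C * tail1 n.
Proof.
move=> hC nn; have C0 : 0 <= C by rewrite -(pmulr_lge0 _ (w1_gt0 (0 : R))) (le_trans _ (hC 0)).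
rewrite /lattice_sum1 (big_cat_nat (leq0n n) nn)//= addrC addrK.
rewrite (le_trans (ler_norm_sum _ _ _))//.
rewrite (le_trans (ler_sum _ (fun j _ => ler_normD _ _)))//.
apply: (@le_trans _ _ (C * (\sum_(n <= j < n') (w1 (- (j.+1)%:R) + w1 j%:R)))).
  by rewrite mulr_sumr; apply: ler_sum => j _; rewrite mulrDr lerD.
rewrite ler_wpM2l// (le_trans (w1_int_le nn))//.
by rewrite gerBl tail1_ge0.
Qed.

Lemma lattice_sum1_le h C n : (forall t, `|h t| <= C * w1 t) -> `|lattice_sum1 n h| <= C * 8.
Proof.
move=> hC; have := lattice_sum1_tail hC (leq0n n).
by rewrite /lattice_sum1 [X in _ - X]big_nil subr0 /tail1 divr1.
Qed.

Lemma primitive_cells (F : R -> R) n : F n%:R - F (- n%:R) =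
  \sum_(0 <= j < n) ((F (- j.+1%:R + 1) - F (- j.+1%:R)) + (F (j%:R + 1) - F j%:R)).
Proof.
elim: n => [|n IH]; first by rewrite big_nil oppr0 subrr.
rewrite big_nat_recr//= -IH -[n.+1%:R]natr1 opprD subrK; ring.
Qed.

Lemma sin2_int_shift l s : sin (pi * (s + l%:~R)) ^+ 2 = sin (pi * s) ^+ 2 :> R.
Proof.
have sl := sin_intpi R l; have h := cos2Dsin2 (l%:~R * pi : R).
rewrite mulrDr (mulrC pi l%:~R) sinD sl mulr0 addr0 exprMn.
by move: h; rewrite sl expr0n/= addr0 => ->; rewrite mulr1.
Qed.

Section Summation1.
Variables (H : R -> R) (C : R).
Hypothesis H_le : forall t, `|H t| <= C * w1 t.
Hypothesis H_lip : forall t (h : R), `|h| <= 1 -> `|H (t + h) - H t| <= C * `|h| * w1 t.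
Hypothesis H_coef : forall l, l != 0 -> Int (fun t => H t * cos (2 * pi * l%:~R * t)) = 0.

Let C0 : 0 <= C.
Proof. by rewrite -(pmulr_lge0 _ (w1_gt0 (0 : R))) (le_trans _ (H_le 0)). Qed.

Let tH : tame H. Proof. exact: lip_tame H_le H_lip. Qed.

(** On the cell centred at l, let s be the displacement from l.  In the Lipschitz bound |s| <= e + s^2 / e; the kernel
    has mass 1, and s^2 <= sin^2 (pi s) makes s^2 times the kernel at most 1 / N. *)
Let cell (N : nat) (e : R) (F P : R -> R) l : 0 < e ->
  (forall t, is_derive t 1 P (fejer N t)) -> (forall t, P (t + 1) = P t + 1) ->
  (forall t, is_derive t 1 F (H (t - 1 / 2) * fejer N (t - 1 / 2))) ->
  `|(F (l%:~R + 1) - F l%:~R) - H l%:~R| <= C * w1 (l%:~R) * (e + N%:R^-1 / e).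
Proof.
move=> e0 dP PP dF; set m : R := l%:~R; set D := C * w1 m.
have D0 : 0 <= D by rewrite mulr_ge0// w1_ge0.
(* the primitive of [(H (t - 1 / 2) - H m)] times the kernel, and one of its majorant [u] *)
pose G t := F t - H m * P (t - 1 / 2).
pose g t := (H (t - 1 / 2) - H m) * fejer N (t - 1 / 2).
have dPs t : is_derive t 1 (fun t => P (t - 1 / 2)) (fejer N (t - 1 / 2)).
  exact: (is_derive_shift (dP (t - 1 / 2))).
have dG t : is_derive t 1 G (g t).
  have h := is_deriveB (dF t) (is_deriveZ (H m) (dPs t)).
  by apply: (is_derive_eq h); rewrite /g mulrBl.
pose U t := D * (e * P (t - 1 / 2) + N%:R^-1 / e * t).
pose u t := D * (e * fejer N (t - 1 / 2) + N%:R^-1 / e).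
have dU t : is_derive t 1 U (u t).
  have h := is_deriveZ D (is_deriveD (is_deriveZ e (dPs t))
    (is_deriveZ (N%:R^-1 / e) (is_derive_id t 1))).
  by apply: (is_derive_eq h); rewrite /u /GRing.scale/= mulr1.
have gu t : m <= t <= m + 1 -> `|g t| <= u t.
  move=> /andP[mt tm]; pose s := t - 1 / 2 - m.
  have s2 : `|s| <= 1 / 2 by rewrite ler_norml /s; lra.
  have k0 := fejer_ge0 N (t - 1 / 2).
  rewrite normrM (ger0_norm k0).
  have hs : `|H (t - 1 / 2) - H m| <= D * `|s|.
    have -> : t - 1 / 2 = m + s by rewrite /s; ring.
    rewrite (le_trans (H_lip m _))//; first lra.
    by rewrite /D mulrAC.
  apply: (@le_trans _ _ (D * `|s| * fejer N (t - 1 / 2))); first by rewrite ler_wpM2r.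
  rewrite -mulrA /u ler_wpM2l//.
  have se : `|s| <= e + s ^+ 2 / e.
    rewrite -(@ler_pM2r _ e)// mulrDl divfK ?gt_eqF// -[s ^+ 2]real_normK ?num_real//.
    by have := sqr_ge0 (`|s| - e); have := sqr_ge0 (`|s|); nra.
  rewrite (le_trans (ler_wpM2r k0 se))// mulrDl lerD2l.
  rewrite mulrAC ler_wpM2r ?invr_ge0 ?(ltW e0)//.
  apply: le_trans (fejer_sin_le N (t - 1 / 2)); rewrite ler_wpM2r//.
  have -> : t - 1 / 2 = s + l%:~R by rewrite /s /m; ring.
  by rewrite sin2_int_shift sqr_le_sin.
have mm : m <= m + 1 by rewrite lerDl.
have U1 : U (m + 1) - U m = D * (e + N%:R^-1 / e).
  rewrite /U (_ : m + 1 - 1 / 2 = m - 1 / 2 + 1); last by ring.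
  by rewrite PP; ring.
have G1 : G (m + 1) - G m = F (m + 1) - F m - H m.
  rewrite /G (_ : m + 1 - 1 / 2 = m - 1 / 2 + 1); last by ring.
  by rewrite PP; ring.
rewrite -U1 -G1 ler_norml; apply/andP; split; last first.
  apply: le_primitive mm dG dU _ => t /gu; rewrite ler_norml; lra.
have dN t : is_derive t 1 (fun t => - U t) (- u t) by apply: is_deriveN.
have : - U (m + 1) - - U m <= G (m + 1) - G m.
  by apply: le_primitive mm dN dG _ => t /gu; rewrite ler_norml; lra.
lra.
Qed.

(** The translation by 1/2 turns the intervals between consecutive integers into cells centred at
    integers. *)
Let approximate (N : nat) e n : (0 < N)%N -> 0 < e ->
  `|Int H - lattice_sum1 n H| <= C * tail1 n + C * 8 * (e + N%:R^-1 / e).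
Proof.
move=> N0 e0; have av := averages_fejer tH H_coef N0.
have tk := averages_tame tH av.
have [_ _ iH _ [P [dP PP]]] := av.
have tks := tame_shift (- (1 / 2)) tk.
have [F dF] := tame_primitive tks.
have iS := Int_shift (- (1 / 2)) tk; rewrite iH (mul1r (Int H)) in iS.
have cF : (fun n => F n%:R - F (- n%:R)) @ \oo --> Int H.
  by rewrite -iS; exact: Int_primitive tks dF.
set E := e + _; have E0 : 0 <= E by rewrite addr_ge0// ?divr_ge0 ?invr_ge0// ltW.
apply: (@norm_cvg_le _ (fun n' => F n'%:R - F (- n'%:R) - lattice_sum1 n H) _ _ n).
  by apply: cvgB => //; exact: cvg_cst.
move=> n' nn; rewrite -(subrK (lattice_sum1 n' H) (F _ - _)) -[X in `|X|]addrA addrC.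
rewrite (le_trans (ler_normD _ _))// lerD//; first exact: lattice_sum1_tail.
rewrite primitive_cells /lattice_sum1 -sumrB (le_trans (ler_norm_sum _ _ _))//.
apply: (@le_trans _ _ (\sum_(0 <= j < n') (C * E * w1 (- j.+1%:R) + C * E * w1 j%:R))).
  apply: ler_sum => j _; rewrite opprD addrACA (le_trans (ler_normD _ _))// lerD//.
    have := cell (Negz j) e0 dP PP dF; rewrite NegzE rmorphN/= => h.
    by rewrite (le_trans h)// mulrAC.
  by have := cell (Posz j) e0 dP PP dF => h; rewrite (le_trans h)// mulrAC.
have := @lattice_sum1_le (fun t => C * E * w1 t) (C * E) n'.
rewrite mulrAC => /(_ _)/(le_trans (ler_norm _)); apply => t.
by rewrite ger0_norm// mulr_ge0 ?w1_ge0// mulr_ge0.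
Qed.

(** Let N tend to infinity and then e to 0 in [approximate]. *)
Lemma lattice_sum1_approx n : `|Int H - lattice_sum1 n H| <= C * tail1 n.
Proof.
apply/ler_addgt0Pr => d d0; pose e := d / (C * 16 + 1).
have e0 : 0 < e by rewrite divr_gt0// ltr_wpDl// mulr_ge0.
pose N := (Num.truncn (e ^- 2)).+1.
have NE : N%:R^-1 / e <= e.
  rewrite ler_pdivrMr// -expr2 -[leRHS]invrK lef_pV2 ?posrE ?ltr0n// ?invr_gt0 ?exprn_gt0//.
  by apply/ltW; exact: truncnS_gt.
rewrite (le_trans (approximate n (ltn0Sn _ : (0 < N)%N) e0))// lerD2l.
apply: (@le_trans _ _ (C * 8 * (e + e))); first by rewrite ler_wpM2l ?mulr_ge0// lerD2l.
rewrite (_ : _ * (e + e) = C * 16 * e); last by ring.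
by rewrite /e mulrA ler_pdivrMr ?ltr_wpDl ?mulr_ge0//; nra.
Qed.

End Summation1.

End LatticeSum1.

(** * Sums over the lattice, one coordinate at a time *)

Section LatticeSum.
Variable R : realType.
Local Notation ZtoR := (map_mx (intr : int -> R)).

Fixpoint lattice_sum n d : ('cV[R]_d -> R) -> R :=
  match d with
  | 0 => fun f => f 0
  | k.+1 => fun f => lattice_sum n (fun v : 'cV[R]_k => lattice_sum1 n (fun t => f (ccons t v)))
  end.

Lemma lattice_sum1B n (f g : R -> R) :
  lattice_sum1 n (fun t => f t - g t) = lattice_sum1 n f - lattice_sum1 n g.
Proof. by rewrite /lattice_sum1 -sumrB; apply: eq_bigr => j _; ring. Qed.

Lemma lattice_sumB n d (f g : 'cV[R]_d -> R) :
  lattice_sum n (fun x => f x - g x) = lattice_sum n f - lattice_sum n g.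
Proof.
elim: d f g => [//|d IH] f g /=; rewrite -IH; congr lattice_sum; apply/funext => v.
exact: lattice_sum1B.
Qed.

Lemma lattice_sum_le n d (f : 'cV[R]_d -> R) C : (forall x, `|f x| <= C * wt x) ->
  `|lattice_sum n f| <= C * 8 ^+ d.
Proof.
elim: d f C => [|d IH] f C fC /=; first by rewrite (le_trans (fC 0))// /wt big_ord0 expr0.
rewrite exprS mulrA; apply: IH => v; rewrite mulrAC; apply: lattice_sum1_le => t.
by rewrite (le_trans (fC _))// wt_ccons mulrAC mulrA.
Qed.

Lemma tail1_cvg0 : (@tail1 R) @ \oo --> (0 : R).
Proof.
by rewrite -[0](mulr0 8); apply: cvgMl_tmp; exact: cvg_harmonic.
Qed.

Lemma tailC_cvg0 (D : R) : (fun n => D * tail1 R n) @ \oo --> (0 : R).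
Proof. by rewrite -[0](mulr0 D); apply: cvgMl_tmp; exact: tail1_cvg0. Qed.

Lemma slice_integral_lip d (f : 'cV[R]_d.+1 -> R) C : wlipC C f ->
  let H t := integralR (fun v => f (ccons t v)) in
  (forall t, `|H t| <= C * IntK R ^+ d * w1 t) /\
  (forall t h : R, `|h| <= 1 -> `|H (t + h) - H t| <= C * IntK R ^+ d * `|h| * w1 t).
Proof.
move=> fC; have [f1 f2] := fC; have ws t : wlip (fun v => f (ccons t v)).
  by exists (C * w1 t); exact: wlipC_slice.
split=> [t|t h h1].
  rewrite mulrAC; apply: integralR_le => // v.
  by rewrite -mulrA -wt_ccons.
rewrite -integralRB// (_ : _ * w1 t = C * `|h| * w1 t * IntK R ^+ d); last by ring.
apply: integralR_le; first exact: wlipB.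
by move=> v; rewrite -ccons_addl (le_trans (f2 _ _ _ h1))// wt_ccons mulrA.
Qed.

Definition vanishing_coefficients d (F : 'cV[R]_d -> R) := forall l : 'cV[int]_d, l != 0 ->
  forall b, integralR (fun x => F x * tg b (dot ((2 * pi) *: ZtoR l) x)) = 0.

Lemma map_intr_ccons d l (l' : 'cV[int]_d) :
  ZtoR (col_mx (l%:M : 'cV[int]_1) l') = ccons (l%:~R) (ZtoR l').
Proof. by rewrite map_col_mx map_scalar_mx. Qed.

Lemma dot_lattice_ccons d l (l' : 'cV[int]_d) t v :
  dot ((2 * pi) *: ZtoR (col_mx (l%:M : 'cV[int]_1) l')) (ccons t v) =
  dot ((2 * pi) *: ZtoR l') v + 2 * pi * l%:~R * t :> R.
Proof.
rewrite map_intr_ccons /ccons scale_col_mx scale_scalar_mx.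
by rewrite (dot_ccons (2 * pi * l%:~R)) addrC.
Qed.

Lemma lattice_ccons_neq0 d l (l' : 'cV[int]_d) : (l != 0) || (l' != 0) ->
  col_mx (l%:M : 'cV[int]_1) l' != 0.
Proof.
apply: contraLR; rewrite negb_or !negbK col_mx_eq0 => /andP[/eqP/matrixP/(_ 0 0) + ->].
by rewrite !mxE eqxx mulr1n => ->; rewrite eqxx.
Qed.

Lemma tg_mul_cos b y z : tg b y * cos z = 2^-1 * (tg b (y + z) + tg b (y - z)) :> R.
Proof. by case: b; rewrite /tg/= ?(cosD, sinD) ?(cosN, sinN) ?(cosD, sinD) ?(cosN, sinN); field. Qed.

Section Step.
Variables (d : nat) (F : 'cV[R]_d.+1 -> R) (C : R).
Hypothesis FC : wlipC C F.
Hypothesis F_coef : vanishing_coefficients F.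

Let wF : wlip F. Proof. by exists C. Qed.
Let C0 : 0 <= C. Proof. exact: wlipC_ge0 FC. Qed.

Let slice_int b (l : 'cV[int]_d) t := integralR (fun v => F (ccons t v) * tg b (dot ((2 * pi) *: ZtoR l) v)).

Let slice_int_lip b l : exists D, wlipC D (fun x => F x * tg b (dot ((2 * pi) *: ZtoR (col_mx (0%:M : 'cV[int]_1) l)) x)).
Proof. exact: wlip_tg_dot. Qed.

Let slice_intE b l t : slice_int b l t = integralR (fun v =>
  (fun x => F x * tg b (dot ((2 * pi) *: ZtoR (col_mx (0%:M : 'cV[int]_1) l)) x)) (ccons t v)).
Proof.
by congr integralR; apply/funext => v; rewrite dot_lattice_ccons mulr0 mul0r addr0.
Qed.

Let Int_slice b l : Int (slice_int b l) =
  integralR (fun x => F x * tg b (dot ((2 * pi) *: ZtoR (col_mx (0%:M : 'cV[int]_1) l)) x)).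
Proof. by rewrite integralRS; congr Int; apply/funext => t; rewrite slice_intE. Qed.

Let slice_coef b l (l1 : int) : l1 != 0 ->
  Int (fun t => slice_int b l t * cos (2 * pi * l1%:~R * t)) = 0.
Proof.
move=> l10.
have nz (m : int) : m != 0 -> col_mx (m%:M : 'cV[int]_1) l != 0.
  by move=> m0; apply: lattice_ccons_neq0; rewrite m0.
have wt' m := wlip_tg_dot b ((2 * pi) *: ZtoR (col_mx (m%:M : 'cV[int]_1) l)) wF.
transitivity (2^-1 * (
  integralR (fun x => F x * tg b (dot ((2 * pi) *: ZtoR (col_mx (l1%:M : 'cV[int]_1) l)) x)) +
  integralR (fun x => F x * tg b (dot ((2 * pi) *: ZtoR (col_mx ((- l1)%:M : 'cV[int]_1) l)) x)))); last first.
  by rewrite !F_coef ?nz ?oppr_eq0// addr0 mulr0.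
rewrite -integralRD// -integralRZ; last exact: wlipD.
rewrite integralRS; congr Int; apply/funext => t.
rewrite mulrC -integralRZ; last first.
  have [D DP] := slice_int_lip b l; exists (D * w1 t); have := wlipC_slice t DP.
  by congr wlipC; apply/funext => v; rewrite dot_lattice_ccons mulr0 mul0r addr0.
congr integralR; apply/funext => v.
rewrite !dot_lattice_ccons rmorphN/= mulrN mulNr.
transitivity (F (ccons t v) * (tg b (dot ((2 * pi) *: ZtoR l) v) * cos (2 * pi * l1%:~R * t))).
  by ring.
by rewrite tg_mul_cos; ring.
Qed.

Let Gn n (v : 'cV[R]_d) := lattice_sum1 n (fun t => F (ccons t v)).

Let F_slice_le v t : `|F (ccons t v)| <= C * wt v * w1 t.
Proof. by have [f1 _] := FC; rewrite (le_trans (f1 _))// wt_ccons mulrAC mulrA. Qed.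

Let Gn_tail n n' v : (n <= n')%N -> `|Gn n' v - Gn n v| <= C * wt v * tail1 R n.
Proof. by move=> nn; apply: lattice_sum1_tail nn; exact: F_slice_le. Qed.

Let G_ex v : exists g : R, (fun n => Gn n v) @ \oo --> g.
Proof.
apply/cvg_ex/cauchy_cvgP/cauchy_exP => e e0.
have /cvgrPdist_lt/(_ e e0)[n _ Hn] := tailC_cvg0 (C * wt v).
exists (Gn n v); exists n => // n' /= nn; rewrite /ball/= distrC.
apply: le_lt_trans (Gn_tail v nn) _.
have := Hn n (leqnn n); rewrite /= sub0r normrN; apply: le_lt_trans; exact: ler_norm.
Qed.

Let G v := projT1 (cid (G_ex v)).

Let G_cvg v : (fun n => Gn n v) @ \oo --> G v.
Proof. exact: projT2 (cid (G_ex v)). Qed.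

Let G_tail n v : `|G v - Gn n v| <= C * tail1 R n * wt v.
Proof.
rewrite mulrAC; apply: (norm_cvg_le (u := fun n' => Gn n' v - Gn n v) (n0 := n)).
  by apply: cvgB; [exact: G_cvg|exact: cvg_cst].
by move=> n' nn; exact: Gn_tail.
Qed.

Let Gn_wlip n : wlipC (C * 8) (Gn n).
Proof.
split=> [v|v i h h1]; first by rewrite mulrAC; apply: lattice_sum1_le; exact: F_slice_le.
rewrite /Gn -lattice_sum1B (_ : _ * wt v = C * `|h| * wt v * 8); last by ring.
apply: lattice_sum1_le => t; have [_ f2] := FC.
by rewrite -ccons_addr (le_trans (f2 _ _ _ h1))// wt_ccons; apply: eq_ler; ring.
Qed.

Let G_wlip : wlipC (C * 8) G.
Proof.
split=> [v|v i h h1].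
  by apply: (norm_cvg_le (u := fun n => Gn n v) (n0 := 0)) => // n _; case: (Gn_wlip n).
apply: (norm_cvg_le (u := fun n => Gn n (v + h *: delta_mx i 0) - Gn n v) (n0 := 0)).
  by apply: cvgB; exact: G_cvg.
by move=> n _; case: (Gn_wlip n) => _; apply.
Qed.

Let integral_Gn b l n : integralR (fun v => Gn n v * tg b (dot ((2 * pi) *: ZtoR l) v)) =
  lattice_sum1 n (slice_int b l).
Proof.
have ws t : wlip (fun v => F (ccons t v)) by exists (C * w1 t); exact: wlipC_slice.
rewrite /Gn /lattice_sum1; elim: n => [|n IH].
  by rewrite big_nil; under eq_fun do rewrite big_nil mul0r; exact: integralR0.
rewrite big_nat_recr//= -IH /slice_int -!integralRD; try exact: wlip_tg_dot.
- by congr integralR; apply/funext => v; rewrite big_nat_recr//=; ring.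
- by apply: wlip_tg_dot; exists (C * 8); exact: Gn_wlip.
- by under eq_fun do rewrite -mulrDl; apply: wlip_tg_dot; exact: wlipD.
Qed.

Let integral_G b l : integralR (fun v => G v * tg b (dot ((2 * pi) *: ZtoR l) v)) =
  integralR (fun x => F x * tg b (dot ((2 * pi) *: ZtoR (col_mx (0%:M : 'cV[int]_1) l)) x)).
Proof.
have [D DP] := slice_int_lip b l; have [h1 h2] := slice_integral_lip DP.
have cf := slice_coef b l.
have a1 : (fun n => lattice_sum1 n (slice_int b l)) @ \oo --> Int (slice_int b l).
  pose B := D * IntK R ^+ d.
  have ap n : `|Int (slice_int b l) - lattice_sum1 n (slice_int b l)| <= B * tail1 R n.
    apply: lattice_sum1_approx => // [t|t h]; first by rewrite slice_intE; exact: h1.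
    by rewrite !slice_intE; exact: h2.
  exact: cvg_dist_le ap (tailC_cvg0 B).
have a2 : (fun n => integralR (fun v => Gn n v * tg b (dot ((2 * pi) *: ZtoR l) v))) @ \oo -->
    integralR (fun v => G v * tg b (dot ((2 * pi) *: ZtoR l) v)).
  apply: (integralR_dominated (C := C * 8)).
  - by move=> n; apply: wlip_tg_dot; exists (C * 8); exact: Gn_wlip.
  - by apply: wlip_tg_dot; exists (C * 8); exact: G_wlip.
  - move=> n v; rewrite normrM; have [g1 _] := Gn_wlip n.
    by rewrite -[leRHS]mulr1 ler_pM// tg_le1.
  - by move=> v; apply: cvgMr_tmp; exact: G_cvg.
rewrite -Int_slice.
have E2 : (fun n => integralR (fun v => Gn n v * tg b (dot ((2 * pi) *: ZtoR l) v))) =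
  (fun n => lattice_sum1 n (slice_int b l)) by apply/funext => n; exact: integral_Gn.
rewrite E2 in a2.
by rewrite -(cvg_lim (@Rhausdorff R) a1); apply/esym/cvg_lim.
Qed.

(** The Fourier coefficients of the sum over the first coordinate are sums over the integers of
    partial Fourier integrals.  By [lattice_sum1_approx] they equal the coefficients of [F] at the
    frequencies with first coordinate 0. *)
Lemma lattice_sum_step : exists G : 'cV[R]_d -> R, [/\ wlip G, vanishing_coefficients G,
  integralR G = integralR F &
  forall n, `|lattice_sum n G - lattice_sum n F| <= C * tail1 R n * 8 ^+ d].
Proof.
exists G; split.
- by exists (C * 8); exact: G_wlip.
- by move=> l l0 b; rewrite integral_G F_coef//; apply: lattice_ccons_neq0; rewrite l0 orbT.
- have := integral_G true 0; rewrite (_ : col_mx _ _ = 0); last by rewrite raddf0 col_mx0.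
  have dz k (x : 'cV[R]_k) : tg true (dot ((2 * pi) *: ZtoR 0) x) = 1.
    by rewrite map_mx0 scaler0 dot0l /tg cos0.
  move=> E; transitivity (integralR (fun v => G v * tg true (dot ((2 * pi) *: ZtoR 0) v))); last first.
    by rewrite E; congr integralR; apply/funext => x; rewrite dz mulr1.
  by congr integralR; apply/funext => x; rewrite dz mulr1.
- by move=> n /=; rewrite -lattice_sumB; apply: lattice_sum_le => v; exact: G_tail.
Qed.

End Step.

Lemma lattice_sum_approx d (F : 'cV[R]_d -> R) : wlip F -> vanishing_coefficients F ->
  exists A, forall n, `|integralR F - lattice_sum n F| <= A * tail1 R n.
Proof.
elim: d F => [|d IH] F wF F0; first by exists 0 => n; rewrite /= subrr normr0 mul0r.
have [C FC] := wF; have [G [wG G0 GF Gs]] := lattice_sum_step FC F0.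
have [A AP] := IH G wG G0; exists (A + C * 8 ^+ d) => n.
rewrite -GF -(subrK (lattice_sum n G) (integralR G)) -addrA mulrDl.
by rewrite (le_trans (ler_normD _ _))// lerD// (le_trans (Gs n))// mulrAC.
Qed.

End LatticeSum.

(** * Unordered sums over the lattice *)

Section Boxes.
Variable R : realType.
Local Notation ZtoR := (map_mx (intr : int -> R)).

Definition int_range n : seq int :=
  [seq Negz j | j <- iota 0 n] ++ [seq Posz j | j <- iota 0 n].

Definition int_rank (m : int) := match m with Posz j => j | Negz j => j end.

Lemma mem_int_range n m : (m \in int_range n) = (int_rank m < n)%N.
Proof.
rewrite mem_cat; apply/orP/idP.
  by case=> /mapP[j + ->]; rewrite mem_iota.
by case: m => j /= jn; [right|left]; rewrite mem_map ?mem_iota// => ? ? [].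
Qed.

Lemma uniq_int_range n : uniq (int_range n).
Proof.
rewrite cat_uniq !map_inj_uniq ?iota_uniq//=; try by move=> ? ? [].
by rewrite andbT; apply/hasPn => _ /mapP[j _ ->]; apply/negP => /mapP[].
Qed.

Lemma lattice_sum1E n (h : R -> R) : lattice_sum1 n h = \sum_(m <- int_range n) h m%:~R.
Proof.
rewrite /lattice_sum1 big_cat !big_map /index_iota subn0 big_split/=.
by congr (_ + _); apply: eq_bigr => j _; rewrite NegzE rmorphN.
Qed.

Fixpoint box n d : seq 'cV[int]_d :=
  match d with
  | 0 => [:: 0]
  | k.+1 => [seq col_mx (m%:M : 'cV[int]_1) v | v <- box n k, m <- int_range n]
  end.

Lemma lattice_sumE n d (f : 'cV[R]_d -> R) : lattice_sum n f = \sum_(k <- box n d) f (ZtoR k).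
Proof.
elim: d f => [|d IH] f /=; first by rewrite big_seq1 map_mx0.
rewrite IH big_allpairs_dep/=; apply: eq_bigr => v _; rewrite lattice_sum1E.
by apply: eq_bigr => m _; rewrite map_intr_ccons.
Qed.

Lemma uniq_box n d : uniq (box n d).
Proof.
elim: d => [//|d IH] /=; apply: allpairs_uniq; [exact: IH|exact: uniq_int_range|].
move=> [v m] [v' m'] _ _ /= E; have [/matrixP/(_ 0 0) + ->] := @eq_col_mx int 1 d 1 _ _ _ _ E.
by rewrite !mxE !eqxx !mulr1n => ->.
Qed.

Lemma mem_box n d (k : 'cV[int]_d) : (forall i, (int_rank (k i 0%R) < n)%N) -> k \in box n d.
Proof.
elim: d k => [|d IH] k kn; first by rewrite (flatmx0 k) mem_seq1.
rewrite -[k](@vsubmxK _ 1 d); apply/allpairsP.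
exists (@dsubmx _ 1 d 1 k, (@usubmx _ 1 d 1 k) 0 0); split=> /=.
- by apply: IH => i; rewrite mxE.
- by rewrite mem_int_range mxE.
- by rewrite -mx11_scalar.
Qed.

Lemma box_sub n n' d : (n <= n')%N -> {subset box n d <= box n' d}.
Proof.
move=> nn; elim: d => [//|d IH] k /= /allpairsP[[v m] [/= vn mn ->]].
apply/allpairsP; exists (v, m); split=> //=; first exact: IH.
by move: mn; rewrite !mem_int_range => /leq_trans; apply.
Qed.

Lemma box_exhausts d (s : seq 'cV[int]_d) : exists n, forall n', (n <= n')%N -> {subset s <= box n' d}.
Proof.
exists (\sum_(k <- s) \sum_i (int_rank (k i 0%R)).+1)%N => n' nn k ks.
apply: mem_box => i; apply: leq_trans nn.
by rewrite (big_rem k)//= (bigD1 i)//= -addnA leq_addr.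
Qed.

Lemma sum_subset (T : eqType) (s s' : seq T) (f : T -> R) : uniq s -> uniq s' -> {subset s <= s'} ->
  \sum_(k <- s') f k = \sum_(k <- s) f k + \sum_(k <- s' | k \notin s) f k.
Proof.
move=> us us' ss; rewrite (bigID (mem s)) /=; congr (_ + _).
rewrite -big_filter; apply: perm_big; apply: uniq_perm; rewrite ?filter_uniq// => k.
by rewrite mem_filter; apply: andb_idr; exact: ss.
Qed.

Lemma sum_subset_le (T : eqType) (s s' : seq T) (f : T -> R) : uniq s -> uniq s' -> {subset s <= s'} ->
  (forall k, 0 <= f k) -> \sum_(k <- s) f k <= \sum_(k <- s') f k.
Proof. by move=> us us' ss f0; rewrite (sum_subset f us us' ss) lerDl sumr_ge0. Qed.

(** Outside a large box the sum of the weights is small, since its sums over boxes increase and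
    are bounded. *)
Lemma lattice_sum_net d (F : 'cV[R]_d -> R) C A S e : (forall x, `|F x| <= C * wt x) ->
  (forall n, `|S - lattice_sum n F| <= A * tail1 R n) -> 0 < e ->
  exists B : seq 'cV[int]_d, forall J : seq 'cV[int]_d, uniq J -> {subset B <= J} ->
    `|S - \sum_(k <- J) F (ZtoR k)| < e.
Proof.
move=> FC FS e0; pose x n := lattice_sum n (@wt R d).
have C0 : 0 <= C by rewrite -(pmulr_lge0 _ (wt_gt0 (0 : 'cV[R]_d))) (le_trans _ (FC 0)).
have x_mono : {homo x : n m / (n <= m)%N >-> n <= m}.
  move=> n m nm; rewrite /x !lattice_sumE; apply: sum_subset_le; rewrite ?uniq_box//.
    exact: box_sub.
  by move=> k; exact: wt_ge0.
have x_le n : x n <= 8 ^+ d.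
  have h := @lattice_sum_le R n d (@wt R d) 1; rewrite mul1r in h.
  by apply: le_trans (ler_norm _) (h _) => y; rewrite mul1r ger0_norm ?wt_ge0.
have /cvg_ex[X xX] : cvgn x.
  by apply: nondecreasing_is_cvgn => //; exists (8 ^+ d) => _ [n _ <-]; exact: x_le.
have xleX n : x n <= X.
  by rewrite -(cvg_lim (@Rhausdorff R) xX); apply: nondecreasing_cvgn_le => //; apply/cvg_ex; exists X.
have e2 : 0 < e / 2 by rewrite divr_gt0.
have /cvgrPdist_lt/(_ (e / 2) e2)[n1 _ H1] := tailC_cvg0 A.
have d0 : 0 < e / 2 / (C + 1) by rewrite divr_gt0// ltr_wpDl.
have /cvgrPdist_lt/(_ _ d0)[n2 _ H2] := xX.
pose n := maxn n1 n2; exists (box n d) => J uJ BJ.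
(* [J] lies between two boxes, the smaller of which carries almost all of the weight *)
have [m mJ] := box_exhausts J.
have h1 : A * tail1 R n < e / 2.
  have := H1 n (leq_maxl _ _); rewrite /= sub0r normrN; exact: le_lt_trans (ler_norm _).
have h2 : C * (X - x n) <= e / 2.
  have := H2 n (leq_maxr _ _); rewrite /= ger0_norm ?subr_ge0// ltr_pdivlMr ?ltr_wpDl// => /ltW.
  by apply: le_trans; rewrite mulrC ler_wpM2l ?subr_ge0// lerDl.
have h3 : `|\sum_(k <- J | k \notin box n d) F (ZtoR k)| <= C * (X - x n).
  apply: (@le_trans _ _ (C * \sum_(k <- J | k \notin box n d) wt (ZtoR k))).
    rewrite (le_trans (ler_norm_sum _ _ _))// mulr_sumr; apply: ler_sum => k _; exact: FC.
  rewrite ler_wpM2l// lerBrDl {1}/x lattice_sumE -sum_subset ?uniq_box//.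
  apply: le_trans (xleX m); rewrite /x lattice_sumE; apply: sum_subset_le; rewrite ?uniq_box//.
    exact: mJ.
  by move=> k; exact: wt_ge0.
rewrite (sum_subset _ (uniq_box n d) uJ BJ) -lattice_sumE opprD addrA.
rewrite (le_lt_trans (ler_normB _ _))// (splitr e).
by apply: ltr_leD; [apply: le_lt_trans h1|apply: le_trans h2].
Qed.

End Boxes.

(** * Poisson summation and the partition of unity *)

Section PoissonSummation.
Variables (R : realType) (d : nat).
Local Notation ZtoR := (map_mx (intr : int -> R)).
Local Notation Re := (@complex.Re R).
Local Notation Im := (@complex.Im R).

(** Comparing l with - l separates the cosine coefficients from the sine coefficients. *)
Lemma vanishing_coefficientsC (f : 'cV[R]_d -> R[i]) : schC f ->
  (forall l : 'cV[int]_d, l != 0 ->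
     integralC (fun x => f x * ei (dot ((2 * pi) *: ZtoR l) x)) = 0) ->
  vanishing_coefficients (fun x => Re (f x)) /\ vanishing_coefficients (fun x => Im (f x)).
Proof.
move=> sf f0; have [wr wi] := schC_cwlip sf.
pose I h b (l : 'cV[int]_d) := integralR (fun x => h (f x) * tg b (dot ((2 * pi) *: ZtoR l) x)).
have E l : l != 0 -> I Re true l + I Im false l = 0 /\ I Im true l - I Re false l = 0.
  move=> l0; set eta := (2 * pi) *: ZtoR l.
  have [] : Re (integralC (fun x => f x * ei (dot eta x))) = 0 /\
            Im (integralC (fun x => f x * ei (dot eta x))) = 0 by rewrite f0.
  rewrite /integralC /=.
  under eq_fun do rewrite Re_mulc; under [X in _ -> integralR X = 0 -> _]eq_fun do rewrite Im_mulc.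
  rewrite /I => hr hi; split.
    rewrite -integralRD; try exact: wlip_tg_dot.
    by rewrite -[RHS]hr; congr integralR; apply/funext => x; rewrite /ei/= /tg; ring.
  rewrite -integralRB; try exact: wlip_tg_dot.
  by rewrite -[RHS]hi; congr integralR; apply/funext => x; rewrite /ei/= /tg; ring.
have dN (l : 'cV[int]_d) x : dot ((2 * pi) *: ZtoR (- l)) x = - dot ((2 * pi) *: ZtoR l) x.
  by rewrite map_mxN scalerN dotNl.
have even h l : I h true (- l) = I h true l.
  by congr integralR; apply/funext => x; rewrite dN /tg cosN.
have odd h l : wlip (fun x => h (f x)) -> I h false (- l) = - I h false l.
  move=> wh; rewrite -mulN1r -integralRZ; last exact: wlip_tg_dot.
  by congr integralR; apply/funext => x; rewrite dN /tg sinN; ring.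
split=> l l0 b; have [e1 e2] := E l l0; have [|] := E (- l); rewrite ?oppr_eq0// !even !odd// => e3 e4.
  by case: b; rewrite -/(I Re _ l); lra.
by case: b; rewrite -/(I Im _ l); lra.
Qed.

Lemma poisson_summation (f : 'cV[R]_d -> R[i]) : schC f ->
  (forall l : 'cV[int]_d, l != 0 ->
     integralC (fun x => f x * ei (dot ((2 * pi) *: ZtoR l) x)) = 0) ->
  partial_sum (fun k : 'cV[int]_d => f (ZtoR k)) @ totally -->
    (integralC f : (R[i] : numFieldType)).
Proof.
move=> sf f0; have [vr vi] := vanishing_coefficientsC sf f0.
have [wr wi] := schC_cwlip sf.
have [A AP] := lattice_sum_approx wr vr; have [D DP] := lattice_sum_approx wi vi.
have [Cr [Cr1 _]] := wr; have [Ci [Ci1 _]] := wi.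
have PF := @totally_filter 'cV[int]_d.
apply/(@cvgrPdist_lt (R[i] : numFieldType) ((R[i] : numFieldType)^o)) => e e0.
have [er eE] : exists r : R, e = r%:C%C.
  by exists (Re e); move: e0; case: (e) => a b; rewrite ltcE/= => /andP[/eqP -> _].
rewrite eE ltcR in e0 *.
(* one half for the real part and one half for the imaginary part *)
have e2 : 0 < er / 2 by rewrite divr_gt0.
have [Br BrP] := lattice_sum_net Cr1 AP e2; have [Bi BiP] := lattice_sum_net Ci1 DP e2.
exists [fset k | k in Br ++ Bi]%fset => // J /= BJ.
have sub k : k \in Br ++ Bi -> k \in (J : seq _).
  move=> kB; apply: (fsubsetP BJ); by rewrite !inE -mem_cat.
have hr : {subset Br <= (J : seq _)} by move=> k kB; apply: sub; rewrite mem_cat kB.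
have hi : {subset Bi <= (J : seq _)} by move=> k kB; apply: sub; rewrite mem_cat kB orbT.
have -> : partial_sum (fun k : 'cV[int]_d => f (ZtoR k)) J = \sum_(k <- J) f (ZtoR k).
  by rewrite /partial_sum big_seq_fsetE.
have ReS (s : seq 'cV[int]_d) : Re (\sum_(k <- s) f (ZtoR k)) = \sum_(k <- s) Re (f (ZtoR k)).
  by elim: s => [|k s IH]; rewrite ?big_nil// !big_cons Re_addc IH.
have ImS (s : seq 'cV[int]_d) : Im (\sum_(k <- s) f (ZtoR k)) = \sum_(k <- s) Im (f (ZtoR k)).
  by elim: s => [|k s IH]; rewrite ?big_nil// !big_cons Im_addc IH.
rewrite normC_cabs ltcR (le_lt_trans (cabs_le_ReIm _))// (splitr er) ltrD//.
  have := BrP J (fset_uniq J) hr; rewrite -ReS; congr (`|_| < _).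
  by case: (\sum_(k <- J) f (ZtoR k)).
have := BiP J (fset_uniq J) hi; rewrite -ImS; congr (`|_| < _).
by case: (\sum_(k <- J) f (ZtoR k)).
Qed.

End PoissonSummation.

Section ConvolutionPowers.
Variables (R : realType) (d : nat).
Implicit Types (phi : functional R d) (h : 'cV[R]_d -> R[i]).

(** Each convolution with [phi] applies [Phi] once more. *)
Lemma conv_power_Phi phi p h x :
  conv_power phi p.+1 (fun y => h (x + y)) = iter p.+1 (Phi phi) h x.
Proof.
rewrite /conv_power /=; elim: p x => [//|p IH] x.
rewrite iterS /convolution [RHS]/=; congr phi; apply/funext => z.
by rewrite -(IH (x + z)); congr (iter _ _ _ _); apply/funext => y; rewrite addrA.
Qed.

End ConvolutionPowers.

Theorem mainTheorem4 (R : realType) (d : nat) (A : 'M[int]_d) (Q : 'M[R]_d)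
  (m : nat) (phi : functional R d) :
  (0 < d)%N -> (0 < m)%N ->
  real_isotropic_dilation R A ->
  isotropic_factor A Q ->
  elliptic_scaling_function A Q phi ->
  dist_sum
    (fun k : 'cV[int]_d => translate (map_mx intr k) (conv_power phi m))
    (regular (fun _ => 1%R)).
Proof.
move=> d0 m0 dil fac [_ phiE] f /schwartzP sf.
have q1 := dilation_det_gt1 d0 dil; have [QT Qpos _] := fac.
have [L [K [a [rho [N [rho01 K0 a0 LE [Lm Lc]]]]]]] := partial_symbol_estimates d0 q1 fac.
have LR n xi : exists r, ev (L n) xi = r%:C%C by exists (partial_symbol A Q n xi).
have Lc' n xi : `|scaling_symbol A Q xi - complex.Re (ev (L n) xi)| <= K * rho ^+ n / wt xi ^+ N.
  by rewrite LE; exact: Lc.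
have phiE' g : schC g -> phi (fourier g) = integralC (fun xi => (scaling_symbol A Q xi)%:C%C * g xi).
  by move=> sg; apply: phiE; apply/schwartzP.
have Ps g : schC g -> schC (Phi phi g) :=
  @Phi_schC _ _ _ _ _ _ _ _ d0 rho01 K0 a0 LR Lm Lc' _ phiE' g.
have Pc g eta r := @Phi_coefficient _ _ _ _ _ _ _ _ d0 rho01 K0 a0 LR Lm Lc' _ phiE' g eta r.
have sP p : schC (iter p (Phi phi) f) by elim: p => [//|p IH]; rewrite iterS; exact: Ps.
have fourier0 g : fourier g 0 = integralC g.
  by rewrite fourier_ei; congr integralC; apply/funext => x; rewrite dot0l ei0 mulr1.
(* the symbol is 1 at the origin *)
have mean p : integralC (iter p (Phi phi) f) = integralC f.
  elim: p => [//|p IH]; rewrite iterS -fourier0 fourier_ei (Pc _ _ 1) ?mul1r//.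
    by rewrite fourier0.
  exists 0%N => n _; rewrite LE oppr0 partial_symbol_0//; exact: elliptic_mask0.
case: m m0 => [//|p] _.
(* the symbol vanishes at the nonzero points of the dual lattice *)
have zero (l : 'cV[int]_d) : l != 0 -> integralC (fun x => iter p.+1 (Phi phi) f x *
    ei (dot ((2 * pi) *: map_mx intr l) x)) = 0.
  move=> l0; rewrite iterS (Pc _ _ 0) ?mul0r//.
  have [|n0 H] := @partial_symbol_lattice R d A Q (- l) d0 q1 fac; first by rewrite oppr_eq0.
  by exists n0 => n nn; rewrite LE -scalerN -map_mxN H.
have := poisson_summation (sP p.+1) zero; rewrite mean.
have -> : regular (fun _ => 1) f = integralC f.
  by congr integralC; apply/funext => x; rewrite mul1r.
have -> : (fun k : 'cV[int]_d => iter p.+1 (Phi phi) f (map_mx intr k)) =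
    (fun k => translate (map_mx intr k) (conv_power phi p.+1) f).
  apply/funext => k; rewrite -conv_power_Phi /translate; congr conv_power.
  by apply/funext => x; rewrite addrC.
by [].
Qed.
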